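(* Let $Q$ be a quiver, $\mathbb{C}Q$ its path algebra and $\mathbb{D}\mathrm{er}(\mathbb{C}Q)$ its bimodule of double derivations. Then $$T_{\mathbb{C}Q}\mathbb{D}\mathrm{er}(\mathbb{C}Q)\big/[T_{\mathbb{C}Q}\mathbb{D}\mathrm{er}(\mathbb{C}Q),T_{\mathbb{C}Q}\mathbb{D}\mathrm{er}(\mathbb{C}Q)]\;\cong\;\mathfrak{n}_Q$$ as graded Lie algebras, where the left-hand side carries the bracket $\{-,-\}$ induced by the double Schouten bracket and $\mathfrak{n}_Q$ is the graded necklace Lie algebra with the graded Kontsevich bracket.
   Context: $\mathbb{C}$ denotes an algebraically closed field of characteristic $0$ and unadorned tensor products are over $\mathbb{C}$; $Q$ is a quiver with set of arrows $Q_1$; $t(a)$, $h(a)$ are the tail and head of an arrow $a$, $e_v$ is the idempotent of a vertex $v$, and paths are multiplied so that $a=e_{t(a)}ae_{h(a)}$. Double derivations. For $A=\mathbb{C}Q$, $\mathbb{D}\mathrm{er}(A)=\mathrm{Der}(A,A\otimes A)$ is the space of all derivations $\delta:A\to A\otimes A$, for the outer bimodule structure $a(a'\otimes a'')b=aa'\otimes a''b$; it is an $A$-bimodule by $(a\delta b)(c)=\delta(c)'b\otimes a\delta(c)''$ (Sweedler notation $\delta(c)=\delta(c)'\otimes\delta(c)''$). $T=T_A\mathbb{D}\mathrm{er}(A)$ is its tensor algebra, graded with $|A|=0$, $|\mathbb{D}\mathrm{er}(A)|=1$; $[T,T]$ is the span of all supercommutators $uv-(-1)^{|u||v|}vu$.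 Double Schouten bracket (Van den Bergh). It is the unique bilinear map $\{\!\!\{-,-\}\!\!\}:T\otimes T\to T\otimes T$ with $\{\!\!\{a,b\}\!\!\}=0$ and $\{\!\!\{\delta,a\}\!\!\}=\delta(a)$ for $a,b\in A$, $\delta\in\mathbb{D}\mathrm{er}(A)$; $\{\!\!\{\delta,\Delta\}\!\!\}=\tau_{(23)}\circ\big((\delta\otimes1)\Delta-(1\otimes\Delta)\delta\big)+\tau_{(12)}\circ\big((1\otimes\delta)\Delta-(\Delta\otimes1)\delta\big)$ for $\delta,\Delta\in\mathbb{D}\mathrm{er}(A)$, the two summands (maps $A\to A^{\otimes3}$) being viewed in $\mathbb{D}\mathrm{er}(A)\otimes A$ and $A\otimes\mathbb{D}\mathrm{er}(A)$ respectively, with $\tau_{(ij)}$ exchanging factors $i$ and $j$; and, for homogeneous $u,v,w\in T$, $\{\!\!\{u,vw\}\!\!\}=(-1)^{(|u|-1)|v|}v\{\!\!\{u,w\}\!\!\}+\{\!\!\{u,v\}\!\!\}w$ and $\{\!\!\{u,v\}\!\!\}=-(-1)^{(|u|-1)(|v|-1)}\sigma\{\!\!\{v,u\}\!\!\}$, where $\sigma(a\otimes b)=(-1)^{|a||b|}b\otimes a$. The bracket $\{-,-\}=\mu\circ\{\!\!\{-,-\}\!\!\}$ ($\mu$ the multiplication) induces a graded Lie bracket on $T/[T,T]$ with degrees shifted by one, $(T/[T,T])[1]$. Graded necklace Lie algebra. The double quiver $\overline{Q}$ is obtained from $Q$ by adding for each arrow $a$ of $Q$ an arrow $a^*$ in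 the opposite direction. Grade $\mathbb{C}\overline{Q}$ by $|a|=0$, $|a^*|=1$ for $a\in Q_1$. As a graded space $\mathfrak{n}_Q=\mathbb{C}\overline{Q}/[\mathbb{C}\overline{Q},\mathbb{C}\overline{Q}]_{super}$ (quotient by the span of supercommutators); it is spanned by closed paths with a marked starting point (ornate necklaces). The graded Kontsevich bracket of two such necklaces $w_1,w_2$ is $$\{w_1,w_2\}=\sum_{a\in Q_1}\Big(\sum(-1)^{(|w_1|-1)|p_2|+|p_1||q_1|+1}\,p_2q_1p_1q_2+\sum(-1)^{(|w_2|-1)|p_2|+|p_1||q_1|}\,p_1q_2p_2q_1\Big),$$ where the first inner sum runs over all factorizations $w_1=p_1\,a\,q_1$, $w_2=p_2\,a^*q_2$, and the second over all factorizations $w_1=p_1a^*q_1$, $w_2=p_2\,a\,q_2$. (So in each term $a$ and $a^*$ are removed, the open necklaces are joined, and the starting point kept is that of the necklace which contained $a^*$.) The space $\mathfrak{n}_Q$ equipped with this bracket is the graded necklace Lie algebra.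
   Formalization: Q is finite; double derivations are taken relative to the span of the vertex idempotents (they vanish on every e_v); in the second sum of the Kontsevich bracket the sign exponent is (|w_2|-1)|q_1|+|p_2||q_2|, since the printed one is not well defined on n_Q. *)

(* Defs.v *)
From HB Require Import structures.
From mathcomp Require Import all_boot all_order all_algebra.
From mathcomp Require Import finmap.
From mathcomp Require Import boolp functions.
From mathcomp Require Import monalg.

Set Implicit Arguments.
Unset Strict Implicit.
Unset Printing Implicit Defensive.

Import GRing.Theory.
Local Open Scope ring_scope.
Local Open Scope quotient_scope.

Declare Scope tensor_scope.
Local Open Scope tensor_scope.

Definition sgn (C : unitRingType) (k : int) : C := (-1 : C) ^ k.

Definition bilin (C : pzRingType) (U V W : lmodType C) (f : U -> V -> W) :=
  (forall u, linear (f u)) /\ (forall v, linear (f^~ v)).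

Section Span.
Variables (R : pzRingType) (V : lmodType R) (S : V -> Prop).

Inductive lspan : V -> Prop :=
| lspan0 : lspan 0
| lspan_step c x y : S x -> lspan y -> lspan (c *: x + y).

Lemma lspan_gen x : S x -> lspan x.
Proof. by move=> Sx; rewrite -[x]scale1r -[_ *: _]addr0; right=> //; left. Qed.

Lemma lspanD x y : lspan x -> lspan y -> lspan (x + y).
Proof.
move=> Sx Sy; elim: Sx => [|c u v Su _ IH]; first by rewrite add0r.
by rewrite -addrA; right.
Qed.

Lemma lspanZ c x : lspan x -> lspan (c *: x).
Proof.
elim=> [|d u v Su _ IH]; first by rewrite scaler0; left.
by rewrite scalerDr scalerA; right.
Qed.

Definition lspan_pred : {pred V} := fun x => `[< lspan x >].

Lemma lspan_zmod_closed : zmod_closed lspan_pred.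
Proof.
split=> [|x y /asboolP Sx /asboolP Sy]; first by apply/asboolP; left.
by apply/asboolP; apply: lspanD => //; rewrite -scaleN1r; apply: lspanZ.
Qed.
HB.instance Definition _ := GRing.isZmodClosed.Build V lspan_pred
  lspan_zmod_closed.

End Span.

(* The quotient of V by the submodule spanned by S; the construction is sealed,
   so that only the fields of this record are available. *)
Record quotient_module (R : pzRingType) (V : lmodType R) (S : V -> Prop) :=
  QuotientModule {
    qmod : lmodType R;
    qpi : V -> qmod;
    qrepr : qmod -> V;
    qreprK : cancel qrepr qpi;
    qpi_linear : linear qpi;
    qpi_eq : forall x y, qpi x = qpi y <-> lspan S (x - y)
  }.

Module QuotientConstruction.
Section QuotientConstruction.
Variables (R : pzRingType) (V : lmodType R) (S : V -> Prop).
Notation lspan := (lspan S).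
Notation lspan_pred := (lspan_pred S).

Definition mquot := {ideal_quot lspan_pred}.
HB.instance Definition _ := GRing.Zmodule.on mquot.

Definition mpi (x : V) : mquot := \pi x.

Lemma mpi_eq x y : mpi x = mpi y <-> lspan (x - y).
Proof.
rewrite /mpi; split=> [/eqP|h].
  by rewrite -Quotient.idealrBE => /asboolP.
by apply/eqP; rewrite -Quotient.idealrBE; apply/asboolP.
Qed.

Lemma mpi_surj (q : mquot) : {x | q = mpi x}.
Proof. by exists (repr q); rewrite /mpi reprK. Qed.

Lemma mpiD x y : mpi (x + y) = mpi x + mpi y.
Proof. by rewrite /mpi !piE. Qed.

Definition mquot_scale (c : R) (q : mquot) : mquot := mpi (c *: repr q).

Lemma mquot_scaleE c x : mquot_scale c (mpi x) = mpi (c *: x).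
Proof.
apply/mpi_eq; rewrite -scalerBr; apply: lspanZ.
by apply/mpi_eq; rewrite /mpi reprK.
Qed.

Fact mquot_scaleA a b q :
  mquot_scale a (mquot_scale b q) = mquot_scale (a * b) q.
Proof. by have [x ->] := mpi_surj q; rewrite !mquot_scaleE scalerA. Qed.
Fact mquot_scale1 : left_id 1 mquot_scale.
Proof. by move=> q; have [x ->] := mpi_surj q; rewrite mquot_scaleE scale1r. Qed.
Fact mquot_scaleDr : right_distributive mquot_scale +%R.
Proof.
move=> a p q; have [x ->] := mpi_surj p; have [y ->] := mpi_surj q.
by rewrite -mpiD !mquot_scaleE scalerDr mpiD.
Qed.
Fact mquot_scaleDl q : {morph mquot_scale^~ q : a b / a + b}.
Proof.
by move=> a b; have [x ->] := mpi_surj q; rewrite !mquot_scaleE scalerDl mpiD.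
Qed.

HB.instance Definition _ := GRing.Zmodule_isLmodule.Build R mquot
  mquot_scaleA mquot_scale1 mquot_scaleDr mquot_scaleDl.

Fact mpi_is_linear : linear mpi.
Proof. by move=> c x y; rewrite mpiD -mquot_scaleE. Qed.

Definition construction : quotient_module S :=
  @QuotientModule R V S mquot mpi repr (@reprK _ _) mpi_is_linear mpi_eq.
End QuotientConstruction.
End QuotientConstruction.

Lemma quotient_construction (R : pzRingType) (V : lmodType R) (S : V -> Prop) :
  quotient_module S.
Proof. exact: QuotientConstruction.construction. Qed.

Section Quotient.
Variables (R : pzRingType) (V : lmodType R) (S : V -> Prop).

Definition mquot : lmodType R := qmod (quotient_construction S).
Definition mpi : V -> mquot := @qpi R V S (quotient_construction S).
Definition mrepr : mquot -> V := @qrepr R V S (quotient_construction S).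

Lemma mreprK : cancel mrepr mpi. Proof. exact: qreprK. Qed.
Lemma mpi_linear : linear mpi. Proof. exact: qpi_linear. Qed.
HB.instance Definition _ := GRing.isLinear.Build R V mquot _ mpi mpi_linear.
Lemma mpi_eq x y : mpi x = mpi y <-> lspan S (x - y). Proof. exact: qpi_eq. Qed.
Lemma mpi_surj (q : mquot) : {x | q = mpi x}.
Proof. by exists (mrepr q); rewrite mreprK. Qed.

End Quotient.
Arguments mpi {R V} S x.
Arguments mrepr {R V S} q.

(* The free R-module with basis K, and linear extensions of maps given on the
   basis; the construction, by finitely supported functions, is sealed. *)
Record free_module (R : nzRingType) (K : choiceType) := FreeModule {
  fmod : lmodType R;
  fgen : K -> fmod;
  flift : forall V : lmodType R, (K -> V) -> fmod -> V;
  flift_linear : forall (V : lmodType R) (f : K -> V), linear (flift f);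
  fliftE : forall (V : lmodType R) (f : K -> V) k, flift f (fgen k) = f k;
  flift_uniq : forall (V : lmodType R) (f g : fmod -> V), linear f -> linear g ->
    (forall k, f (fgen k) = g (fgen k)) -> f =1 g
}.

Module FreeConstruction.
Section LinearExtension.
Variables (R : nzRingType) (K : choiceType) (V : lmodType R).
Implicit Types (f : K -> V) (x : {malg R[K]}).

Definition mext f x : V := \sum_(k <- msupp x) x@_k *: f k.

Lemma mextEw f x (D : {fset K}) : (msupp x `<=` D)%fset ->
  mext f x = \sum_(k <- D) x@_k *: f k.
Proof.
move=> sD; rewrite /mext (big_fset_incl _ sD) // => k _ kx.
by rewrite mcoeff_outdom // scale0r.
Qed.

Lemma mext_is_linear f : linear (mext f).
Proof.
move=> c x y; pose D := (msupp x `|` (msupp y `|` msupp (c *: x + y)))%fset.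
have sx : (msupp x `<=` D)%fset by apply: fsubsetUl.
have sy : (msupp y `<=` D)%fset.
  by apply: fsubset_trans (fsubsetUr _ _); apply: fsubsetUl.
have sz : (msupp (c *: x + y) `<=` D)%fset.
  by apply: fsubset_trans (fsubsetUr _ _); apply: fsubsetUr.
rewrite (mextEw _ sx) (mextEw _ sy) (mextEw _ sz).
rewrite scaler_sumr -big_split /=; apply: eq_bigr => k _.
by rewrite mcoeffD mcoeffZ scalerDl scalerA.
Qed.

Lemma mextU f k : mext f << k >> = f k.
Proof.
rewrite (@mextEw _ _ [fset k]%fset) ?msuppU_le //.
by rewrite big_seq_fset1 mcoeffUU scale1r.
Qed.

Lemma malg_ext (f g : {malg R[K]} -> V) : linear f -> linear g ->
  (forall k, f << k >> = g << k >>) -> f =1 g.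
Proof.
move=> lf lg fg x.
have l0 (h : {malg R[K]} -> V) : linear h -> h 0 = 0.
  by move=> lh; have := lh (-1) 0 0; rewrite scaler0 addr0 scaleN1r addNr.
rewrite [x]monalgE; elim/big_rec: _ => [|k y _ IH]; first by rewrite !l0.
have -> : << x@_k *g k >> = x@_k *: << k >> :> {malg R[K]}.
  by apply/malgP => j; rewrite mcoeffZ !mcoeffU mulrnAr mulr1.
by rewrite lf lg IH fg.
Qed.

End LinearExtension.

Definition construction (R : nzRingType) (K : choiceType) : free_module R K :=
  @FreeModule R K {malg R[K]} (fun k => << k >>) (@mext R K) (@mext_is_linear R K)
    (@mextU R K) (@malg_ext R K).
End FreeConstruction.

Lemma free_construction (R : nzRingType) (K : choiceType) : free_module R K.
Proof. exact: FreeConstruction.construction. Qed.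

Section Free.
Variables (R : nzRingType) (K : choiceType).

Definition free : lmodType R := fmod (free_construction R K).
Definition gen : K -> free := @fgen R K (free_construction R K).
Definition fext (V : lmodType R) : (K -> V) -> free -> V :=
  @flift R K (free_construction R K) V.

Lemma fext_linear (V : lmodType R) (f : K -> V) : linear (fext f).
Proof. exact: flift_linear. Qed.
HB.instance Definition _ (V : lmodType R) (f : K -> V) :=
  GRing.isLinear.Build R free V _ (fext f) (fext_linear f).
Lemma fextE (V : lmodType R) (f : K -> V) k : fext f (gen k) = f k.
Proof. exact: fliftE. Qed.
Lemma free_ext (V : lmodType R) (f g : free -> V) : linear f -> linear g ->
  (forall k, f (gen k) = g (gen k)) -> f =1 g.
Proof. exact: flift_uniq. Qed.

End Free.
Arguments gen {R K} k.

Section Tensor.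
Variables (C : fieldType) (V W : lmodType C).

Inductive tensor_rel : free C (V * W)%type -> Prop :=
| tensor_rel_l c v v' w :
    tensor_rel (gen (c *: v + v', w) - (c *: gen (v, w) + gen (v', w)))
| tensor_rel_r c v w w' :
    tensor_rel (gen (v, c *: w + w') - (c *: gen (v, w) + gen (v, w'))).

Definition tensor : lmodType C := mquot tensor_rel.

Definition tprod (v : V) (w : W) : tensor := mpi tensor_rel (gen (v, w)).

Lemma tprod_bilin : bilin tprod.
Proof.
split=> [v c w w'|w c v v']; apply: etrans (mpi_linear _ _ _ _);
  apply/mpi_eq; apply: lspan_gen.
- exact: tensor_rel_r.
- exact: tensor_rel_l.
Qed.

Section Lift.
Variables (U : lmodType C) (f : V -> W -> U).

(* the linear map induced by f, meaningful when f is bilinear (tliftE) *)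
Definition tlift (t : tensor) : U :=
  fext (fun vw : V * W => f vw.1 vw.2) (mrepr t).

Hypothesis bf : bilin f.

Let tlift_pi x : tlift (mpi _ x) = fext (fun vw : V * W => f vw.1 vw.2) x.
Proof.
rewrite /tlift; apply/eqP; rewrite -subr_eq0 -linearB.
have /mpi_eq : mpi tensor_rel (mrepr (mpi tensor_rel x)) = mpi tensor_rel x.
  by rewrite mreprK.
elim=> [|c u y [d v v' w|d v w w'] _ /eqP IH]; first by rewrite linear0.
  rewrite linearP IH addr0 linearB linearP /= !fextE /=.
  by rewrite (bf.2 w) subrr scaler0.
rewrite linearP IH addr0 linearB linearP /= !fextE /=.
by rewrite (bf.1 v) subrr scaler0.
Qed.

Lemma tliftE v w : tlift (tprod v w) = f v w.
Proof. by rewrite tlift_pi fextE. Qed.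

Lemma tlift_linear : linear tlift.
Proof.
move=> c s t; have [x ->] := mpi_surj s; have [y ->] := mpi_surj t.
by rewrite -mpi_linear !tlift_pi fext_linear.
Qed.

End Lift.

Lemma tensor_ext (U : lmodType C) (f g : tensor -> U) :
  linear f -> linear g ->
  (forall v w, f (tprod v w) = g (tprod v w)) -> f =1 g.
Proof.
move=> lf lg fg t; have [x ->] := mpi_surj t.
apply: (@free_ext _ _ _ (fun x => f (mpi _ x)) (fun x => g (mpi _ x))).
- by move=> c u v; rewrite mpi_linear lf.
- by move=> c u v; rewrite mpi_linear lg.
- by case=> v w; apply: fg.
Qed.

End Tensor.

Notation "v ⊗ w" := (tprod v w)
  (at level 40, left associativity) : tensor_scope.

Definition tmap (C : fieldType) (V W V' W' : lmodType C)
    (f : V -> V') (g : W -> W') : tensor V W -> tensor V' W' :=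
  tlift (fun v w => f v ⊗ g w).

(* The algebra structures of ssralg are nonzero by definition, which would
   exclude the path algebra of the quiver without vertices. *)
Record algebra (C : fieldType) := Algebra {
  alg_sort :> lmodType C;
  aone : alg_sort;
  amul : alg_sort -> alg_sort -> alg_sort;
  amul_bilin : bilin amul;
  amulA : associative amul;
  amul1l : left_id aone amul;
  amul1r : right_id aone amul
}.
Arguments aone {C a}.
Arguments amul {C a} x y.
Notation "x ∙ y" := (amul x y) (at level 40, left associativity) : ring_scope.

(* the algebra with basis K, product m on the basis and unit e *)
Section BasisAlgebra.
Variables (C : fieldType) (K : choiceType).
Variables (m : K -> K -> free C K) (e : free C K).

Definition bmul (x y : free C K) : free C K :=
  fext (fun p => fext (fun q => m p q) y) x.

Lemma bmulE p q : bmul (gen p) (gen q) = m p q.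
Proof. by rewrite /bmul !fextE. Qed.

Let lin_exchange (V : lmodType C) (c d : C) (x x' y y' : V) :
  c *: (d *: x + x') + (d *: y + y') = d *: (c *: x + y) + (c *: x' + y').
Proof. by rewrite !scalerDr !scalerA [d * c]mulrC addrACA. Qed.

Lemma bmul_bilin : bilin bmul.
Proof.
split=> [x c y z|y c x z]; last by rewrite /bmul fext_linear.
rewrite /bmul; move: x; apply: free_ext => [d u v|d u v|p].
- by rewrite fext_linear.
- by rewrite !fext_linear lin_exchange.
- by rewrite !fextE fext_linear.
Qed.

Hypothesis mA : forall p q r, bmul (gen p) (m q r) = bmul (m p q) (gen r).
Hypothesis m1l : forall p, bmul e (gen p) = gen p.
Hypothesis m1r : forall p, bmul (gen p) e = gen p.

Lemma bmulA : associative bmul.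
Proof.
have [l r] := bmul_bilin.
move=> x y z; move: x; apply: free_ext => [d u v|d u v|p].
- by rewrite r.
- by rewrite !r.
move: y; apply: free_ext => [d u v|d u v|q].
- by rewrite r l.
- by rewrite l r.
move: z; apply: free_ext => [d u v|d u v|s].
- by rewrite !l.
- by rewrite l.
by rewrite !bmulE mA.
Qed.

Lemma bmul1l : left_id e bmul.
Proof.
by apply: free_ext => [d u v|//|p]; rewrite ?(bmul_bilin.1) ?m1l.
Qed.

Lemma bmul1r : right_id e bmul.
Proof.
move=> x; move: x; apply: free_ext => [d u v|//|p]; last exact: m1r.
by rewrite bmul_bilin.2.
Qed.

Definition basis_algebra : algebra C :=
  Algebra bmul_bilin bmulA bmul1l bmul1r.
End BasisAlgebra.

Section AlgebraTheory.
Variables (C : fieldType) (A : algebra C).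

Lemma amulDr (x y z : A) : x ∙ (y + z) = x ∙ y + x ∙ z.
Proof. by have := (amul_bilin A).1 x 1 y z; rewrite !scale1r. Qed.
Lemma amulDl (x y z : A) : (y + z) ∙ x = y ∙ x + z ∙ x.
Proof. by have := (amul_bilin A).2 x 1 y z; rewrite !scale1r. Qed.
Lemma amulr0 (x : A) : x ∙ 0 = 0.
Proof. by apply: (addrI (x ∙ 0)); rewrite -amulDr !addr0. Qed.
Lemma amul0r (x : A) : 0 ∙ x = 0.
Proof. by apply: (addrI (0 ∙ x)); rewrite -amulDl !addr0. Qed.
Lemma amulZr c (x y : A) : x ∙ (c *: y) = c *: (x ∙ y).
Proof. by rewrite -[c *: y]addr0 (amul_bilin A).1 amulr0 addr0. Qed.
Lemma amulZl c (x y : A) : (c *: y) ∙ x = c *: (y ∙ x).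
Proof. by rewrite -[c *: y]addr0 (amul_bilin A).2 amul0r addr0. Qed.

End AlgebraTheory.

Section Algebra.
Variables (C : fieldType) (A : algebra C).

Definition tmul : tensor A A -> A := tlift amul.

Definition outl (a : A) : tensor A A -> tensor A A :=
  tlift (fun x y => (a ∙ x) ⊗ y).
Definition outr (t : tensor A A) (b : A) : tensor A A :=
  tlift (fun x y => x ⊗ (y ∙ b)) t.
Definition inner (a : A) (t : tensor A A) (b : A) : tensor A A :=
  tlift (fun x y => (x ∙ b) ⊗ (a ∙ y)) t.

Lemma outl_bilin a : bilin (fun x y : A => (a ∙ x) ⊗ y).
Proof.
have [l r] := tprod_bilin A A; have [ml mr] := amul_bilin A.
by split=> [x c y y'|y c x x']; rewrite ?ml (l, r).
Qed.

Lemma outr_bilin b : bilin (fun x y : A => x ⊗ (y ∙ b)).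
Proof.
have [l r] := tprod_bilin A A; have [ml mr] := amul_bilin A.
by split=> [x c y y'|y c x x']; rewrite ?mr (l, r).
Qed.

Lemma inner_bilin a b : bilin (fun x y : A => (x ∙ b) ⊗ (a ∙ y)).
Proof.
have [l r] := tprod_bilin A A; have [ml mr] := amul_bilin A.
by split=> [x c y y'|y c x x']; rewrite (ml, mr) (l, r).
Qed.

Lemma outl_linear a : linear (outl a).
Proof. exact/tlift_linear/outl_bilin. Qed.
Lemma outr_linear b : linear (outr^~ b).
Proof. exact/tlift_linear/outr_bilin. Qed.
Lemma inner_linear a b : linear (fun t => inner a t b).
Proof. exact/tlift_linear/inner_bilin. Qed.

Lemma inner_outl a b x t : inner a (outl x t) b = outl x (inner a t b).
Proof.
move: t; apply: tensor_ext => [c s t|c s t|u v].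
- by rewrite outl_linear inner_linear.
- by rewrite inner_linear outl_linear.
- rewrite /outl /inner !(tliftE (outl_bilin _), tliftE (inner_bilin _ _)).
  by rewrite amulA.
Qed.

Lemma inner_outr a b t y : inner a (outr t y) b = outr (inner a t b) y.
Proof.
move: t; apply: tensor_ext => [c s t|c s t|u v].
- by rewrite outr_linear inner_linear.
- by rewrite inner_linear outr_linear.
- rewrite /outr /inner !(tliftE (outr_bilin _), tliftE (inner_bilin _ _)).
  by rewrite amulA.
Qed.

End Algebra.

(* Derivations A -> A ⊗ A relative to a set B of constants.  For a path algebra B
   consists of the vertex idempotents, so that double derivations are bilinear
   over the semisimple subalgebra spanned by them.  This is automatic for one
   vertex; for more vertices it is needed to have a double derivation for each
   arrow and no others up to the bimodule structure: without it, two vertices and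
   no arrow would give nonzero inner double derivations. *)
Section DoubleDerivations.
Variables (C : fieldType) (A : algebra C) (B : A -> Prop).

Definition is_dder (f : A -> tensor A A) : Prop :=
  [/\ linear f,
      forall a b, f (a ∙ b) = outr (f a) b + outl a (f b)
    & forall e, B e -> f e = 0].

Definition is_dder_pred : {pred (A -> tensor A A)} := fun f => `[< is_dder f >].

Lemma is_dder_submod : submod_closed is_dder_pred.
Proof.
split=> [|k f g /asboolP[lf df kf] /asboolP[lg dg kg]]; apply/asboolP.
  split=> [c x y|a b|//]; first by rewrite scaler0 addr0.
  have Z h : linear h -> h (0 : tensor A A) = 0 :> tensor A A.
    by move=> lh; have := lh (-1) 0 0; rewrite scaler0 addr0 scaleN1r addNr.
  by rewrite (Z _ (outl_linear a)) (Z _ (outr_linear b)) addr0.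
have E x : (k *: f + g) x = k *: f x + g x by [].
split=> [c x y|a b|e Be]; rewrite !E.
- rewrite lf lg !scalerDr !scalerA [k * c]mulrC !addrA; congr (_ + _).
  by rewrite -!addrA; congr (_ + _); rewrite addrC.
- rewrite df dg outl_linear outr_linear !scalerDr -!addrA; congr (_ + _).
  by rewrite addrCA.
- by rewrite kf // kg // scaler0 addr0.
Qed.
HB.instance Definition _ := GRing.isSubmodClosed.Build C (A -> tensor A A)
  is_dder_pred is_dder_submod.

Record dder := DDer {
  dder_fun :> A -> tensor A A;
  dderP : is_dder_pred dder_fun
}.
HB.instance Definition _ := [isSub for dder_fun].
HB.instance Definition _ := [Choice of dder by <:].
HB.instance Definition _ := [SubChoice_isSubLmodule of dder by <:].

Lemma dder_bimod_proof a (d : dder) b :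
  is_dder_pred (fun c => inner a (d c) b).
Proof.
have /asboolP[ld dd kd] := dderP d; apply/asboolP.
split=> [c x y|x y|e Be].
- by rewrite ld inner_linear.
- rewrite dd -[outr _ _]scale1r inner_linear scale1r.
  by rewrite inner_outl inner_outr.
- rewrite kd //; have := inner_linear a b (-1) 0 0.
  by rewrite scaler0 addr0 scaleN1r addNr.
Qed.

(* (a d b)(c) = d(c)' b ⊗ a d(c)'' *)
Definition dder_bimod (a : A) (d : dder) (b : A) : dder :=
  DDer (dder_bimod_proof a d b).

End DoubleDerivations.

(* A grading of V is given by its homogeneous parts: deg n x means that x is
   homogeneous of degree n. *)
Section Graded.
Variable C : fieldType.

Inductive supercomm (A : algebra C) (deg : nat -> A -> Prop) : A -> Prop :=
| supercomm_gen m n u v : deg m u -> deg n v ->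
    supercomm deg (u ∙ v - sgn C (m%:Z * n%:Z) *: (v ∙ u)).

Definition superab (A : algebra C) (deg : nat -> A -> Prop) : lmodType C :=
  mquot (supercomm deg).
Definition superab_pi (A : algebra C) (deg : nat -> A -> Prop) :
  A -> superab deg := mpi (supercomm deg).
Definition superab_deg (A : algebra C) (deg : nat -> A -> Prop) (n : nat)
  (y : superab deg) : Prop := exists2 x, deg n x & y = superab_pi deg x.

Definition graded_lie_iso (V W : lmodType C)
    (degV : nat -> V -> Prop) (degW : nat -> W -> Prop)
    (brV : V -> V -> V) (brW : W -> W -> W) (phi : V -> W) : Prop :=
  [/\ linear phi, bijective phi,
      forall n x, degV n x <-> degW n (phi x)
    & forall x y, phi (brV x y) = brW (phi x) (phi y)].

End Graded.

(* T_A(M): the free algebra on letters inl a (a in A) and inr m (m in M), modulo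
   the relations making inl an algebra map, inr linear, and
   inl a · inr m · inl b = inr (act a m b), act being the bimodule structure. *)
Section TensorAlgebra.
Variables (C : fieldType) (A : algebra C) (M : lmodType C).
Variable act : A -> M -> A -> M.

Local Notation word := (seq (A + M)%type).

Let cat_mulA (p q r : word) : bmul (fun s t : word => gen (s ++ t))
    (gen p) (gen (q ++ r) : free C word)
  = bmul (fun s t : word => gen (s ++ t)) (gen (p ++ q)) (gen r).
Proof. by rewrite !bmulE catA. Qed.
Let cat_mul1 (p : word) :
  bmul (fun s t : word => gen (s ++ t)) (gen [::]) (gen p) = gen p :> free C word.
Proof. by rewrite bmulE. Qed.
Let cat_mulr1 (p : word) :
  bmul (fun s t : word => gen (s ++ t)) (gen p) (gen [::]) = gen p :> free C word.
Proof. by rewrite bmulE cats0. Qed.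

Definition free_alg : algebra C := basis_algebra cat_mulA cat_mul1 cat_mulr1.

Definition word_elt (w : word) : free_alg := gen w.
Definition letter (x : A + M) : free_alg := word_elt [:: x].

Inductive talg_rel : free_alg -> Prop :=
| talg_rel_one : talg_rel (letter (inl aone) - aone)
| talg_rel_mul a b :
    talg_rel (letter (inl (a ∙ b)) - letter (inl a) ∙ letter (inl b))
| talg_rel_linA c a b :
    talg_rel (letter (inl (c *: a + b))
              - (c *: letter (inl a) + letter (inl b)))
| talg_rel_linM c m n :
    talg_rel (letter (inr (c *: m + n))
              - (c *: letter (inr m) + letter (inr n)))
| talg_rel_act a m b :
    talg_rel (letter (inr (act a m b))
              - letter (inl a) ∙ letter (inr m) ∙ letter (inl b)).

Inductive talg_ideal : free_alg -> Prop :=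
| talg_ideal_gen u r v : talg_rel r -> talg_ideal (u ∙ r ∙ v).

Definition talg_mod : lmodType C := mquot talg_ideal.
Definition talg_pi (x : free_alg) : talg_mod := mpi talg_ideal x.

Definition talg_mul (p q : talg_mod) : talg_mod :=
  talg_pi ((mrepr p : free_alg) ∙ mrepr q).

Lemma talg_idealMl (x y : free_alg) :
  lspan talg_ideal y -> lspan talg_ideal (x ∙ y).
Proof.
elim=> [|c u z [a r b hr] _ IH]; first by rewrite amulr0; left.
rewrite (amul_bilin _).1 !amulA; right => //; exact: talg_ideal_gen.
Qed.

Lemma talg_idealMr (x y : free_alg) :
  lspan talg_ideal y -> lspan talg_ideal (y ∙ x).
Proof.
elim=> [|c u z [a r b hr] _ IH]; first by rewrite amul0r; left.
by rewrite (amul_bilin _).2 -[_ ∙ b ∙ x]amulA; right.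
Qed.

Lemma talg_mulE x y : talg_mul (talg_pi x) (talg_pi y) = talg_pi (x ∙ y).
Proof.
apply/mpi_eq; rewrite /talg_pi.
set x' : free_alg := mrepr (mpi _ x); set y' : free_alg := mrepr (mpi _ y).
have hx : lspan talg_ideal (x' - x) by apply/mpi_eq; rewrite mreprK.
have hy : lspan talg_ideal (y' - y) by apply/mpi_eq; rewrite mreprK.
have -> : x' ∙ y' - x ∙ y = (x' - x) ∙ y' + x ∙ (y' - y).
  by rewrite -!scaleN1r !amulDl !amulDr amulZl amulZr !scaleN1r addrA subrK.
by apply: lspanD; [apply: talg_idealMr|apply: talg_idealMl].
Qed.

Lemma talg_piP c x y : talg_pi (c *: x + y) = c *: talg_pi x + talg_pi y.
Proof. exact: mpi_linear. Qed.

Lemma talg_surj (p : talg_mod) : {x | p = talg_pi x}.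
Proof. exact: mpi_surj. Qed.

Fact talg_mul_bilin : bilin talg_mul.
Proof.
split=> p c q r; have [x ->] := talg_surj p;
  have [y ->] := talg_surj q; have [z ->] := talg_surj r.
- apply: etrans (congr1 (talg_mul _) (esym (talg_piP c y z))) _.
  rewrite !talg_mulE; apply: etrans (talg_piP _ _ _); congr talg_pi.
  by rewrite (amul_bilin _).1.
- apply: etrans (congr1 (talg_mul^~ _) (esym (talg_piP c y z))) _.
  rewrite !talg_mulE; apply: etrans (talg_piP _ _ _); congr talg_pi.
  by rewrite (amul_bilin _).2.
Qed.

Fact talg_mulA : associative talg_mul.
Proof.
move=> p q r; have [x ->] := talg_surj p; have [y ->] := talg_surj q.
by have [z ->] := talg_surj r; rewrite !talg_mulE amulA.
Qed.

Fact talg_mul1l : left_id (talg_pi aone) talg_mul.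
Proof. by move=> p; have [x ->] := talg_surj p; rewrite talg_mulE amul1l. Qed.

Fact talg_mul1r : right_id (talg_pi aone) talg_mul.
Proof. by move=> p; have [x ->] := talg_surj p; rewrite talg_mulE amul1r. Qed.

Definition talg : algebra C :=
  Algebra talg_mul_bilin talg_mulA talg_mul1l talg_mul1r.

Definition talg_inA (a : A) : talg := talg_pi (letter (inl a)).
Definition talg_inM (m : M) : talg := talg_pi (letter (inr m)).

Definition word_deg (w : seq (A + M)) : nat :=
  count (fun x : A + M => if x is inr _ then true else false) w.

Inductive talg_word (n : nat) : talg -> Prop :=
| talg_word_gen w : word_deg w = n -> talg_word n (talg_pi (word_elt w)).

Definition talg_deg (n : nat) : talg -> Prop := lspan (talg_word n).

End TensorAlgebra.

Section DoubleSchouten.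
Variables (C : fieldType) (A : algebra C) (B : A -> Prop).

Definition Der : lmodType C := dder B.
Definition dT : algebra C := @talg C A Der (@dder_bimod C A B).
Definition dT_deg : nat -> dT -> Prop := @talg_deg C A Der (@dder_bimod C A B).
Definition inA : A -> dT := @talg_inA C A Der (@dder_bimod C A B).
Definition inD : Der -> dT := @talg_inM C A Der (@dder_bimod C A B).

Definition A3 : lmodType C := tensor A (tensor A A).

(* (x ⊗ y) ⊗ z |-> x ⊗ (y ⊗ z) *)
Definition rcons3 (t : tensor A A) (z : A) : A3 :=
  tlift (fun x y => x ⊗ (y ⊗ z)) t.

Definition ext_l (f : A -> tensor A A) : tensor A A -> A3 :=
  tlift (fun x y => rcons3 (f x) y).
Definition ext_r (f : A -> tensor A A) : tensor A A -> A3 :=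
  tlift (fun x y => x ⊗ f y).

Definition tau23 : A3 -> A3 :=
  tlift (fun x t => x ⊗ tlift (fun y z => z ⊗ y) t).
Definition tau12 : A3 -> A3 :=
  tlift (fun x t => tlift (fun y z => y ⊗ (x ⊗ z)) t).

(* elements of Der ⊗ A and A ⊗ Der as maps A -> A ⊗ A ⊗ A *)
Definition view_l (x : tensor Der A) (c : A) : A3 :=
  tlift (fun (d : Der) a => rcons3 ((d : dder B) c) a) x.
Definition view_r (y : tensor A Der) (c : A) : A3 :=
  tlift (fun a (d : Der) => a ⊗ (d : dder B) c) y.

Definition dder_bracket_l (d e : dder B) (c : A) : A3 :=
  tau23 (ext_l d (e c) - ext_r e (d c)).
Definition dder_bracket_r (d e : dder B) (c : A) : A3 :=
  tau12 (ext_r d (e c) - ext_l e (d c)).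

(* the signed flip of dT ⊗ dT *)
Definition is_superflip (sigma : tensor dT dT -> tensor dT dT) : Prop :=
  linear sigma /\
  forall m n u v, dT_deg m u -> dT_deg n v ->
    sigma (u ⊗ v) = sgn C (m%:Z * n%:Z) *: (v ⊗ u).

Record double_schouten (D : dT -> dT -> tensor dT dT) : Prop := {
  ds_bilin : bilin D;
  ds_AA : forall a b, D (inA a) (inA b) = 0;
  ds_DA : forall (d : dder B) a, D (inD d) (inA a) = tmap inA inA (d a);
  ds_DD : forall d e : dder B, exists x y,
    [/\ view_l x = dder_bracket_l d e,
        view_r y = dder_bracket_r d e
      & D (inD d) (inD e) = tmap inD inA x + tmap inA inD y];
  ds_leibniz : forall m n k u v w,
    dT_deg m u -> dT_deg n v -> dT_deg k w ->
    D u (v ∙ w) = sgn C ((m%:Z - 1) * n%:Z) *: outl v (D u w) + outr (D u v) w;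
  ds_anti : exists2 sigma, is_superflip sigma &
    forall m n u v, dT_deg m u -> dT_deg n v ->
    D u v = - (sgn C ((m%:Z - 1) * (n%:Z - 1)) *: sigma (D v u))
}.

(* br is the bracket induced on dT / [dT, dT] by the composition of D with the
   multiplication *)
Definition induced_bracket (D : dT -> dT -> tensor dT dT)
    (br : superab dT_deg -> superab dT_deg -> superab dT_deg) : Prop :=
  forall u v, br (superab_pi dT_deg u) (superab_pi dT_deg v)
              = superab_pi dT_deg (tmul (D u v)).

End DoubleSchouten.

Record quiver := Quiver {
  vert : finType;
  arr : finType;
  tl : arr -> vert;
  hd : arr -> vert
}.

(* inr a is the arrow a^* *)
Definition double_quiver (Q : quiver) : quiver :=
  Quiver (fun x : arr Q + arr Q => match x with inl a => tl a | inr a => hd a end)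
         (fun x : arr Q + arr Q => match x with inl a => hd a | inr a => tl a end).

Section Paths.
Variable Q : quiver.

Fixpoint walk (v : vert Q) (s : seq (arr Q)) : bool :=
  if s is a :: s' then (tl a == v) && walk (hd a) s' else true.

Definition walk_end (v : vert Q) (s : seq (arr Q)) : vert Q :=
  last v (map (@hd Q) s).

Lemma walk_cat v s t : walk v (s ++ t) = walk v s && walk (walk_end v s) t.
Proof. by elim: s v => //= a s IH v; rewrite IH andbA. Qed.

Lemma walk_end_cat v s t :
  walk_end v (s ++ t) = walk_end (walk_end v s) t.
Proof. by rewrite /walk_end map_cat last_cat. Qed.

(* a path is a starting vertex with the sequence of its arrows *)
Definition qpath := {p : vert Q * seq (arr Q) | walk p.1 p.2}.
HB.instance Definition _ := Choice.on qpath.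

Definition mkpath v s (w : walk v s) : qpath := exist _ (v, s) w.
Definition psrc (p : qpath) : vert Q := (val p).1.
Definition parr (p : qpath) : seq (arr Q) := (val p).2.
Definition ptgt (p : qpath) : vert Q := walk_end (psrc p) (parr p).
Definition pclosed (p : qpath) : bool := psrc p == ptgt p.

Definition pid (v : vert Q) : qpath := @mkpath v [::] isT.

Lemma pcat_proof (p q : qpath) :
  ptgt p == psrc q -> walk (psrc p) (parr p ++ parr q).
Proof.
move=> /eqP e; rewrite walk_cat (valP p) /= -/(ptgt p) e; exact: (valP q).
Qed.
Definition pcat (p q : qpath) (e : ptgt p == psrc q) : qpath :=
  mkpath (pcat_proof e).

Lemma ptake_proof i (p : qpath) : walk (psrc p) (take i (parr p)).
Proof.
have := valP p; rewrite -[X in walk _ X](cat_take_drop i) walk_cat.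
by case/andP.
Qed.
Definition ptake i (p : qpath) : qpath := mkpath (ptake_proof i p).

Lemma pdrop_proof i (p : qpath) : walk (ptgt (ptake i p)) (drop i (parr p)).
Proof.
have := valP p; rewrite -[X in walk _ X](cat_take_drop i) walk_cat.
by case/andP.
Qed.
Definition pdrop i (p : qpath) : qpath := mkpath (pdrop_proof i p).

Lemma qpath_eq (p q : qpath) : psrc p = psrc q -> parr p = parr q -> p = q.
Proof.
case: p q => [[v s] i] [[w t] j] /= ; rewrite /psrc /parr /= => e1 e2.
by apply: val_inj; rewrite /= e1 e2.
Qed.

End Paths.

Section PathAlgebra.
Variables (C : fieldType) (Q : quiver).

Definition pmul (p q : qpath Q) : free C (qpath Q) :=
  if decP (@idP (ptgt p == psrc q)) is left e then gen (pcat e) else 0.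

Lemma pmulE p q (e : ptgt p == psrc q) : pmul p q = gen (pcat e).
Proof.
rewrite /pmul; case: (decP (@idP (ptgt p == psrc q))) => [e'|/(_ e)[]].
by rewrite (bool_irrelevance e' e).
Qed.

Lemma pmul0 p q : ptgt p != psrc q -> pmul p q = 0.
Proof. by rewrite /pmul => /negP h; case: (decP (@idP (ptgt p == psrc q))). Qed.

Definition path_one : free C (qpath Q) := \sum_(v : vert Q) gen (pid v).

Let Zr x : bmul pmul x 0 = 0.
Proof.
by have := (bmul_bilin pmul).1 x (-1) 0 0; rewrite scaler0 addr0 scaleN1r addNr.
Qed.
Let Zl x : bmul pmul 0 x = 0.
Proof.
by have := (bmul_bilin pmul).2 x (-1) 0 0; rewrite scaler0 addr0 scaleN1r addNr.
Qed.

Fact path_mulA p q r :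
  bmul pmul (gen p) (pmul q r) = bmul pmul (pmul p q) (gen r).
Proof.
have [e1|n1] := boolP (ptgt p == psrc q);
  have [e2|n2] := boolP (ptgt q == psrc r).
- have f1 : ptgt p == psrc (pcat e2) by [].
  have f2 : ptgt (pcat e1) == psrc r.
    by rewrite /ptgt /= walk_end_cat -/(ptgt p) (eqP e1).
  rewrite !pmulE !bmulE !pmulE; congr gen; apply: qpath_eq => //.
  by rewrite /parr /= catA.
- rewrite (pmul0 n2) Zr pmulE bmulE pmul0 //.
  by rewrite /ptgt /= walk_end_cat -/(ptgt p) (eqP e1).
- by rewrite (pmul0 n1) Zl pmulE bmulE pmul0.
- by rewrite (pmul0 n1) (pmul0 n2) Zl Zr.
Qed.

Fact path_mul1l p : bmul pmul path_one (gen p) = gen p.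
Proof.
rewrite /bmul /path_one linear_sum (bigD1 (psrc p)) //= !fextE.
rewrite big1 ?addr0 => [|v nv]; last by rewrite !fextE pmul0.
by rewrite pmulE; congr gen; apply: qpath_eq.
Qed.

Fact path_mul1r p : bmul pmul (gen p) path_one = gen p.
Proof.
rewrite /bmul /path_one fextE linear_sum (bigD1 (ptgt p)) //= !fextE.
rewrite big1 ?addr0 => [|v nv]; last by rewrite fextE pmul0 // eq_sym.
by rewrite pmulE; congr gen; apply: qpath_eq; rewrite // /parr /= cats0.
Qed.

Definition path_alg : algebra C :=
  basis_algebra path_mulA path_mul1l path_mul1r.

Definition pelt (p : qpath Q) : path_alg := gen p.

Definition vertex_idem (e : path_alg) : Prop := exists v, e = pelt (pid v).

End PathAlgebra.

Section Necklace.
Variables (C : fieldType) (Q : quiver).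
Local Notation QQ := (double_quiver Q).

Definition pdeg (p : qpath QQ) : nat :=
  count (fun x : arr Q + arr Q => if x is inr _ then true else false) (parr p).

Inductive homog_path (n : nat) : path_alg C QQ -> Prop :=
| homog_path_gen p : pdeg p = n -> homog_path n (pelt C p).

Definition path_deg (n : nat) : path_alg C QQ -> Prop := lspan (homog_path n).

Definition necklace : lmodType C := superab path_deg.

(* p = ptake i p · x · pdrop i.+1 p with x the i-th arrow of p *)
Definition has_arrow (p : qpath QQ) (i : nat) (x : arr Q + arr Q) : bool :=
  onth (parr p) i == Some x.

(* The terms of {w1, w2} for w1 = p1 a q1, w2 = p2 a^* q2, with a at position i
   and a^* at position j. *)
Definition kterm (w1 w2 : qpath QQ) (i j : nat) : path_alg C QQ :=
  let p1 := ptake i w1 in let q1 := pdrop i.+1 w1 in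
  let p2 := ptake j w2 in let q2 := pdrop j.+1 w2 in
  sgn C (((pdeg w1)%:Z - 1) * (pdeg p2)%:Z + (pdeg p1)%:Z * (pdeg q1)%:Z + 1)
    *: (pelt C p2 ∙ pelt C q1 ∙ pelt C p1 ∙ pelt C q2).

(* The terms for w1 = p1 a^* q1, w2 = p2 a q2.  Up to sign this is kterm with the
   two necklaces exchanged; the sign is the one making the bracket graded
   antisymmetric for the shifted degrees |w| - 1, and well defined on necklaces.
   It cannot be (|w2| - 1)|p2| + |p1||q1|: with loops a, b, w1 = a^* b^* and
   w2 = a this would give b^* both for a^* b^* and for b^* a^* = - a^* b^*. *)
Definition kterm_star (w1 w2 : qpath QQ) (i j : nat) : path_alg C QQ :=
  let p1 := ptake i w1 in let q1 := pdrop i.+1 w1 in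
  let p2 := ptake j w2 in let q2 := pdrop j.+1 w2 in
  sgn C (((pdeg w2)%:Z - 1) * (pdeg q1)%:Z + (pdeg p2)%:Z * (pdeg q2)%:Z)
    *: (pelt C p1 ∙ pelt C q2 ∙ pelt C p2 ∙ pelt C q1).

Definition kontsevich (w1 w2 : qpath QQ) : path_alg C QQ :=
  \sum_(a : arr Q)
   ((\sum_(i < size (parr w1) | has_arrow w1 i (inl a))
      \sum_(j < size (parr w2) | has_arrow w2 j (inr a)) kterm w1 w2 i j)
  + (\sum_(i < size (parr w1) | has_arrow w1 i (inr a))
      \sum_(j < size (parr w2) | has_arrow w2 j (inl a)) kterm_star w1 w2 i j)).

Definition kontsevich_bracket (br : necklace -> necklace -> necklace) : Prop :=
  bilin br /\
  forall w1 w2 : qpath QQ, pclosed w1 -> pclosed w2 ->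
    br (superab_pi path_deg (pelt C w1)) (superab_pi path_deg (pelt C w2))
    = superab_pi path_deg (kontsevich w1 w2).

End Necklace.

Section QuiverDerivations.
Variables (C : fieldType) (Q : quiver).

Definition TDer : algebra C := dT (@vertex_idem C Q).
Definition TDer_deg : nat -> TDer -> Prop := @dT_deg C _ (@vertex_idem C Q).
Definition TDer_ab : lmodType C := superab TDer_deg.
Definition TDer_ab_deg : nat -> TDer_ab -> Prop := @superab_deg C TDer TDer_deg.

Definition necklace_deg : nat -> necklace C Q -> Prop :=
  @superab_deg C _ (@path_deg C Q).

Definition quiver_schouten : (TDer -> TDer -> tensor TDer TDer) -> Prop :=
  @double_schouten C (path_alg C Q) (@vertex_idem C Q).

Definition quiver_induced (D : TDer -> TDer -> tensor TDer TDer)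
    (br : TDer_ab -> TDer_ab -> TDer_ab) : Prop :=
  @induced_bracket C (path_alg C Q) (@vertex_idem C Q) D br.

End QuiverDerivations.

(* Main.v *)
From HB Require Import structures.
From mathcomp Require Import all_boot all_order all_algebra.
From mathcomp Require Import boolp zify.
Require Import Defs.

(* A double derivation is determined by its values on the arrows, which gives
   d = sum_a d(a)'' ∂_a d(a)' with ∂_a(b) = δ_ab (e_{t(a)} ⊗ e_{h(a)}).  Hence
   a |-> a, ∂_a |-> a^* identifies the tensor algebra with the path algebra of the
   double quiver, and the double bracket is forced to be
     {{w1, w2}} = sum ± p2 q1 ⊗ p1 q2
   over the factorizations w1 = p1 x q1, w2 = p2 y q2 with {x, y} = {a, a^*}.
   Multiplying the two factors gives the Kontsevich bracket, up to a cyclic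
   rotation in the terms where a^* lies in w1.  The formula for {{d, e}} is checked
   on d = q ∂_a p and e = s ∂_b r: as functions of the argument both of its
   components are derivations with values in A ⊗ A ⊗ A, so that it suffices to
   compare them on arrows. *)

Set Implicit Arguments.
Unset Strict Implicit.
Unset Printing Implicit Defensive.

Import GRing.Theory.
Local Open Scope ring_scope.
Local Open Scope tensor_scope.

(** * Linear maps and tensors *)

(** The bracket is built on the path algebra because that algebra has a basis: a bilinear map is
    given there by arbitrary values on pairs of paths, and the Leibniz rule and antisymmetry become
    comparisons of signs attached to pairs of positions. On the tensor algebra, a quotient of a free
    algebra, the same construction would have to respect the relations. The price is that the
    prescribed values on double derivations have to be recovered through the isomorphism. The
    bracket of two derivations is the delicate one, since its defining formula speaks only of views
    as maps [A -> A ⊗ A ⊗ A]: existence needs explicit elements with given views, and uniqueness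
    needs injectivity of the views. A derivation that kills the vertex idempotents has its value on
    an arrow a in e_{t(a)}A ⊗ Ae_{h(a)}; this is why d can be rebuilt from its values on the
    finitely many arrows. *)

Section Linear.
Variables (R : pzRingType).
Implicit Types U V W : lmodType R.

Lemma lin0 U V (f : U -> V) : linear f -> f 0 = 0.
Proof. by move=> lf; have := lf (-1) 0 0; rewrite scaler0 addr0 scaleN1r addNr. Qed.

Lemma linD U V (f : U -> V) : linear f -> {morph f : x y / x + y}.
Proof. by move=> lf x y; have := lf 1 x y; rewrite !scale1r. Qed.

Lemma linZ U V (f : U -> V) : linear f -> forall c, {morph f : x / c *: x}.
Proof. by move=> lf c x; have := lf c x 0; rewrite (lin0 lf) !addr0. Qed.

Lemma linN U V (f : U -> V) : linear f -> {morph f : x / - x}.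
Proof. by move=> lf x; rewrite -scaleN1r linZ // scaleN1r. Qed.

Lemma linB U V (f : U -> V) : linear f -> {morph f : x y / x - y}.
Proof. by move=> lf x y; rewrite linD // linN. Qed.

Lemma lin_sum U V (f : U -> V) : linear f ->
  forall I (r : seq I) (P : pred I) (F : I -> U),
  f (\sum_(i <- r | P i) F i) = \sum_(i <- r | P i) f (F i).
Proof. by move=> lf I r P F; apply: big_morph; [exact: linD|exact: lin0]. Qed.

Lemma lin_comp U V W (f : V -> W) (g : U -> V) :
  linear f -> linear g -> linear (fun x => f (g x)).
Proof. by move=> lf lg c x y; rewrite lg lf. Qed.

Lemma lin_add U V (f g : U -> V) :
  linear f -> linear g -> linear (fun x => f x + g x).
Proof. by move=> lf lg c x y; rewrite lf lg scalerDr addrACA. Qed.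

Lemma lin_opp U V (f : U -> V) : linear f -> linear (fun x => - f x).
Proof. by move=> lf c x y; rewrite lf opprD scalerN. Qed.

Lemma lin_id U : linear (fun x : U => x).
Proof. by []. Qed.

Lemma lin_bigsum U V I (r : seq I) (P : pred I) (F : I -> U -> V) :
  (forall i, linear (F i)) -> linear (fun x => \sum_(i <- r | P i) F i x).
Proof.
by move=> lF c x y; rewrite scaler_sumr -big_split; apply: eq_bigr => i _; rewrite lF.
Qed.

Lemma lspan_lin V (S : V -> Prop) W (f g : V -> W) : linear f -> linear g ->
  (forall x, S x -> f x = g x) -> forall x, lspan S x -> f x = g x.
Proof.
move=> lf lg fg x; elim=> [|c u v Su _ IH]; first by rewrite !lin0.
by rewrite lf lg fg // IH.
Qed.

Lemma lspan_sub V (S : V -> Prop) (P : V -> Prop) : P 0 ->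
  (forall c x y, P x -> P y -> P (c *: x + y)) -> (forall x, S x -> P x) ->
  forall x, lspan S x -> P x.
Proof. by move=> P0 PD PS x; elim=> // c u v Su _; apply: PD; apply: PS. Qed.

Lemma lspan_sum V (S : V -> Prop) I (r : seq I) (P : pred I) (F : I -> V) :
  (forall i, P i -> lspan S (F i)) -> lspan S (\sum_(i <- r | P i) F i).
Proof.
by move=> h; apply: (big_ind (lspan S)) => //; [left|apply: lspanD].
Qed.

Lemma lspan_map V W (f : V -> W) (S : V -> Prop) (S' : W -> Prop) : linear f ->
  (forall x, S x -> lspan S' (f x)) -> forall x, lspan S x -> lspan S' (f x).
Proof.
move=> lf h x; elim=> [|c u v Su _ IH]; first by rewrite lin0 //; left.
by rewrite lf; apply: lspanD => //; apply/lspanZ/h.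
Qed.

End Linear.

Section Bilinear.
Variable C : fieldType.
Implicit Types U V W : lmodType C.

Lemma bilin_l U V W (f : U -> V -> W) v : bilin f -> linear (f^~ v).
Proof. by case=> _; apply. Qed.
Lemma bilin_r U V W (f : U -> V -> W) u : bilin f -> linear (f u).
Proof. by case=> + _; apply. Qed.

Lemma linswap (V : lmodType C) (c d : C) (x x' y y' : V) :
  c *: (d *: x + x') + (d *: y + y') = d *: (c *: x + y) + (c *: x' + y').
Proof. by rewrite !scalerDr !scalerA [d * c]mulrC addrACA. Qed.

Lemma lin_scale U V (k : C) (f : U -> V) : linear f -> linear (fun x => k *: f x).
Proof. by move=> lf c x y; rewrite lf scalerDr !scalerA mulrC. Qed.

Lemma lin_zero U V : linear (fun _ : U => 0 : V).
Proof. by move=> c x y; rewrite scaler0 addr0. Qed.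

(** The free module is known only through its universal property, so uniqueness of linear extensions
    is applied to the projection modulo the span of the basis and to the zero map, which agree on
    the basis. *)
Lemma free_span (K : choiceType) (x : free C K) :
  lspan (fun y => exists k, y = gen k) x.
Proof.
rewrite -[x]subr0; apply/mpi_eq.
move: x; apply: free_ext => [c u v|c u v|k]; first exact: mpi_linear.
  by rewrite (lin0 (@mpi_linear _ _ _)) scaler0 addr0.
by apply/mpi_eq; rewrite subr0; apply: lspan_gen; exists k.
Qed.

Lemma free_ind (K : choiceType) (P : free C K -> Prop) : P 0 ->
  (forall c x y, P x -> P y -> P (c *: x + y)) -> (forall k, P (gen k)) ->
  forall x, P x.
Proof.
by move=> P0 PD Pg x; apply: (lspan_sub P0 PD) (free_span x) => _ [k ->].
Qed.

Lemma tensor_ind V W (P : tensor V W -> Prop) : P 0 ->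
  (forall c x y, P x -> P y -> P (c *: x + y)) -> (forall v w, P (v ⊗ w)) ->
  forall x, P x.
Proof.
move=> P0 PD Pt t; have [x ->] := mpi_surj t.
move: x; apply: free_ind.
- by rewrite (lin0 (@mpi_linear _ _ _)).
- by move=> c x y hx hy; rewrite mpi_linear; apply: PD.
- by case=> v w; apply: Pt.
Qed.

Lemma tprod_l V W (w : W) : linear (fun v : V => v ⊗ w).
Proof. exact: (tprod_bilin V W).2. Qed.
Lemma tprod_r V W (v : V) : linear (fun w : W => v ⊗ w).
Proof. exact: (tprod_bilin V W).1. Qed.

Lemma bilin_comp U V U' V' W (f : U' -> V' -> W) (g : U -> U') (h : V -> V') :
  bilin f -> linear g -> linear h -> bilin (fun x y => f (g x) (h y)).
Proof.
by case=> fl fr lg lh; split=> [u c x y|v c x y]; rewrite ?lg ?lh (fl, fr).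
Qed.

Lemma bilin_lcomp U V W W' (f : U -> V -> W) (g : W -> W') :
  bilin f -> linear g -> bilin (fun x y => g (f x y)).
Proof.
by case=> fl fr lg; split=> [u c x y|v c x y]; rewrite (fl, fr) lg.
Qed.

Section Fext2.
Variables (K L : choiceType) (V : lmodType C) (f : K -> L -> V).
Definition fext2 (x : free C K) (y : free C L) : V :=
  fext (fun p => fext (fun q => f p q) y) x.

Lemma fext2E p q : fext2 (gen p) (gen q) = f p q.
Proof. by rewrite /fext2 !fextE. Qed.

Lemma fext2_bilin : bilin fext2.
Proof.
split=> [x c y z|y c x z]; last by rewrite /fext2 fext_linear.
rewrite /fext2; move: x; apply: free_ext => [d u v|d u v|p].
- by rewrite fext_linear.
- by rewrite !fext_linear linswap.
- by rewrite !fextE fext_linear.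
Qed.
End Fext2.

Section Tmap.
Variables (V W V' W' : lmodType C) (f : V -> V') (g : W -> W').
Hypotheses (lf : linear f) (lg : linear g).

Lemma tmap_bilin : bilin (fun v w => f v ⊗ g w).
Proof. by apply: bilin_comp => //; apply: tprod_bilin. Qed.
Lemma tmap_linear : linear (tmap f g).
Proof. exact: tlift_linear tmap_bilin. Qed.
Lemma tmapE v w : tmap f g (v ⊗ w) = f v ⊗ g w.
Proof. exact: tliftE tmap_bilin _ _. Qed.
End Tmap.

Lemma tmap_comp (V W V' W' V2 W2 : lmodType C) (f' : V' -> V2) (g' : W' -> W2)
    (f : V -> V') (g : W -> W') : linear f -> linear g -> linear f' -> linear g' ->
  forall t, tmap f' g' (tmap f g t) = tmap (fun x => f' (f x)) (fun x => g' (g x)) t.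
Proof.
move=> lf lg lf' lg'; apply: tensor_ext.
- exact: lin_comp (tmap_linear lf' lg') (tmap_linear lf lg).
- exact: tmap_linear (lin_comp lf' lf) (lin_comp lg' lg).
- by move=> v w; rewrite !tmapE //; apply: lin_comp.
Qed.

Lemma tmap_id (V W : lmodType C) (f : V -> V) (g : W -> W) :
  f =1 id -> g =1 id -> forall t, tmap f g t = t.
Proof.
move=> fE gE; have lf : linear f by move=> c x y; rewrite !fE.
have lg : linear g by move=> c x y; rewrite !gE.
apply: (tensor_ext (tmap_linear lf lg) (@lin_id _ _)) => v w.
by rewrite tmapE // fE gE.
Qed.

End Bilinear.

(** * Outer and inner actions on the tensor square of an algebra *)

Section Alg.
Variables (C : fieldType) (A : algebra C).
Implicit Types (a b x y : A) (t : tensor A A).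

Lemma mull_lin a : linear (fun x => a ∙ x).
Proof. exact: (amul_bilin A).1. Qed.
Lemma mulr_lin a : linear (fun x => x ∙ a).
Proof. exact: (amul_bilin A).2. Qed.

Lemma tmul_linear : linear (@tmul C A).
Proof. exact: tlift_linear (amul_bilin A). Qed.
Lemma tmulE x y : tmul (x ⊗ y) = x ∙ y.
Proof. exact: tliftE (amul_bilin A) _ _. Qed.
Lemma outlE a x y : outl a (x ⊗ y) = (a ∙ x) ⊗ y.
Proof. exact: tliftE (outl_bilin a) _ _. Qed.
Lemma outrE a x y : outr (x ⊗ y) a = x ⊗ (y ∙ a).
Proof. exact: tliftE (outr_bilin a) _ _. Qed.
Lemma innerE a b x y : inner a (x ⊗ y) b = (x ∙ b) ⊗ (a ∙ y).
Proof. exact: tliftE (inner_bilin a b) _ _. Qed.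

Lemma tmul_outl a t : tmul (outl a t) = a ∙ tmul t.
Proof.
move: t; apply: tensor_ext.
- exact: lin_comp tmul_linear (outl_linear a).
- exact: lin_comp (mull_lin a) tmul_linear.
- by move=> v w; rewrite outlE !tmulE amulA.
Qed.

Lemma tmul_outr a t : tmul (outr t a) = tmul t ∙ a.
Proof.
move: t; apply: tensor_ext.
- exact: lin_comp tmul_linear (outr_linear a).
- exact: lin_comp (mulr_lin a) tmul_linear.
- by move=> v w; rewrite outrE !tmulE amulA.
Qed.

Lemma outl_outr a b t : outl a (outr t b) = outr (outl a t) b.
Proof.
move: t; apply: tensor_ext.
- exact: lin_comp (outl_linear a) (outr_linear b).
- exact: lin_comp (outr_linear b) (outl_linear a).
- by move=> v w; rewrite !(outlE, outrE).
Qed.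

Lemma outlM a b t : outl (a ∙ b) t = outl a (outl b t).
Proof.
move: t; apply: tensor_ext.
- exact: outl_linear.
- exact: lin_comp (outl_linear a) (outl_linear b).
- by move=> v w; rewrite !outlE amulA.
Qed.

Lemma outrM a b t : outr t (a ∙ b) = outr (outr t a) b.
Proof.
move: t; apply: tensor_ext.
- exact: outr_linear.
- exact: lin_comp (outr_linear b) (outr_linear a).
- by move=> v w; rewrite !outrE amulA.
Qed.

Lemma outl1 t : outl aone t = t.
Proof.
move: t; apply: (tensor_ext (outl_linear _) (@lin_id _ _)) => v w.
by rewrite outlE amul1l.
Qed.

Lemma outr1 t : outr t aone = t.
Proof.
move: t; apply: (tensor_ext (outr_linear _) (@lin_id _ _)) => v w.
by rewrite outrE amul1r.
Qed.

Lemma outl_lin_l t : linear (fun a => outl a t).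
Proof.
move=> c a b; move: t; apply: tensor_ext.
- exact: outl_linear.
- apply: lin_add (outl_linear b) => d x y.
  by rewrite (outl_linear a) scalerDr !scalerA mulrC.
- by move=> v w; rewrite !outlE (amul_bilin A).2 tprod_l.
Qed.

Lemma outr_lin_r t : linear (outr t).
Proof.
move=> c a b; move: t; apply: tensor_ext.
- exact: outr_linear.
- apply: lin_add (outr_linear b) => d x y.
  by rewrite (outr_linear a) scalerDr !scalerA mulrC.
- by move=> v w; rewrite !outrE (amul_bilin A).1 tprod_r.
Qed.

End Alg.

Section AlgMorphism.
Variables (C : fieldType) (A B : algebra C) (f : A -> B).
Hypotheses (lf : linear f) (fM : {morph f : x y / x ∙ y}).

Lemma tmap_outl a t : tmap f f (outl a t) = outl (f a) (tmap f f t).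
Proof.
move: t; apply: tensor_ext.
- exact: lin_comp (tmap_linear lf lf) (outl_linear a).
- exact: lin_comp (outl_linear _) (tmap_linear lf lf).
- by move=> v w; rewrite !(outlE, tmapE) // fM.
Qed.

Lemma tmap_outr a t : tmap f f (outr t a) = outr (tmap f f t) (f a).
Proof.
move: t; apply: tensor_ext.
- exact: lin_comp (tmap_linear lf lf) (outr_linear a).
- exact: lin_comp (outr_linear _) (tmap_linear lf lf).
- by move=> v w; rewrite !(outrE, tmapE) // fM.
Qed.

Lemma tmul_tmap t : tmul (tmap f f t) = f (tmul t).
Proof.
move: t; apply: tensor_ext.
- exact: lin_comp (@tmul_linear _ _) (tmap_linear lf lf).
- exact: lin_comp lf (@tmul_linear _ _).
- by move=> v w; rewrite !(tmulE, tmapE) // fM.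
Qed.
End AlgMorphism.

(** * Signs and parities *)

Section Sign.
Variable C : fieldType.

(** Exponents such as |w| - 1 may be negative, hence the absolute value. Through [oddzE] every
    identity of signs becomes a Boolean identity between parities, which a case analysis decides. *)
Definition oddz (k : int) : bool := odd `|k|%N.

Lemma oddzN k : oddz (- k) = oddz k. Proof. by rewrite /oddz abszN. Qed.
Lemma oddzn (n : nat) : oddz n = odd n. Proof. by []. Qed.
Lemma oddz1 : oddz 1 = true. Proof. by []. Qed.
Lemma oddzS (k : int) : oddz (k + 1) = ~~ oddz k.
Proof.
case: k => n; first by rewrite -PoszD !oddzn addn1.
have -> : Negz n + 1 = - n%:Z by rewrite NegzE -addn1 PoszD opprD addrNK.
by rewrite NegzE !oddzN !oddzn /= negbK.
Qed.
Lemma oddzD k l : oddz (k + l) = oddz k (+) oddz l.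
Proof.
have hn j (n : nat) : oddz (j + n%:Z) = oddz j (+) odd n.
  elim: n => [|n IH]; first by rewrite addr0 addbF.
  by rewrite -addn1 PoszD addrA oddzS IH addn1 /= addbN.
case: l => n; first exact: hn.
rewrite NegzE oddzN; have := hn (k - n.+1%:Z) n.+1.
by rewrite subrK oddzn => ->; rewrite -addbA addbb addbF.
Qed.
Lemma oddzM k l : oddz (k * l) = oddz k && oddz l.
Proof. by rewrite /oddz abszM oddM. Qed.

Lemma sgn_oddz k : sgn C k = (-1) ^+ oddz k.
Proof.
rewrite /sgn; case: k => n; first by rewrite -exprnP oddzn signr_odd.
by rewrite NegzE -exprnN oddzN oddzn -exprVn invrN1 signr_odd.
Qed.

Lemma sgn_eq k l : oddz k = oddz l -> sgn C k = sgn C l.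
Proof. by rewrite !sgn_oddz => ->. Qed.

Lemma scale_sgn_eq (V : lmodType C) k l (x : V) :
  oddz k = oddz l -> sgn C k *: x = sgn C l *: x.
Proof. by move=> /sgn_eq ->. Qed.

Lemma sgnD k l : sgn C k * sgn C l = sgn C (k + l).
Proof. by rewrite !sgn_oddz oddzD signr_addb. Qed.

Lemma sgnN k : - sgn C k = sgn C (k + 1).
Proof. by rewrite -sgnD /sgn -exprnP expr1 mulrN1. Qed.

Lemma sgn0 : sgn C 0 = 1. Proof. by rewrite sgn_oddz. Qed.
End Sign.

Definition oddzE := (oddzD, oddzM, oddzN, oddz1, oddzn).

(** * Path algebras *)

Section PathAlgebraTheory.
Variables (C : fieldType) (Q : quiver).
Local Notation A := (path_alg C Q).
Local Notation el := (pelt C).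
Implicit Types p q r : qpath Q.

Lemma pelt_mul p q (e : ptgt p == psrc q) : el p ∙ el q = el (pcat e).
Proof. by rewrite /= bmulE pmulE. Qed.

Lemma pelt_mul0 p q : ptgt p != psrc q -> el p ∙ el q = 0.
Proof. by move=> h; rewrite /= bmulE pmul0. Qed.

Definition idem v : A := el (pid v).

Lemma idem_mul p : idem (psrc p) ∙ el p = el p.
Proof. by rewrite pelt_mul; congr el; apply: qpath_eq. Qed.
Lemma mul_idem p : el p ∙ idem (ptgt p) = el p.
Proof. by rewrite pelt_mul; congr el; apply: qpath_eq => //; apply: cats0. Qed.
Lemma idem_idem v : idem v ∙ idem v = idem v.
Proof. exact: (idem_mul (pid v)). Qed.

Lemma aone_pid : aone = \sum_v idem v :> A.
Proof. by []. Qed.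

Lemma path_alg_ind (P : A -> Prop) : P 0 ->
  (forall c x y, P x -> P y -> P (c *: x + y)) -> (forall p, P (el p)) ->
  forall x, P x.
Proof. exact: free_ind. Qed.

Lemma parrow_proof (a : arr Q) : walk (tl a) [:: a].
Proof. by rewrite /= eqxx. Qed.
Definition parrow a : qpath Q := mkpath (parrow_proof a).
Definition arrow a : A := el (parrow a).

Lemma idem_arrow a : idem (tl a) ∙ arrow a = arrow a.
Proof. exact: idem_mul. Qed.
Lemma arrow_idem a : arrow a ∙ idem (hd a) = arrow a.
Proof. exact: mul_idem. Qed.

Lemma qpath_cons_proof (v : vert Q) a s : walk v (a :: s) -> walk (hd a) s.
Proof. by case/andP. Qed.

Lemma path_ind (P : qpath Q -> Prop) : (forall v, P (pid v)) ->
  (forall a p (e : ptgt (parrow a) == psrc p), P p -> P (pcat e)) ->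
  forall p, P p.
Proof.
move=> P0 PS [[v s] w]; elim: s v w => [|a s IH] v w.
  by have -> : exist _ (v, [::]) w = pid v by apply: qpath_eq.
pose p : qpath Q := exist _ (hd a, s) (qpath_cons_proof w).
have e : ptgt (parrow a) == psrc p by [].
have -> : exist _ (v, a :: s) w = pcat e; last by apply: PS; apply: IH.
by apply: qpath_eq => //; have /andP[/eqP] := w.
Qed.

Lemma path_mul_ind (P : A -> Prop) : (forall v, P (idem v)) ->
  (forall a p, P (el p) -> P (arrow a ∙ el p)) -> forall p, P (el p).
Proof.
move=> P0 PS; apply: path_ind => [//|a p e hp].
by rewrite -pelt_mul; apply: PS.
Qed.

Section PosSum.
Variable V : zmodType.
Implicit Types F : nat -> V.

(** A factorization p = p1 a q1 is encoded by the position of a in p. The summand is a function on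
    all of [nat], so that it can be shifted when p is cut into two paths. *)
Definition pos_sum p a F : V :=
  \sum_(i < size (parr p) | onth (parr p) i == Some a) F i.

Lemma eq_pos_sum p a F G :
  (forall i, (i < size (parr p))%N -> onth (parr p) i = Some a -> F i = G i) ->
  pos_sum p a F = pos_sum p a G.
Proof. by move=> h; apply: eq_bigr => i /eqP hi; apply: h. Qed.

Lemma pos_sum_cat p q (e : ptgt p == psrc q) a F :
  pos_sum (pcat e) a F =
  pos_sum p a F + pos_sum q a (fun i => F (size (parr p) + i)%N).
Proof.
rewrite /pos_sum -!(big_mkord (fun i => onth _ i == Some a)).
rewrite /parr /= -/(parr p) -/(parr q) size_cat.
rewrite (@big_cat_nat _ _ _ (size (parr p))) ?leq_addr //=.
congr (_ + _).
  rewrite [LHS]big_nat_cond [RHS]big_nat_cond; apply: eq_bigl => i.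
  by rewrite onth_cat; case: ltnP.
rewrite -{1}[size (parr p)]add0n big_addn addKn big_mkcond [RHS]big_mkcond big_mkord.
apply: eq_bigr => i _.
by rewrite onth_cat ltnNge leq_addl /= addnK addnC.
Qed.

Lemma pos_sum_pid v a F : pos_sum (pid v) a F = 0.
Proof. by rewrite /pos_sum big_ord0. Qed.

Lemma pos_sum_arrow b a F : pos_sum (parrow b) a F = if a == b then F 0%N else 0.
Proof.
rewrite /pos_sum big_mkcond big_ord_recl /= big_ord0 addr0.
by rewrite eq_sym (inj_eq Some_inj).
Qed.

End PosSum.

Lemma pos_sum_lin (U V : lmodType C) (f : U -> V) p a (F : nat -> U) : linear f ->
  f (pos_sum p a F) = pos_sum p a (fun i => f (F i)).
Proof. by move=> lf; rewrite /pos_sum lin_sum. Qed.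

Lemma pos_sum_add (V : lmodType C) p a (F G : nat -> V) :
  pos_sum p a (fun i => F i + G i) = pos_sum p a F + pos_sum p a G.
Proof. exact: big_split. Qed.

Section Cat.
Variables (p q : qpath Q) (e : ptgt p == psrc q).

Lemma ptake_catl i : (i < size (parr p))%N -> ptake i (pcat e) = ptake i p.
Proof. by move=> hi; apply: qpath_eq => //; rewrite /parr /= takel_cat // ltnW. Qed.

Lemma psrc_pdrop i r : psrc (pdrop i r) = ptgt (ptake i r). Proof. by []. Qed.
Lemma ptgt_pdrop i r : ptgt (pdrop i r) = ptgt r.
Proof.
rewrite /ptgt /psrc /= -walk_end_cat -[in RHS](cat_take_drop i (parr r)).
by rewrite /parr /=.
Qed.

(** Stated in the algebra rather than for paths: concatenation of paths carries a proof of
    composability, the product does not. *)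
Lemma pdrop_catl i : (i < size (parr p))%N ->
  el (pdrop i.+1 (pcat e)) = el (pdrop i.+1 p) ∙ el q.
Proof.
move=> hi; have e' : ptgt (pdrop i.+1 p) == psrc q by rewrite ptgt_pdrop.
rewrite pelt_mul; congr el; apply: qpath_eq.
  by rewrite !psrc_pdrop /ptgt /psrc /= /parr /= takel_cat.
rewrite /parr /= -/(parr p) -/(parr q) drop_cat; case: ltnP => // h.
have -> : i.+1 = size (parr p) by apply/eqP; rewrite eqn_leq hi h.
by rewrite subnn drop0 /parr /= drop_size.
Qed.

Lemma ptake_catr i :
  el (ptake (size (parr p) + i) (pcat e)) = el p ∙ el (ptake i q).
Proof.
rewrite pelt_mul; congr el; apply: qpath_eq => //.
by rewrite /parr /= takeD take_size_cat // drop_size_cat.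
Qed.

Lemma pdrop_catr i : pdrop (size (parr p) + i).+1 (pcat e) = pdrop i.+1 q.
Proof.
apply: qpath_eq; last by
  rewrite /parr /= -addnS addnC -drop_drop drop_size_cat.
have := eqP e; rewrite !psrc_pdrop /ptgt /psrc /= /parr /= -addnS takeD.
by rewrite take_size_cat // drop_size_cat // walk_end_cat => ->.
Qed.
End Cat.

Lemma onth_size (T : Type) (s : seq T) i x : onth s i = Some x -> (i < size s)%N.
Proof. by move=> h; rewrite ltnNge; apply/negP => /onth_default; rewrite h. Qed.

(** The Leibniz rule forces this formula for ∂_a: a path is cut open at each occurrence of a. *)
Definition pderiv_path a p : tensor A A :=
  pos_sum p a (fun i => el (ptake i p) ⊗ el (pdrop i.+1 p)).
Definition pderiv a : A -> tensor A A := fext (pderiv_path a).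

Lemma pderiv_linear a : linear (pderiv a). Proof. exact: fext_linear. Qed.
Lemma pderiv_pelt a p : pderiv a (el p) = pderiv_path a p.
Proof. exact: fextE. Qed.

Lemma pderiv_dder a : is_dder (@vertex_idem C Q) (pderiv a).
Proof.
split; first exact: pderiv_linear; last first.
  by move=> _ [v ->]; rewrite pderiv_pelt /pderiv_path pos_sum_pid.
have lr y : linear (fun x => outr (pderiv a x) y).
  exact: lin_comp (@outr_linear _ _ _) (pderiv_linear a).
have ll x : linear (fun y => outl x (pderiv a y)).
  exact: lin_comp (@outl_linear _ _ _) (pderiv_linear a).
move=> x y; move: x; apply: free_ext.
- exact: lin_comp (pderiv_linear a) (mulr_lin _).
- exact: lin_add (lr y) (@outl_lin_l _ _ _).
move=> p; move: y; apply: free_ext.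
- exact: lin_comp (pderiv_linear a) (mull_lin _).
- exact: lin_add (@outr_lin_r _ _ _) (ll _).
move=> q; rewrite -/(pelt C p) -/(pelt C q).
have [e|n] := boolP (ptgt p == psrc q).
  rewrite pelt_mul !pderiv_pelt /pderiv_path pos_sum_cat.
  rewrite (pos_sum_lin _ _ _ (@outr_linear _ _ _)).
  rewrite (pos_sum_lin _ _ _ (@outl_linear _ _ _)).
  congr (_ + _); apply: eq_pos_sum => i hi hx.
    by rewrite outrE ptake_catl // pdrop_catl.
  by rewrite outlE ptake_catr pdrop_catr.
(* For paths that do not compose both sides vanish, the right one term by term: the end of p still
   meets the start of q inside a single tensor factor. *)
rewrite pelt_mul0 // (lin0 (pderiv_linear a)) !pderiv_pelt /pderiv_path.
rewrite (pos_sum_lin _ _ _ (@outr_linear _ _ _)).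
rewrite (pos_sum_lin _ _ _ (@outl_linear _ _ _)).
rewrite /pos_sum !big1 ?addr0 // => i /eqP hi.
  by rewrite outlE pelt_mul0 // (lin0 (tprod_l _)).
by rewrite outrE pelt_mul0 ?(lin0 (tprod_r _)) // ptgt_pdrop.
Qed.

Lemma pderiv_arrow a b :
  pderiv a (arrow b) = if a == b then idem (tl a) ⊗ idem (hd a) else 0.
Proof.
rewrite pderiv_pelt /pderiv_path pos_sum_arrow; case: eqP => // ->.
by congr (el _ ⊗ el _); apply: qpath_eq.
Qed.

End PathAlgebraTheory.
Arguments idem C {Q} v.
Arguments arrow C {Q} a.

(** * Double derivations of a path algebra *)

Section Derivations.
Variables (C : fieldType) (Q : quiver).
Local Notation A := (path_alg C Q).
Local Notation B := (@vertex_idem C Q).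
Local Notation Der := (Der B).
Local Notation el := (pelt C).
Implicit Types (d e : Der) (x y p q r s : A) (a b c : arr Q).

(* [L x m] and [R m y] stand for the left and right action on the bimodule of
   values, of which no property is needed. *)
Definition is_deriv (V : lmodType C) (L : A -> V -> V) (R : V -> A -> V)
    (F : A -> V) : Prop :=
  [/\ linear F, forall x y, F (x ∙ y) = R (F x) y + L x (F y)
    & forall v, F (idem C v) = 0].

(** The generality in V, L and R pays off: the lemma serves for values in A ⊗ A, in A ⊗ A ⊗ A under
    two pairs of actions, and in the tensor square of the tensor algebra. *)
Lemma deriv_ext (V : lmodType C) L R (F G : A -> V) :
  is_deriv L R F -> is_deriv L R G -> (forall a, F (arrow C a) = G (arrow C a)) ->
  F = G.
Proof.
case=> lF dF iF [lG dG iG] FG; apply/funext; apply: (free_ext lF lG).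
apply: (path_mul_ind (P := fun x => F x = G x)) => [v|a p IH]; first by rewrite iF iG.
by rewrite dF dG FG IH.
Qed.

Lemma dder_linear (d : dder B) : linear d.
Proof. by have /asboolP[] := dderP d. Qed.
Lemma dderM (d : dder B) x y : d (x ∙ y) = outr (d x) y + outl x (d y).
Proof. by have /asboolP[] := dderP d. Qed.
Lemma dder_idem (d : dder B) v : d (idem C v) = 0.
Proof. by have /asboolP[_ _ h] := dderP d; apply: h; exists v. Qed.

Lemma dder_deriv (d : dder B) : is_deriv (@outl _ A) (@outr _ A) d.
Proof. by split; [exact: dder_linear|exact: dderM|exact: dder_idem]. Qed.

Lemma dder_ext (d e : dder B) : (forall a, d (arrow C a) = e (arrow C a)) -> d = e.
Proof. by move=> h; apply/val_inj/(deriv_ext (dder_deriv d) (dder_deriv e)). Qed.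

Lemma dder_idem_l (d : dder B) v x : d (idem C v ∙ x) = outl (idem C v) (d x).
Proof. by rewrite dderM dder_idem (lin0 (outr_linear _)) add0r. Qed.
Lemma dder_idem_r (d : dder B) v x : d (x ∙ idem C v) = outr (d x) (idem C v).
Proof. by rewrite dderM dder_idem (lin0 (outl_linear _)) addr0. Qed.

Lemma dderD (d e : dder B) x : (d + e : dder B) x = d x + e x.
Proof. by []. Qed.
Lemma dderZ k (d : dder B) x : (k *: d : dder B) x = k *: d x.
Proof. by []. Qed.
Lemma dder_sum I (r : seq I) (P : pred I) (F : I -> dder B) x :
  (\sum_(i <- r | P i) F i : dder B) x = \sum_(i <- r | P i) F i x.
Proof. exact: (lin_sum (f := fun d : dder B => d x)). Qed.

Definition partial a : dder B := DDer (asboolT (pderiv_dder C a)).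

Lemma partial_arrow a b : partial a (arrow C b) =
  if a == b then idem C (tl a) ⊗ idem C (hd a) else 0.
Proof. exact: pderiv_arrow. Qed.

(* [q ∂_a p], the double derivation with value [p ⊗ q] on [a] *)
Definition qpartial a q p : Der := dder_bimod q (partial a) p.

Lemma qpartialE a q p b : (qpartial a q p : dder B) (arrow C b) =
  if a == b then (idem C (tl a) ∙ p) ⊗ (q ∙ idem C (hd a)) else 0.
Proof.
rewrite /qpartial -[LHS]/(inner q (partial a (arrow C b)) p) partial_arrow.
by case: eqP => _; rewrite ?innerE // (lin0 (inner_linear _ _)).
Qed.

Lemma qpartial_act a x q p y : dder_bimod x (qpartial a q p) y
  = qpartial a (x ∙ q) (p ∙ y).
Proof.
apply: dder_ext => b; rewrite qpartialE.
rewrite -[LHS]/(inner x ((qpartial a q p : dder B) (arrow C b)) y) qpartialE.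
case: eqP => _; last by rewrite (lin0 (inner_linear _ _)).
by rewrite innerE !amulA.
Qed.

Lemma qpartial_l a p : linear (fun q => qpartial a q p).
Proof.
move=> k x y; apply: dder_ext => b; rewrite dderD dderZ !qpartialE.
case: eqP => _; last by rewrite scaler0 addr0.
by rewrite mulr_lin tprod_r.
Qed.
Lemma qpartial_r a q : linear (qpartial a q).
Proof.
move=> k x y; apply: dder_ext => b; rewrite dderD dderZ !qpartialE.
case: eqP => _; last by rewrite scaler0 addr0.
by rewrite mull_lin tprod_l.
Qed.
Lemma qpartial_bilin a : bilin (fun p q => qpartial a q p).
Proof. by split=> [p|q]; [apply: qpartial_l|apply: qpartial_r]. Qed.

Definition tpartial a : tensor A A -> Der := tlift (fun p q => qpartial a q p).
Lemma tpartial_linear a : linear (tpartial a).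
Proof. exact: tlift_linear (qpartial_bilin a). Qed.
Lemma tpartialE a p q : tpartial a (p ⊗ q) = qpartial a q p.
Proof. exact: tliftE (qpartial_bilin a) p q. Qed.

Lemma tpartial_arrow a t b : (tpartial a t : dder B) (arrow C b) =
  if a == b then outl (idem C (tl a)) (outr t (idem C (hd a))) else 0.
Proof.
move: t; apply: tensor_ind => [|k t u ht hu|p q].
- rewrite (lin0 (tpartial_linear a)) (lin0 (outr_linear _)) (lin0 (outl_linear _)).
  by rewrite if_same.
- rewrite tpartial_linear dderD dderZ ht hu; case: eqP => _.
    by rewrite outr_linear outl_linear.
  by rewrite scaler0 addr0.
- by rewrite tpartialE qpartialE outrE outlE.
Qed.

(** From a = e_{t(a)} a e_{h(a)} and the vanishing of d on idempotents, d(a) is fixed by e_{t(a)} on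
    the left and by e_{h(a)} on the right. On such tensors [tpartial a] is inverted by evaluation at
    a. *)
Lemma dder_expand d : d = \sum_a tpartial a ((d : dder B) (arrow C a)).
Proof.
apply: dder_ext => b; rewrite dder_sum (bigD1 b) //= big1 => [|a /negPf nab].
  rewrite addr0 tpartial_arrow eqxx -dder_idem_r arrow_idem.
  by rewrite -dder_idem_l idem_arrow.
by rewrite tpartial_arrow nab.
Qed.

Lemma tpartial_idem a t :
  tpartial a t = tpartial a (outl (idem C (tl a)) (outr t (idem C (hd a)))).
Proof.
apply: dder_ext => b; rewrite !tpartial_arrow; case: eqP => // _.
rewrite [RHS](outl_outr (idem C (tl a)) (idem C (hd a))) -outlM.
by rewrite idem_idem -[RHS]outl_outr -outrM idem_idem.
Qed.

(** The two conditions on p and q can be imposed because [tpartial a] only sees its argument after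
    multiplication by these idempotents. They make the value of q ∂_a p on a exactly p ⊗ q, which
    keeps idempotents out of the computation of brackets. *)
Lemma Der_ind (P : Der -> Prop) : P 0 ->
  (forall k d e, P d -> P e -> P (k *: d + e)) ->
  (forall a p q, idem C (tl a) ∙ p = p -> q ∙ idem C (hd a) = q ->
     P (qpartial a q p)) ->
  forall d, P d.
Proof.
move=> P0 PD Pq d; rewrite [d]dder_expand; apply: (big_ind P) => //.
  by move=> x y hx hy; rewrite -[x]scale1r; apply: PD.
move=> a _; move: (X in tpartial a X) => t; move: t; apply: tensor_ind.
- by rewrite (lin0 (tpartial_linear _)).
- by move=> k x y hx hy; rewrite tpartial_linear; apply: PD.
move=> p q; rewrite tpartial_idem outrE outlE tpartialE.
by apply: Pq; rewrite ?amulA ?idem_idem // -amulA idem_idem.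
Qed.

Local Notation A3 := (A3 A).

Lemma rcons3_bilin x : bilin (fun u v : A => u ⊗ (v ⊗ x) : A3).
Proof.
split=> [u k v w|v k u w]; first by rewrite tprod_l tprod_r.
by rewrite tprod_l.
Qed.
Lemma rcons3_linear x : linear (@rcons3 _ A ^~ x).
Proof. exact: tlift_linear (rcons3_bilin x). Qed.
Lemma rcons3E x u v : rcons3 (u ⊗ v) x = u ⊗ (v ⊗ x).
Proof. exact: tliftE (rcons3_bilin x) u v. Qed.
Lemma rcons3_linear_r t : linear (@rcons3 _ A t).
Proof.
move=> k x y; move: t; apply: tensor_ind => [|c t u ht hu|u v].
- by rewrite !(lin0 (rcons3_linear _)) scaler0 addr0.
- by rewrite !rcons3_linear ht hu linswap.
- by rewrite !rcons3E !tprod_r.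
Qed.

Lemma rcons3_tbilin (d : A -> tensor A A) : linear d ->
  bilin (fun x y => rcons3 (d x) y).
Proof.
move=> ld; split=> [x|y]; first exact: rcons3_linear_r.
by apply: lin_comp => //; apply: rcons3_linear.
Qed.
Lemma ext_l_linear (d : A -> tensor A A) : linear d -> linear (ext_l d).
Proof. by move=> ld; apply: tlift_linear (rcons3_tbilin ld). Qed.
Lemma ext_lE (d : A -> tensor A A) x y : linear d ->
  ext_l d (x ⊗ y) = rcons3 (d x) y.
Proof. by move=> ld; apply: tliftE (rcons3_tbilin ld) x y. Qed.

Lemma ext_r_bilin (d : A -> tensor A A) : linear d -> bilin (fun x y => x ⊗ d y).
Proof. by move=> ld; apply: bilin_comp (@lin_id _ _) ld; apply: tprod_bilin. Qed.
Lemma ext_r_linear (d : A -> tensor A A) : linear d -> linear (ext_r d).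
Proof. by move=> ld; apply: tlift_linear (ext_r_bilin ld). Qed.
Lemma ext_rE (d : A -> tensor A A) x y : linear d -> ext_r d (x ⊗ y) = x ⊗ d y.
Proof. by move=> ld; apply: tliftE (ext_r_bilin ld) x y. Qed.

Lemma flip_bilin : bilin (fun y z : A => z ⊗ y).
Proof. by split=> [x|y]; [apply: tprod_l|apply: tprod_r]. Qed.
Lemma tau23_bilin :
  bilin (fun (x : A) (t : tensor A A) => x ⊗ tlift (fun y z => z ⊗ y) t : A3).
Proof.
apply: (bilin_comp _ (@lin_id _ _) (tlift_linear flip_bilin)).
exact: tprod_bilin.
Qed.
Lemma tau23_linear : linear (@tau23 _ A).
Proof. exact: tlift_linear tau23_bilin. Qed.
Lemma tau23E x y z : tau23 (x ⊗ (y ⊗ z)) = x ⊗ (z ⊗ y) :> A3.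
Proof. by rewrite /tau23 (tliftE tau23_bilin) (tliftE flip_bilin). Qed.

Lemma tau12_bilin_in x : bilin (fun y z : A => y ⊗ (x ⊗ z) : A3).
Proof.
split=> [y|z]; last exact: tprod_l.
by apply: lin_comp; apply: tprod_r.
Qed.
Lemma tau12_bilin :
  bilin (fun (x : A) (t : tensor A A) => tlift (fun y z => y ⊗ (x ⊗ z)) t : A3).
Proof.
split=> [x|t]; first exact: tlift_linear (tau12_bilin_in x).
move=> k x x'; move: t; apply: tensor_ind => [|c t u ht hu|u v].
- by rewrite !(lin0 (tlift_linear (tau12_bilin_in _))) scaler0 addr0.
- by rewrite !(tlift_linear (tau12_bilin_in _)) ht hu linswap.
- by rewrite !(tliftE (tau12_bilin_in _)) tprod_l tprod_r.
Qed.
Lemma tau12_linear : linear (@tau12 _ A).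
Proof. exact: tlift_linear tau12_bilin. Qed.
Lemma tau12E x y z : tau12 (x ⊗ (y ⊗ z)) = y ⊗ (x ⊗ z) :> A3.
Proof. by rewrite /tau12 (tliftE tau12_bilin) (tliftE (tau12_bilin_in _)). Qed.

Lemma view_l_bilin z : bilin (fun (d : Der) x => rcons3 ((d : dder B) z) x).
Proof.
split=> [d|x]; first exact: rcons3_linear_r.
by move=> k d e; rewrite dderD dderZ rcons3_linear.
Qed.
Lemma view_l_linear z : linear (fun x : tensor Der A => view_l x z).
Proof. exact: tlift_linear (view_l_bilin z). Qed.
Lemma view_lE d x z : view_l (d ⊗ x) z = rcons3 ((d : dder B) z) x.
Proof. exact: tliftE (view_l_bilin z) d x. Qed.

Lemma view_r_bilin z : bilin (fun x (d : Der) => x ⊗ (d : dder B) z).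
Proof.
split=> [x|d]; last exact: tprod_l.
by move=> k d e; rewrite dderD dderZ tprod_r.
Qed.
Lemma view_r_linear z : linear (fun y : tensor A Der => view_r y z).
Proof. exact: tlift_linear (view_r_bilin z). Qed.
Lemma view_rE d x z : view_r (x ⊗ d) z = x ⊗ (d : dder B) z.
Proof. exact: tliftE (view_r_bilin z) x d. Qed.

End Derivations.

(** * Derivations with values in A ⊗ A ⊗ A *)

Section Triple.
Variables (C : fieldType) (Q : quiver).
Local Notation A := (path_alg C Q).
Local Notation B := (@vertex_idem C Q).
Local Notation Der := (Der B).
Local Notation A3 := (A3 A).
Implicit Types (d e : Der) (x y z p q r s u v : A) (a b c : arr Q).
Implicit Types (t : tensor A A) (w : A3).

(** The digit is the tensor factor acted upon. The outer structure is (l1, r3); [tau23] carries it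
    to (l1, r2), the one seen by elements of Der ⊗ A, and [tau12] to (l2, r3), the one seen by
    elements of A ⊗ Der. *)
Definition act_l1 x : A3 -> A3 := tmap (fun u => x ∙ u) id.
Definition act_r3 w y : A3 := tmap id (fun t => outr t y) w.
Definition act_l2 x : A3 -> A3 := tmap id (outl x).
Definition act_r2 w y : A3 := tmap id (tmap (fun u => u ∙ y) id) w.

Lemma act_l1_linear x : linear (act_l1 x).
Proof. exact: tmap_linear (mull_lin x) (@lin_id _ _). Qed.
Lemma act_r3_linear y : linear (act_r3 ^~ y).
Proof. exact: tmap_linear (@lin_id _ _) (outr_linear y). Qed.
Lemma act_l2_linear x : linear (act_l2 x).
Proof. exact: tmap_linear (@lin_id _ _) (outl_linear x). Qed.
Lemma act_r2_linear y : linear (act_r2 ^~ y).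
Proof. exact: tmap_linear (@lin_id _ _) (tmap_linear (mulr_lin y) (@lin_id _ _)). Qed.

Lemma act_l1E x u t : act_l1 x (u ⊗ t) = (x ∙ u) ⊗ t.
Proof. exact: (tmapE (mull_lin x) (@lin_id _ _)). Qed.
Lemma act_r3E y u t : act_r3 (u ⊗ t) y = u ⊗ outr t y.
Proof. exact: (tmapE (@lin_id _ _) (outr_linear y)). Qed.
Lemma act_l2E x u t : act_l2 x (u ⊗ t) = u ⊗ outl x t.
Proof. exact: (tmapE (@lin_id _ _) (outl_linear x)). Qed.
Lemma act_r2E y u v z : act_r2 (u ⊗ (v ⊗ z)) y = u ⊗ ((v ∙ y) ⊗ z).
Proof.
rewrite /act_r2 (tmapE (@lin_id _ _) (tmap_linear (mulr_lin y) (@lin_id _ _))).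
by rewrite (tmapE (mulr_lin y) (@lin_id _ _)).
Qed.

Lemma A3_ext (V : lmodType C) (f g : A3 -> V) : linear f -> linear g ->
  (forall u v z, f (u ⊗ (v ⊗ z)) = g (u ⊗ (v ⊗ z))) -> f =1 g.
Proof.
move=> lf lg fg; apply: tensor_ext => // u t; move: t.
by apply: tensor_ext => // k t t'; rewrite tprod_r ?lf ?lg.
Qed.

Lemma tau23_l1 x w : tau23 (act_l1 x w) = act_l1 x (tau23 w).
Proof.
move: w; apply: A3_ext.
- exact: lin_comp (@tau23_linear _ _) (act_l1_linear x).
- exact: lin_comp (act_l1_linear x) (@tau23_linear _ _).
- by move=> *; rewrite !(act_l1E, tau23E).
Qed.
Lemma tau23_r3 y w : tau23 (act_r3 w y) = act_r2 (tau23 w) y.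
Proof.
move: w; apply: A3_ext.
- exact: lin_comp (@tau23_linear _ _) (act_r3_linear y).
- exact: lin_comp (act_r2_linear y) (@tau23_linear _ _).
- by move=> *; rewrite !(act_r3E, outrE, tau23E, act_r2E).
Qed.
Lemma tau12_l1 x w : tau12 (act_l1 x w) = act_l2 x (tau12 w).
Proof.
move: w; apply: A3_ext.
- exact: lin_comp (@tau12_linear _ _) (act_l1_linear x).
- exact: lin_comp (act_l2_linear x) (@tau12_linear _ _).
- by move=> *; rewrite !(act_l1E, tau12E, act_l2E, outlE).
Qed.
Lemma tau12_r3 y w : tau12 (act_r3 w y) = act_r3 (tau12 w) y.
Proof.
move: w; apply: A3_ext.
- exact: lin_comp (@tau12_linear _ _) (act_r3_linear y).
- exact: lin_comp (act_r3_linear y) (@tau12_linear _ _).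
- by move=> *; rewrite !(act_r3E, outrE, tau12E, act_r3E).
Qed.

Lemma rcons3_outl x t y : rcons3 (outl x t) y = act_l1 x (rcons3 t y).
Proof.
move: t; apply: tensor_ext.
- exact: lin_comp (@rcons3_linear _ _ _) (@outl_linear _ _ _).
- exact: lin_comp (act_l1_linear _) (@rcons3_linear _ _ _).
- by move=> u v; rewrite outlE !rcons3E act_l1E.
Qed.
Lemma rcons3_outr x t y : rcons3 (outr t x) y = act_r2 (rcons3 t y) x.
Proof.
move: t; apply: tensor_ext.
- exact: lin_comp (@rcons3_linear _ _ _) (@outr_linear _ _ _).
- exact: lin_comp (act_r2_linear _) (@rcons3_linear _ _ _).
- by move=> u v; rewrite outrE !rcons3E act_r2E.
Qed.
Lemma rcons3_mulr x t y : rcons3 t (y ∙ x) = act_r3 (rcons3 t y) x.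
Proof.
move: t; apply: tensor_ext.
- exact: rcons3_linear.
- exact: lin_comp (act_r3_linear _) (@rcons3_linear _ _ _).
- by move=> u v; rewrite !rcons3E act_r3E outrE.
Qed.

(* [contract (d x) (e y)] is the cross term common to [(d ⊗ 1) e] and [(1 ⊗ e) d]
   at [x ∙ y]. *)
Definition contract t t' : A3 := tlift (fun u v => u ⊗ outl v t') t.
Lemma contract_bilin t' : bilin (fun u v : A => u ⊗ outl v t').
Proof.
split=> [u|v]; last exact: tprod_l.
exact: lin_comp (@tprod_r _ _ _ _) (outl_lin_l t').
Qed.
Lemma contractE u v t' : contract (u ⊗ v) t' = u ⊗ outl v t'.
Proof. exact: tliftE (contract_bilin t') u v. Qed.
Lemma contract_linear t' : linear (contract ^~ t').
Proof. exact: tlift_linear (contract_bilin t'). Qed.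
Lemma contract_linear_r t : linear (contract t).
Proof.
move=> k x y; move: t; apply: tensor_ind => [|c t u ht hu|u v].
- by rewrite !(lin0 (contract_linear _)) scaler0 addr0.
- by rewrite !contract_linear ht hu linswap.
- by rewrite !contractE outl_linear tprod_r.
Qed.

Lemma ext_l_outr (d : A -> tensor A A) t y : linear d ->
  ext_l d (outr t y) = act_r3 (ext_l d t) y.
Proof.
move=> ld; move: t; apply: tensor_ext.
- exact: lin_comp (ext_l_linear ld) (@outr_linear _ _ _).
- exact: lin_comp (act_r3_linear _) (ext_l_linear ld).
- by move=> u v; rewrite outrE !ext_lE // rcons3_mulr.
Qed.

Lemma ext_r_outl (d : A -> tensor A A) t x : linear d ->
  ext_r d (outl x t) = act_l1 x (ext_r d t).
Proof.
move=> ld; move: t; apply: tensor_ext.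
- exact: lin_comp (ext_r_linear ld) (@outl_linear _ _ _).
- exact: lin_comp (act_l1_linear _) (ext_r_linear ld).
- by move=> u v; rewrite outlE !ext_rE // act_l1E.
Qed.

Lemma ext_l_outl (d : dder B) t x :
  ext_l d (outl x t) = contract (d x) t + act_l1 x (ext_l d t).
Proof.
have ld := dder_linear d; move: t; apply: tensor_ext.
- exact: lin_comp (ext_l_linear ld) (@outl_linear _ _ _).
- apply: lin_add (contract_linear_r _) _.
  exact: lin_comp (act_l1_linear _) (ext_l_linear ld).
move=> u v; rewrite outlE !ext_lE // dderM (linD (rcons3_linear _)) rcons3_outl.
congr (_ + _); move: (d x); apply: tensor_ext.
- exact: lin_comp (rcons3_linear _) (outr_linear _).
- exact: contract_linear.
- by move=> p q; rewrite outrE rcons3E contractE outlE.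
Qed.

Lemma ext_r_outr (e : dder B) t y :
  ext_r e (outr t y) = act_r3 (ext_r e t) y + contract t (e y).
Proof.
have le := dder_linear e; move: t; apply: tensor_ext.
- exact: lin_comp (ext_r_linear le) (@outr_linear _ _ _).
- apply: lin_add (contract_linear _).
  exact: lin_comp (act_r3_linear _) (ext_r_linear le).
move=> u v.
by rewrite outrE !ext_rE // dderM (linD (tprod_r _)) contractE act_r3E.
Qed.

Definition pre_bracket (d e : dder B) x : A3 := ext_l d (e x) - ext_r e (d x).

Let cancel_mid (V : zmodType) (a b c a' b' : V) :
  a + (c + b) - (a' + c + b') = a - a' + (b - b').
Proof.
rewrite addrCA [a' + c]addrC -[c + a' + b']addrA opprD addrACA subrr add0r.
by rewrite opprD addrACA.
Qed.

(** Neither composite is a derivation by itself, but both deviate by the same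
    [contract (d x) (e y)], which cancels in the difference. *)
Lemma pre_bracket_deriv (d e : dder B) : is_deriv act_l1 act_r3 (pre_bracket d e).
Proof.
have ld := dder_linear d; have le := dder_linear e.
have ll := ext_l_linear ld; have lr := ext_r_linear le; split.
- apply: lin_add (lin_comp ll le) _; apply: lin_opp; exact: lin_comp lr ld.
- move=> x y; rewrite /pre_bracket !dderM (linD ll) (linD lr) ext_l_outr //.
  rewrite ext_l_outl ext_r_outr ext_r_outl // (linB (act_r3_linear y)).
  by rewrite (linB (act_l1_linear x)) cancel_mid.
- by move=> v; rewrite /pre_bracket !dder_idem (lin0 ll) (lin0 lr) subrr.
Qed.

Lemma bracket_lE (d e : dder B) : dder_bracket_l d e = fun x => tau23 (pre_bracket d e x).
Proof. by []. Qed.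
(** Up to sign and permutation of factors the second component is the first with d and e exchanged,
    so a single derivation property covers both. *)
Lemma bracket_rE (d e : dder B) :
  dder_bracket_r d e = fun x => - tau12 (pre_bracket e d x).
Proof.
apply/funext => x; rewrite /dder_bracket_r /pre_bracket.
by rewrite -(linN (@tau12_linear _ _)) opprB.
Qed.

Lemma bracket_l_deriv (d e : dder B) :
  is_deriv act_l1 act_r2 (dder_bracket_l d e).
Proof.
rewrite bracket_lE; have [lF dF iF] := pre_bracket_deriv d e; split.
- exact: lin_comp (@tau23_linear _ _) lF.
- by move=> x y; rewrite dF (linD (@tau23_linear _ _)) tau23_l1 tau23_r3.
- by move=> v; rewrite iF (lin0 (@tau23_linear _ _)).
Qed.

Lemma bracket_r_deriv (d e : dder B) :
  is_deriv act_l2 act_r3 (dder_bracket_r d e).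
Proof.
rewrite bracket_rE; have [lF dF iF] := pre_bracket_deriv e d; split.
- apply: lin_opp; exact: lin_comp (@tau12_linear _ _) lF.
- move=> x y; rewrite dF (linD (@tau12_linear _ _)) tau12_l1 tau12_r3 opprD.
  by rewrite (linN (act_l2_linear _)) (linN (act_r3_linear _)).
- by move=> v; rewrite iF (lin0 (@tau12_linear _ _)) oppr0.
Qed.

Lemma is_deriv_comb (V : lmodType C) (L : A -> V -> V) (R : V -> A -> V) F G k :
  (forall x, linear (L x)) -> (forall y, linear (R ^~ y)) ->
  is_deriv L R F -> is_deriv L R G -> is_deriv L R (fun x => k *: F x + G x).
Proof.
move=> lL lR [lF dF iF] [lG dG iG]; split.
- by move=> c x y; rewrite lF lG linswap.
- by move=> x y; rewrite dF dG lL lR scalerDr addrACA.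
- by move=> v; rewrite iF iG scaler0 addr0.
Qed.

Lemma is_deriv0 (V : lmodType C) (L : A -> V -> V) (R : V -> A -> V) :
  (forall x, linear (L x)) -> (forall y, linear (R ^~ y)) ->
  is_deriv L R (fun=> 0).
Proof.
move=> lL lR; split=> //; first by move=> k x y; rewrite scaler0 addr0.
by move=> x y; rewrite (lin0 (lL x)) (lin0 (lR y)) addr0.
Qed.

Lemma view_l_deriv (X : tensor Der A) : is_deriv act_l1 act_r2 (view_l X).
Proof.
move: X; apply: tensor_ind => [|k X Y hX hY|d u].
- have -> : view_l (0 : tensor Der A) = fun=> 0.
    by apply/funext => x; rewrite (lin0 (view_l_linear _)).
  by apply: is_deriv0; [apply: act_l1_linear|apply: act_r2_linear].
- have -> : view_l (k *: X + Y) = fun x => k *: view_l X x + view_l Y x.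
    by apply/funext => x; rewrite view_l_linear.
  by apply: is_deriv_comb => //; [apply: act_l1_linear|apply: act_r2_linear].
have -> : view_l (d ⊗ u) = fun x => rcons3 ((d : dder B) x) u.
  by apply/funext => x; rewrite view_lE.
split.
- exact: lin_comp (rcons3_linear _) (dder_linear _).
- by move=> x y; rewrite dderM (linD (rcons3_linear _)) rcons3_outl rcons3_outr.
- by move=> v; rewrite dder_idem (lin0 (rcons3_linear _)).
Qed.

Lemma view_r_deriv (X : tensor A Der) : is_deriv act_l2 act_r3 (view_r X).
Proof.
move: X; apply: tensor_ind => [|k X Y hX hY|u d].
- have -> : view_r (0 : tensor A Der) = fun=> 0.
    by apply/funext => x; rewrite (lin0 (view_r_linear _)).
  by apply: is_deriv0; [apply: act_l2_linear|apply: act_r3_linear].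
- have -> : view_r (k *: X + Y) = fun x => k *: view_r X x + view_r Y x.
    by apply/funext => x; rewrite view_r_linear.
  by apply: is_deriv_comb => //; [apply: act_l2_linear|apply: act_r3_linear].
have -> : view_r (u ⊗ d) = fun x => u ⊗ (d : dder B) x.
  by apply/funext => x; rewrite view_rE.
split.
- exact: lin_comp (@tprod_r _ _ _ _) (dder_linear _).
- by move=> x y; rewrite dderM (linD (@tprod_r _ _ _ _)) act_r3E act_l2E.
- by move=> v; rewrite dder_idem (lin0 (@tprod_r _ _ _ _)).
Qed.

(* [view_l] is injective: [d ⊗ u] is recovered from the values
   [d(a)' ⊗ d(a)'' ⊗ u] as the sum over [a] of [d(a)'' ∂_a d(a)' ⊗ u]. *)
Lemma view_l_inj : injective (@view_l C A B).
Proof.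
pose f a u : tensor A A -> tensor Der A := tmap (fun v => qpartial a v u) id.
have lf a u : linear (f a u) by apply: tmap_linear (qpartial_l a u) (@lin_id _ _).
have fE a u v z : f a u (v ⊗ z) = qpartial a v u ⊗ z.
  by rewrite /f (tmapE (qpartial_l a u) (@lin_id _ _)).
have bf a : bilin (f a).
  split=> [u|t]; first exact: lf.
  move=> k u u'; move: t; apply: tensor_ext => // [|v z].
    by move=> c x y; rewrite !lf linswap.
  by rewrite !fE qpartial_r tprod_l.
pose g (F : A -> A3) : tensor Der A := \sum_a tlift (f a) (F (arrow C a)).
suff gK : cancel (@view_l C A B) g by exact: can_inj gK.
apply: tensor_ext => [||d u] //.
  apply: lin_bigsum => a; apply: lin_comp (view_l_linear _).
  exact: tlift_linear (bf a).
rewrite [in RHS](dder_expand d) (lin_sum (tprod_l u)); apply: eq_bigr => a _.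
rewrite view_lE; move: ((d : dder B) _); apply: tensor_ext.
- exact: lin_comp (tlift_linear (bf a)) (rcons3_linear u).
- exact: lin_comp (@tprod_l _ _ _ _) (tpartial_linear a).
- by move=> p q; rewrite rcons3E (tliftE (bf a)) fE tpartialE.
Qed.

(** Here the two factors coming from d stand together as the last two, so [tpartial] applies to them
    directly. *)
Lemma view_r_inj : injective (@view_r C A B).
Proof.
pose f u a : tensor A A -> tensor A Der := fun t => u ⊗ tpartial a t.
have bf a : bilin (fun u t => f u a t).
  exact: bilin_comp (tprod_bilin _ _) (@lin_id _ _) (tpartial_linear a).
pose g (F : A -> A3) : tensor A Der :=
  \sum_a tlift (fun u t => f u a t) (F (arrow C a)).
suff gK : cancel (@view_r C A B) g by exact: can_inj gK.
apply: tensor_ext => [||u d] //.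
  apply: lin_bigsum => a; apply: lin_comp (view_r_linear _).
  exact: tlift_linear (bf a).
rewrite [in RHS](dder_expand d) (lin_sum (tprod_r u)); apply: eq_bigr => a _.
by rewrite view_rE (tliftE (bf a)).
Qed.

End Triple.

(** * The double bracket on the path algebra of the double quiver *)

Section DoubleBracket.
Variables (C : fieldType) (Q : quiver).
Local Notation QQ := (double_quiver Q).
Local Notation P := (path_alg C QQ).
Local Notation el := (@pelt C QQ).
Local Notation deg := (@path_deg C Q).
Implicit Types (p q w : qpath QQ) (x y z : P) (t : tensor P P).

Definition starred (x : arr QQ) : bool := if x is inr _ then true else false.

Lemma pdeg_count p : pdeg p = count starred (parr p).
Proof. by []. Qed.

Lemma pdeg_cat p q (e : ptgt p == psrc q) : pdeg (pcat e) = (pdeg p + pdeg q)%N.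
Proof. by rewrite !pdeg_count /= count_cat. Qed.

Lemma pdeg_split p i (x : arr QQ) : onth (parr p) i = Some x ->
  pdeg p = (pdeg (ptake i p) + starred x + pdeg (pdrop i.+1 p))%N.
Proof.
move=> h; have hi := onth_size h; rewrite !pdeg_count.
rewrite -[in LHS](cat_take_drop i (parr p)) (drop_nth x hi) count_cat /=.
by rewrite (@onth_nth _ x _ _ _ h) addnA.
Qed.

Lemma deg_el p : deg (pdeg p) (el p).
Proof. exact/lspan_gen/homog_path_gen. Qed.

Lemma deg_elM p q : deg (pdeg p + pdeg q)%N (el p ∙ el q).
Proof.
have [e|n] := boolP (ptgt p == psrc q).
  by rewrite pelt_mul -(pdeg_cat e); apply: deg_el.
by rewrite pelt_mul0 //; left.
Qed.

Lemma degM m n x y : deg m x -> deg n y -> deg (m + n)%N (x ∙ y).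
Proof.
move=> hx hy; move: x hx; apply: lspan_map => [|x [p <-]]; first exact: mulr_lin.
move: y hy; apply: lspan_map => [|y [q <-]]; first exact: mull_lin.
exact: deg_elM.
Qed.

(* The summand of [{{w1, w2}}] for [w1 = p1 x q1], [w2 = p2 y q2] with [x] at
   position [i], [y] at position [j] and [{{x, y}} = e ⊗ e'] up to sign. *)
Definition dterm p q i j : tensor P P :=
  let p1 := ptake i p in let q1 := pdrop i.+1 p in
  let p2 := ptake j q in let q2 := pdrop j.+1 q in
  (el p2 ∙ el q1) ⊗ (el p1 ∙ el q2).

(* The sign of [kterm] for [x = a]; for [x = a^*], when [b] holds, antisymmetry
   adds [|q1| + 1]. *)
Definition dsign p q i j (b : bool) : C :=
  let p1 := ptake i p in let q1 := pdrop i.+1 p in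
  let p2 := ptake j q in
  sgn C (((pdeg p)%:Z - 1) * (pdeg p2)%:Z + (pdeg p1)%:Z * (pdeg q1)%:Z + 1
          + b%:Z * (pdeg q1)%:Z + b%:Z).

Definition pair_sum (V : zmodType) p q (x y : arr QQ) (F : nat -> nat -> V) : V :=
  pos_sum p x (fun i => pos_sum q y (fun j => F i j)).

Definition dbr_path p q : tensor P P := \sum_(a : arr Q)
  (pair_sum p q (inl a) (inr a) (fun i j => dsign p q i j false *: dterm p q i j)
  + pair_sum p q (inr a) (inl a) (fun i j => dsign p q i j true *: dterm p q i j)).

Definition dbr : P -> P -> tensor P P := fext2 dbr_path.

Lemma dbr_bilin : bilin dbr. Proof. exact: fext2_bilin. Qed.
Lemma dbrE p q : dbr (el p) (el q) = dbr_path p q. Proof. exact: fext2E. Qed.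

Lemma dsign_catl p v w (e : ptgt v == psrc w) i j b : (j < size (parr v))%N ->
  dsign p (pcat e) i j b = dsign p v i j b.
Proof. by move=> hj; rewrite /dsign ptake_catl. Qed.

(** The sign involves the second path only through its part before the cut. Prefixing v lengthens
    this part and contributes exactly the Leibniz sign, while a factor appended after the cut leaves
    the sign alone. *)
Lemma dsign_catr p v w (e : ptgt v == psrc w) i j b :
  dsign p (pcat e) i (size (parr v) + j)%N b
  = sgn C (((pdeg p)%:Z - 1) * (pdeg v)%:Z) * dsign p w i j b.
Proof.
rewrite sgnD; apply: sgn_eq.
have -> : pdeg (ptake (size (parr v) + j) (pcat e)) = (pdeg v + pdeg (ptake j w))%N.
  by rewrite !pdeg_count /parr /= -count_cat takeD take_size_cat // drop_size_cat.
rewrite PoszD mulrDr !oddzE; do !case: (odd _) => //; by case: b.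
Qed.

Lemma dterm_catl p v w (e : ptgt v == psrc w) i j : (j < size (parr v))%N ->
  dterm p (pcat e) i j = outr (dterm p v i j) (el w).
Proof.
by move=> hj; rewrite /dterm outrE ptake_catl // pdrop_catl // amulA.
Qed.

Lemma dterm_catr p v w (e : ptgt v == psrc w) i j :
  dterm p (pcat e) i (size (parr v) + j)%N = outl (el v) (dterm p w i j).
Proof. by rewrite /dterm outlE ptake_catr pdrop_catr amulA. Qed.

Lemma dbr_leibniz_path p v w : dbr (el p) (el v ∙ el w)
  = sgn C (((pdeg p)%:Z - 1) * (pdeg v)%:Z) *: outl (el v) (dbr (el p) (el w))
    + outr (dbr (el p) (el v)) (el w).
Proof.
set k := sgn C _.
have lL : linear (fun t => k *: outl (el v) t).
  exact: lin_scale (outl_linear _).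
have lR := outr_linear (el w).
(* The conditional supplies the composability proof needed to form v w, and the value 0 otherwise.
   In that second case the right-hand side vanishes too, since v and w still meet inside one tensor
   factor of each term. *)
have E (x y : arr QQ) b :
    (if ptgt v == psrc w =P true is ReflectT e then
       pair_sum p (pcat e) x y
         (fun i j => dsign p (pcat e) i j b *: dterm p (pcat e) i j)
     else 0) =
    k *: outl (el v) (pair_sum p w x y (fun i j => dsign p w i j b *: dterm p w i j))
    + outr (pair_sum p v x y (fun i j => dsign p v i j b *: dterm p v i j)) (el w).
  rewrite /pair_sum (pos_sum_lin _ _ _ lL) (pos_sum_lin _ _ _ lR) -pos_sum_add.
  case: eqP => [e|ne].
    apply: eq_pos_sum => i hi hx.
    rewrite (pos_sum_lin _ _ _ lL) (pos_sum_lin _ _ _ lR).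
    rewrite pos_sum_cat addrC; congr (_ + _); apply: eq_pos_sum => j hj _.
      by rewrite dsign_catr dterm_catr (linZ (outl_linear _)) scalerA.
    by rewrite dsign_catl // dterm_catl // (linZ lR).
  rewrite [RHS]big1 // => i _.
  rewrite (pos_sum_lin _ _ _ lL) (pos_sum_lin _ _ _ lR).
  rewrite /pos_sum !big1 ?addr0 // => j _;
    rewrite (linZ (outl_linear _), linZ lR) /dterm.
    rewrite outrE -amulA (@pelt_mul0 _ _ _ w) ?amulr0 ?(lin0 (tprod_r _)) ?scaler0 //.
    by rewrite ptgt_pdrop; apply/negP.
  rewrite outlE amulA (@pelt_mul0 _ _ v) ?amul0r ?(lin0 (tprod_l _)) ?scaler0 //.
  exact/negP.
have -> : dbr (el p) (el v ∙ el w) =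
    if ptgt v == psrc w =P true is ReflectT e then dbr_path p (pcat e) else 0.
  case: eqP => [e|/negP ne]; first by rewrite pelt_mul dbrE.
  by rewrite pelt_mul0 // (lin0 (bilin_r _ dbr_bilin)).
rewrite !dbrE /dbr_path (lin_sum lL) (lin_sum lR) -big_split.
(* Summation over b merges the two families of terms, a paired with a^* and a^* paired with a, so
   that [E] treats both at once. *)
transitivity (\sum_(a : arr Q) \sum_(b : bool)
  (if ptgt v == psrc w =P true is ReflectT e then
       pair_sum p (pcat e) (if b then inr a else inl a) (if b then inl a else inr a)
         (fun i j => dsign p (pcat e) i j b *: dterm p (pcat e) i j)
     else 0)).
  case: eqP => [e|ne]; last by rewrite !big1 // => a _; rewrite big1.
  by apply: eq_bigr => a _; rewrite big_bool addrC.
apply: eq_bigr => a _; rewrite big_bool /= !E.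
by rewrite (linD lL) (linD lR) addrC addrACA.
Qed.

Lemma dbr_leibniz m n x y z : deg m x -> deg n y ->
  dbr x (y ∙ z) = sgn C ((m%:Z - 1) * n%:Z) *: outl y (dbr x z) + outr (dbr x y) z.
Proof.
move=> hx hy; have [Lr Ll] := dbr_bilin.
set k := sgn C _.
move: x hx; apply: lspan_lin => [||x [p ep]].
- exact: Ll.
- apply: lin_add; last exact: lin_comp (outr_linear _) (Ll _).
  exact: (lin_scale _ (lin_comp (outl_linear _) (Ll _))).
move: y hy; apply: lspan_lin => [||y [q eq]].
- exact: lin_comp (Lr _) (mulr_lin _).
- apply: lin_add; last exact: lin_comp (outr_linear _) (Lr _).
  exact: lin_scale (outl_lin_l _).
move: z; apply: free_ext => [||w].
- exact: lin_comp (Lr _) (mull_lin _).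
- apply: lin_add (lin_scale _ (lin_comp (outl_linear _) (Lr _))) _.
  exact: (@outr_lin_r _ P).
by rewrite dbr_leibniz_path /k ep eq.
Qed.

(** The signed flip makes sense on all elements because the basis of paths is homogeneous. *)
Definition sflip_path (x y : P) : tensor P P :=
  fext2 (fun p q => sgn C ((pdeg p)%:Z * (pdeg q)%:Z) *: (el q ⊗ el p)) x y.
Definition sflip : tensor P P -> tensor P P := tlift sflip_path.

Lemma sflip_linear : linear sflip.
Proof. exact/tlift_linear/fext2_bilin. Qed.
Lemma sflipE p q :
  sflip (el p ⊗ el q) = sgn C ((pdeg p)%:Z * (pdeg q)%:Z) *: (el q ⊗ el p).
Proof. by rewrite /sflip tliftE; [exact: fext2E|exact: fext2_bilin]. Qed.

Lemma sflip_deg m n x y : deg m x -> deg n y ->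
  sflip (x ⊗ y) = sgn C (m%:Z * n%:Z) *: (y ⊗ x).
Proof.
set k := sgn C _ => hx hy.
move: x hx; apply: lspan_lin => [||x [p ep]].
- exact: lin_comp sflip_linear (tprod_l _).
- exact: lin_scale (@tprod_r _ _ _ _).
move: y hy; apply: lspan_lin => [||y [q eq]].
- exact: lin_comp sflip_linear (tprod_r _).
- exact: lin_scale (@tprod_l _ _ _ _).
by rewrite sflipE /k ep eq.
Qed.

Lemma exchange_pair (V : zmodType) p q (x y : arr QQ) (F : nat -> nat -> V) :
  pair_sum p q x y F = pair_sum q p y x (fun j i => F i j).
Proof. exact: exchange_big. Qed.

Lemma eq_pair_sum (V : zmodType) p q (x y : arr QQ) (F G : nat -> nat -> V) :
  (forall i j, onth (parr p) i = Some x -> onth (parr q) j = Some y ->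
     F i j = G i j) -> pair_sum p q x y F = pair_sum p q x y G.
Proof.
by move=> h; apply: eq_pos_sum => i _ hi; apply: eq_pos_sum => j _ hj; apply: h.
Qed.

Lemma pair_sum_lin (U V : lmodType C) (f : U -> V) p q (x y : arr QQ)
    (F : nat -> nat -> U) :
  linear f -> f (pair_sum p q x y F) = pair_sum p q x y (fun i j => f (F i j)).
Proof.
move=> lf; rewrite /pair_sum (pos_sum_lin _ _ _ lf).
by apply: eq_pos_sum => i _ _; rewrite (pos_sum_lin _ _ _ lf).
Qed.

(** Exchanging the two paths only exchanges the tensor factors p2 q1 and p1 q2, so signs alone are
    compared, as functions of the parities of the four pieces. The term |q1| + 1 of [dsign] for a
    starred first arrow is what makes them agree. *)
Lemma sflip_dterm p q i j (x y : arr QQ) :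
  onth (parr p) i = Some x -> onth (parr q) j = Some y ->
  starred x = ~~ starred y ->
  dsign p q i j (starred x) *: dterm p q i j =
  - (sgn C (((pdeg p)%:Z - 1) * ((pdeg q)%:Z - 1)) *:
     sflip (dsign q p j i (starred y) *: dterm q p j i)).
Proof.
move=> hx hy exy; rewrite /dterm (linZ sflip_linear).
rewrite (sflip_deg (deg_elM _ _) (deg_elM _ _)) !scalerA -scaleNr -!mulNr sgnN !sgnD.
congr (_ *: _); apply: sgn_eq; rewrite (pdeg_split hx) (pdeg_split hy) exy !PoszD.
rewrite !oddzE; case: (starred y) => /=; do !case: (odd _) => //.
Qed.

Lemma dbr_anti_path p q : dbr (el p) (el q) =
  - (sgn C (((pdeg p)%:Z - 1) * ((pdeg q)%:Z - 1)) *: sflip (dbr (el q) (el p))).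
Proof.
set k := sgn C _.
have lf : linear (fun t => - (k *: sflip t)).
  exact: lin_opp (lin_scale _ sflip_linear).
rewrite !dbrE /dbr_path (lin_sum lf); apply: eq_bigr => a _.
rewrite (linD lf) addrC !(pair_sum_lin _ _ _ _ _ lf); congr (_ + _).
  rewrite [RHS]exchange_pair; apply: eq_pair_sum => i j hi hj.
  exact: (sflip_dterm hi hj).
rewrite [RHS]exchange_pair; apply: eq_pair_sum => i j hi hj.
exact: (sflip_dterm hi hj).
Qed.

Lemma dbr_anti m n x y : deg m x -> deg n y -> dbr x y =
  - (sgn C ((m%:Z - 1) * (n%:Z - 1)) *: sflip (dbr y x)).
Proof.
set k := sgn C _ => hx hy; have [Lr Ll] := dbr_bilin.
have lf : linear (fun t => - (k *: sflip t)).
  exact: lin_opp (lin_scale _ sflip_linear).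
move: x hx; apply: lspan_lin => [||x [p ep]]; [exact: Ll|exact: lin_comp lf (Lr _)|].
move: y hy; apply: lspan_lin => [||y [q eq]]; [exact: Lr|exact: lin_comp lf (Ll _)|].
by rewrite dbr_anti_path /k ep eq.
Qed.

(** Every term removes some a from one path and a^* from the other, so at least one of the two paths
    has a starred arrow. *)
Lemma dbr_deg0 x y : deg 0 x -> deg 0 y -> dbr x y = 0.
Proof.
have [Lr Ll] := dbr_bilin.
move=> hx hy.
move: x hx; apply: (lspan_lin (Ll y) (@lin_zero _ _ _)) => _ [p ep].
move: y hy; apply: (lspan_lin (Lr _) (@lin_zero _ _ _)) => _ [q eq].
rewrite dbrE; apply: big1 => a _.
have ns w : pdeg w = 0%N -> forall F : nat -> tensor P P, pos_sum w (inr a) F = 0.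
  move=> h F; apply: big1 => i /eqP hi.
  by move: (pdeg_split hi); rewrite h /= addn1 addSn.
by rewrite /pair_sum ns // addr0; apply: big1 => i _; rewrite ns.
Qed.

Lemma pair_sum_arrow (x y x' y' : arr QQ) (V : zmodType) (F : nat -> nat -> V) :
  pair_sum (parrow x) (parrow y) x' y' F =
  if (x' == x) && (y' == y) then F 0%N 0%N else 0.
Proof. by rewrite /pair_sum !pos_sum_arrow; do 2!case: eqP. Qed.

Lemma dterm_arrow (x y : arr QQ) : hd x = tl y -> hd y = tl x ->
  dterm (parrow x) (parrow y) 0 0 = idem C (tl y) ⊗ idem C (tl x).
Proof.
move=> e1 e2; rewrite /dterm.
have -> : ptake 0 (parrow y) = pid (tl y) by apply: qpath_eq.
have -> : ptake 0 (parrow x) = pid (tl x) by apply: qpath_eq.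
have -> : pdrop 1 (parrow y) = pid (tl x) by apply: qpath_eq.
have -> : pdrop 1 (parrow x) = pid (tl y) by apply: qpath_eq.
by rewrite !idem_idem.
Qed.

(** This is the origin of the constant 1 in the sign: {{∂_a, a}} is to be e_{t(a)} ⊗ e_{h(a)}, and
    antisymmetry in degrees 1 and 0 then gives {{a, ∂_a}} the flipped value with a minus sign. *)
Lemma dbr_arrow_star a b :
  dbr (arrow C (inl a : arr QQ)) (arrow C (inr b : arr QQ)) =
  if a == b then - (idem C (hd a : vert QQ) ⊗ idem C (tl a : vert QQ)) else 0.
Proof.
rewrite dbrE /dbr_path (bigD1 a) //= big1 ?addr0 => [|c nc]; last first.
  rewrite !pair_sum_arrow /= addr0; case: eqP => //= -[/eqP].
  by rewrite (negPf nc).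
rewrite !pair_sum_arrow eqxx /= addr0.
have -> : (inr a == inr b :> arr QQ) = (a == b) by [].
case: eqP => // <-.
rewrite dterm_arrow // /dsign.
rewrite (@sgn_eq _ _ 1) ?oddzE //= /sgn -exprnP expr1 scaleN1r //.
Qed.

Lemma dbr_stars a b :
  dbr (arrow C (inr a : arr QQ)) (arrow C (inr b : arr QQ)) = 0.
Proof.
rewrite dbrE /dbr_path big1 // => c nc.
by rewrite !pair_sum_arrow andbF addr0.
Qed.

End DoubleBracket.

(** * Passage to the quotient by supercommutators *)

Section Superab.
Variables (C : fieldType) (A : algebra C) (deg : nat -> A -> Prop).
Local Notation pi := (@superab_pi C A deg).

Lemma superab_pi_linear : linear pi. Proof. exact: mpi_linear. Qed.

Lemma superab_piC m n (u v : A) : deg m u -> deg n v ->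
  pi (u ∙ v) = sgn C (m%:Z * n%:Z) *: pi (v ∙ u).
Proof.
move=> hu hv; rewrite -(linZ superab_pi_linear); apply/mpi_eq/lspan_gen.
exact: supercomm_gen.
Qed.

Lemma superab_lift (V : lmodType C) (f : A -> V) : linear f ->
  (forall m n u v, deg m u -> deg n v ->
     f (u ∙ v) = sgn C (m%:Z * n%:Z) *: f (v ∙ u)) ->
  forall x, f (mrepr (pi x)) = f x.
Proof.
move=> lf fC x; apply/eqP; rewrite -subr_eq0 -(linB lf); apply/eqP.
have /mpi_eq : mpi (supercomm deg) (mrepr (pi x)) = mpi (supercomm deg) x.
  exact: mreprK.
move: (_ - _) => y; apply: (lspan_lin lf (@lin_zero _ _ _)) => _ [m n u v hu hv].
by rewrite (linB lf) (linZ lf) -(fC _ _ _ _ hu hv) subrr.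
Qed.
End Superab.

(** * The Kontsevich bracket from the double bracket *)

Section NecklaceBracket.
Variables (C : fieldType) (Q : quiver).
Local Notation QQ := (double_quiver Q).
Local Notation P := (path_alg C QQ).
Local Notation el := (@pelt C QQ).
Local Notation deg := (@path_deg C Q).
Local Notation pi := (superab_pi deg).
Implicit Types (p q w : qpath QQ) (x y z : P).

(** Each term loses exactly one starred arrow. The truncated predecessor does no harm: for m = n = 0
    there are no terms. *)
Lemma dbr_deg m n x y : deg m x -> deg n y -> deg (m + n).-1 (tmul (@dbr C Q x y)).
Proof.
move=> hx hy; have [Lr Ll] := @dbr_bilin C Q; have lt := @tmul_linear C P.
move: x hx; apply: lspan_map => [|_ [p <-]]; first exact: lin_comp lt (Ll _).
move: y hy; apply: lspan_map => [|_ [q <-]]; first exact: lin_comp lt (Lr _).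
have termD i j (x y : arr QQ) : onth (parr p) i = Some x -> onth (parr q) j = Some y ->
    starred x = ~~ starred y -> deg (pdeg p + pdeg q).-1 (tmul (dterm C p q i j)).
  move=> hi hj exy; rewrite tmulE.
  have -> : (pdeg p + pdeg q).-1 = ((pdeg (ptake j q) + pdeg (pdrop i.+1 p))
      + (pdeg (ptake i p) + pdeg (pdrop j.+1 q)))%N.
    by rewrite (pdeg_split hi) (pdeg_split hj) exy; case: (starred y) => /=; lia.
  by apply: degM; apply: deg_elM.
have pairD (x y : arr QQ) b : starred x = ~~ starred y ->
  lspan (@homog_path C Q (pdeg p + pdeg q).-1) (tmul
    (pair_sum p q x y (fun i j => dsign C p q i j b *: dterm C p q i j))).
  move=> exy; rewrite (pair_sum_lin _ _ _ _ _ lt).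
  apply: lspan_sum => i /eqP hi; apply: lspan_sum => j /eqP hj.
  by rewrite (linZ lt); apply: lspanZ; apply: (termD i j x y).
rewrite dbrE /dbr_path (lin_sum lt); apply: lspan_sum => a _.
by rewrite (linD lt); apply: lspanD; apply: pairD.
Qed.

Definition kbr x y : necklace C Q := pi (tmul (dbr x y)).

Lemma kbr_bilin : bilin kbr.
Proof.
have lp := lin_comp (@superab_pi_linear C P deg) (@tmul_linear C P).
exact: bilin_lcomp (@dbr_bilin C Q) lp.
Qed.

(** The sign of the flip is the one of the supercommutator. Hence antisymmetry of the double bracket
    turns into graded antisymmetry of [kbr]. *)
Lemma pi_sflip (t : tensor P P) : pi (tmul (sflip t)) = pi (tmul t).
Proof.
have lp : linear (fun t : tensor P P => pi (tmul t)).
  exact: lin_comp (superab_pi_linear _) (@tmul_linear C P).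
move: t; apply: (tensor_ext (lin_comp lp (@sflip_linear C Q)) lp).
move=> x y; move: x; apply: free_ext.
- exact: lin_comp lp (lin_comp (@sflip_linear C Q) (tprod_l _)).
- exact: lin_comp lp (tprod_l _).
move=> p; move: y; apply: free_ext.
- exact: lin_comp lp (lin_comp (@sflip_linear C Q) (tprod_r _)).
- exact: lin_comp lp (tprod_r _).
move=> q; rewrite (@sflipE C Q) (linZ lp) !tmulE.
by rewrite [RHS](superab_piC (@deg_el C Q p) (@deg_el C Q q)).
Qed.

Lemma kbr_anti m n x y : deg m x -> deg n y ->
  kbr x y = - (sgn C ((m%:Z - 1) * (n%:Z - 1)) *: kbr y x).
Proof.
move=> hx hy; rewrite /kbr (dbr_anti hx hy).
have lp : linear (fun t : tensor P P => pi (tmul t)).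
  exact: lin_comp (superab_pi_linear _) (@tmul_linear C P).
by rewrite (linN lp) (linZ lp) pi_sflip.
Qed.

Lemma dbr_piC m n k x y z : deg m x -> deg n y -> deg k z ->
  pi (tmul (dbr x y) ∙ z) = sgn C ((m%:Z + n%:Z - 1) * k%:Z) *: pi (z ∙ tmul (dbr x y)).
Proof.
(* For m = n = 0 the integer m + n - 1 differs from the natural predecessor, but then the bracket is
   0. *)
move=> hx hy hz; case: m n hx hy => [[|n]|m n] hx hy.
- rewrite dbr_deg0 // (lin0 (@tmul_linear _ _)) amul0r amulr0.
  by rewrite (lin0 (@superab_pi_linear _ _ _)) scaler0.
- rewrite (superab_piC (dbr_deg hx hy) hz); congr (sgn C (_ * _) *: _); lia.
- rewrite (superab_piC (dbr_deg hx hy) hz); congr (sgn C (_ * _) *: _); lia.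
Qed.

(** The Leibniz rule gives two terms on each side, z or y standing once to the left and once to the
    right of a bracket. Modulo supercommutators, moving it across matches the first term of either
    side with the second of the other. *)
Lemma kbr_comm m n x y z : deg m y -> deg n z ->
  kbr x (y ∙ z) = sgn C (m%:Z * n%:Z) *: kbr x (z ∙ y).
Proof.
move=> hy hz; have [Lr Ll] := kbr_bilin.
move: x; apply: free_ext => [||p]; [exact: Ll|exact: lin_scale (Ll _)|].
have hp := deg_el C p.
have lp := @superab_pi_linear C P deg; have lt := @tmul_linear C P.
rewrite -/(pelt C p) /kbr (dbr_leibniz _ hp hy) (dbr_leibniz _ hp hz).
rewrite !(linD lt) !(linZ lt) !tmul_outl !tmul_outr !(linD lp) !(linZ lp).
rewrite (dbr_piC hp hy hz) (dbr_piC hp hz hy) scalerDr !scalerA addrC !sgnD.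
by congr (_ + _); apply: scale_sgn_eq; rewrite !oddzE;
  case: (odd m) (odd n) (odd (pdeg p)) => [] [] [].
Qed.

Lemma kbr_comml m n x y z : deg m y -> deg n z ->
  kbr (y ∙ z) x = sgn C (m%:Z * n%:Z) *: kbr (z ∙ y) x.
Proof.
move=> hy hz; have [Lr Ll] := kbr_bilin.
move: x; apply: free_ext => [||p]; [exact: Lr|exact: lin_scale (Lr _)|].
have hp := deg_el C p; rewrite -/(pelt C p).
rewrite (kbr_anti (degM hy hz) hp) (kbr_anti (degM hz hy) hp) (kbr_comm _ hy hz).
by rewrite scalerN !scalerA mulrC addnC.
Qed.

Definition nbr (u v : necklace C Q) : necklace C Q := kbr (mrepr u) (mrepr v).

Lemma nbrE x y : nbr (pi x) (pi y) = kbr x y.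
Proof.
have [Lr Ll] := kbr_bilin; rewrite /nbr.
rewrite (superab_lift (Lr _)); last by move=> m n u v; apply: kbr_comm.
by rewrite (superab_lift (Ll _)) // => m n u v; apply: kbr_comml.
Qed.

Lemma nbr_bilin : bilin nbr.
Proof.
have [Lr Ll] := kbr_bilin; have lp := @superab_pi_linear C P deg.
split=> u c v w; have [x ->] := mpi_surj u; have [y ->] := mpi_surj v;
  have [z ->] := mpi_surj w; rewrite -!/(pi _) -lp !nbrE; [exact: Lr|exact: Ll].
Qed.

Lemma nbr_kontsevich p q : nbr (pi (el p)) (pi (el q)) = pi (kontsevich C p q).
Proof.
have lp := @superab_pi_linear C P deg; have lt := @tmul_linear C P.
have lpt : linear (fun t => pi (tmul t)) by apply: lin_comp.
rewrite nbrE /kbr dbrE /dbr_path (lin_sum lpt) /kontsevich (lin_sum lp).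
apply: eq_bigr => a _; rewrite (linD lpt) (linD lp) !(pair_sum_lin _ _ _ _ _ lpt).
rewrite -[X in _ = pi X + _]/(pair_sum p q (inl a) (inr a) (kterm C p q)).
rewrite -[X in _ = _ + pi X]/(pair_sum p q (inr a) (inl a) (kterm_star C p q)).
rewrite !(pair_sum_lin _ _ _ _ _ lp).
congr (_ + _); apply: eq_pair_sum => i j hi hj; rewrite (linZ lpt) (linZ lp) tmulE.
  rewrite -amulA; congr (_ *: pi _); last by rewrite !amulA.
  by apply: sgn_eq; rewrite !oddzE !andFb !addbF.
(* In [kterm_star] the starting point is that of the first path: p2 q1 has to move past p1 q2, and
   the sign of this move turns [dsign] into the sign of [kterm_star]. *)
rewrite (superab_piC (deg_elM _ _ _) (deg_elM _ _ _)) scalerA sgnD.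
congr (_ *: pi _); last by rewrite !amulA.
apply: sgn_eq; rewrite (pdeg_split hi) (pdeg_split hj) /= !PoszD !oddzE.
rewrite -[odd 1]/true -[odd 0]/false.
case: (odd (pdeg (ptake i p))) (odd (pdeg (pdrop i.+1 p)))
  (odd (pdeg (ptake j q))) (odd (pdeg (pdrop j.+1 q))) => [] [] [] [] //.
Qed.

End NecklaceBracket.

(** * The tensor algebra as the path algebra of the double quiver *)

Section TensorAlgebraTheory.
Variables (C : fieldType) (A : algebra C) (M : lmodType C).
Variable act : A -> M -> A -> M.
Local Notation T := (talg act).
Local Notation word := (seq (A + M)%type).
Local Notation inA := (@talg_inA C A M act).
Local Notation inM := (@talg_inM C A M act).
Local Notation pi := (@talg_pi C A M act).

Lemma talg_pi_linear : linear (pi : free_alg A M -> T). Proof. exact: talg_piP. Qed.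
Lemma talg_piM (x y : free_alg A M) : pi (x ∙ y) = (pi x : T) ∙ pi y.
Proof. by rewrite -talg_mulE. Qed.
Lemma talg_pi_rel x y : talg_rel act (x - y) -> pi x = pi y.
Proof.
move=> h; apply/mpi_eq/lspan_gen.
by rewrite -[_ - _]amul1l -[_ ∙ _]amul1r; apply: talg_ideal_gen.
Qed.

Lemma inA_linear : linear (inA : A -> T).
Proof.
move=> c a b; rewrite /talg_inA -talg_pi_linear.
by apply: talg_pi_rel; apply: talg_rel_linA.
Qed.
Lemma inM_linear : linear (inM : M -> T).
Proof.
move=> c a b; rewrite /talg_inM -talg_pi_linear.
by apply: talg_pi_rel; apply: talg_rel_linM.
Qed.
Lemma inA1 : inA aone = aone :> T.
Proof. by apply: talg_pi_rel; apply: talg_rel_one. Qed.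
Lemma inA_M a b : inA (a ∙ b) = (inA a : T) ∙ inA b :> T.
Proof.
rewrite -[RHS]talg_piM.
by apply: talg_pi_rel; apply: talg_rel_mul.
Qed.
Lemma inM_act a m b : inM (act a m b) = (inA a : T) ∙ inM m ∙ inA b :> T.
Proof.
rewrite -[X in X ∙ _]talg_piM -[RHS]talg_piM.
by apply: talg_pi_rel; apply: talg_rel_act.
Qed.

Definition tletter (x : A + M) : T := pi (letter x).

Lemma talg_word_cons x w : pi (word_elt (x :: w)) = tletter x ∙ pi (word_elt w) :> T.
Proof.
rewrite -[RHS]talg_piM; congr pi.
by rewrite /letter /word_elt /= bmulE.
Qed.

Lemma talg_ind (P : T -> Prop) : P 0 ->
  (forall c x y, P x -> P y -> P (c *: x + y)) ->
  (forall w, P (pi (word_elt w))) -> forall x, P x.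
Proof.
move=> P0 PD Pw x; have [y ->] := talg_surj x.
move: y; apply: free_ind => //.
  by rewrite (lin0 talg_pi_linear).
by move=> c u v hu hv; rewrite talg_pi_linear; apply: PD.
Qed.

Lemma talg_word_ind (P : T -> Prop) : P aone ->
  (forall x y, P y -> P (tletter x ∙ y)) -> forall w, P (pi (word_elt w)).
Proof. by move=> P1 PM; elim=> // x w IH; rewrite talg_word_cons; apply: PM. Qed.

Lemma talg_deg_word w : talg_deg (word_deg w) (pi (word_elt w) : T).
Proof. exact/lspan_gen/talg_word_gen. Qed.
Lemma talg_deg1 : talg_deg 0 (aone : T).
Proof. exact: (talg_deg_word [::]). Qed.
Lemma talg_deg_inA a : talg_deg 0 (inA a : T).
Proof. exact: (talg_deg_word [:: inl a]). Qed.
Lemma talg_deg_inM m : talg_deg 1 (inM m : T).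
Proof. exact: (talg_deg_word [:: inr m]). Qed.

Lemma talg_degM m n (x y : T) : talg_deg m x -> talg_deg n y ->
  talg_deg (m + n)%N (x ∙ y).
Proof.
move=> hx hy; move: x hx; apply: lspan_map => [|_ [w <-]]; first exact: mulr_lin.
move: y hy; apply: lspan_map => [|_ [w' <-]]; first exact: mull_lin.
rewrite -[_ ∙ _]talg_piM /word_elt /= bmulE.
by apply: lspan_gen; rewrite /word_deg -count_cat; apply: talg_word_gen.
Qed.

Section Lift.
Variables (E : algebra C) (f : A -> E) (g : M -> E).
Hypotheses (lf : linear f) (f1 : f aone = aone) (fM : {morph f : x y / x ∙ y}).
Hypotheses (lg : linear g) (gact : forall a m b, g (act a m b) = f a ∙ g m ∙ f b).

Definition letter_val (x : A + M) : E := match x with inl a => f a | inr m => g m end.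
Definition word_val (w : word) : E := foldr (fun x e => letter_val x ∙ e) aone w.
Definition free_lift : free_alg A M -> E := fext word_val.
Definition talg_lift (t : T) : E := free_lift (mrepr t).

Lemma free_lift_linear : linear free_lift. Proof. exact: fext_linear. Qed.

Lemma free_lift1 : free_lift aone = aone.
Proof. exact: fextE. Qed.
Lemma free_lift_letter x : free_lift (letter x) = letter_val x.
Proof. by rewrite /free_lift /letter /word_elt fextE /= amul1r. Qed.

Lemma word_val_cat v w : word_val (v ++ w) = word_val v ∙ word_val w.
Proof. by elim: v => [|x v IH] /=; rewrite ?amul1l // IH amulA. Qed.

Lemma free_liftM : {morph free_lift : x y / x ∙ y}.
Proof.
have ll := free_lift_linear.
move=> x y; move: x; apply: free_ext.
- exact: lin_comp ll (mulr_lin _).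
- exact: lin_comp (mulr_lin _) ll.
move=> v; move: y; apply: free_ext.
- exact: lin_comp ll (mull_lin _).
- exact: lin_comp (mull_lin _) ll.
by move=> w; rewrite /free_lift /= bmulE !fextE word_val_cat.
Qed.

(** The five families of relations correspond one by one to the five hypotheses on f and g; this
    yields the universal property of the tensor algebra. *)
Lemma free_lift_rel r : talg_rel act r -> free_lift r = 0.
Proof.
have ll := free_lift_linear.
have vE := free_lift_letter.
case=> [|a b|c a b|c m n|a m b]; rewrite (linB ll) vE /=.
- by rewrite free_lift1 f1 subrr.
- by rewrite free_liftM !vE /= fM subrr.
- by rewrite ll !vE /= lf subrr.
- by rewrite ll !vE /= lg subrr.
- by rewrite !free_liftM !vE /= gact subrr.
Qed.

Lemma talg_lift_pi x : talg_lift (pi x) = free_lift x.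
Proof.
have ll := free_lift_linear.
apply/eqP; rewrite -subr_eq0 -(linB ll); apply/eqP.
have /mpi_eq : mpi (talg_ideal act) (mrepr (pi x)) = mpi (talg_ideal act) x.
  exact: mreprK.
move: (_ - _) => y; apply: (lspan_lin ll (@lin_zero _ _ _)) => _ [u r v hr].
by rewrite !free_liftM (free_lift_rel hr) amulr0 amul0r.
Qed.

Lemma talg_lift_linear : linear talg_lift.
Proof.
move=> c s t; have [x ->] := talg_surj s; have [y ->] := talg_surj t.
by rewrite -talg_piP !talg_lift_pi free_lift_linear.
Qed.
Lemma talg_liftM : {morph talg_lift : x y / x ∙ y}.
Proof.
move=> s t; have [x ->] := talg_surj s; have [y ->] := talg_surj t.
by rewrite -[_ ∙ _]talg_piM !talg_lift_pi free_liftM.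
Qed.
Lemma talg_lift_1 : talg_lift aone = aone.
Proof. by rewrite talg_lift_pi free_lift1. Qed.
Lemma talg_lift_inA a : talg_lift (inA a) = f a.
Proof. by rewrite talg_lift_pi free_lift_letter. Qed.
Lemma talg_lift_inM m : talg_lift (inM m) = g m.
Proof. by rewrite talg_lift_pi free_lift_letter. Qed.
End Lift.
End TensorAlgebraTheory.

Local Arguments amul : simpl never.

(** * The mutually inverse algebra maps *)

Section Iso.
Variables (C : fieldType) (Q : quiver).
Local Notation QQ := (double_quiver Q).
Local Notation A := (path_alg C Q).
Local Notation P := (path_alg C QQ).
Local Notation B := (@vertex_idem C Q).
Local Notation Der := (Der B).
Local Notation T := (TDer C Q).
Local Notation inA := (@inA C A B : A -> T).
Local Notation inD := (@inD C A B : Der -> T).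
Local Notation deg := (@path_deg C Q).

Lemma TinA_linear : linear inA. Proof. exact: inA_linear. Qed.
Lemma TinAM : {morph inA : x y / x ∙ y}. Proof. exact: inA_M. Qed.
Lemma TinA1 : inA aone = aone. Proof. exact: inA1. Qed.
Lemma TinD_linear : linear inD. Proof. exact: inM_linear. Qed.
Lemma TinD_act x (d : Der) y : inD (dder_bimod x d y) = inA x ∙ inD d ∙ inA y.
Proof. exact: inM_act. Qed.

Lemma walk_inl (v : vert Q) (s : seq (arr Q)) :
  @walk QQ v (map inl s) = walk v s.
Proof. by elim: s v => //= a s IH v; rewrite IH. Qed.
Lemma walk_end_inl (v : vert Q) (s : seq (arr Q)) :
  @walk_end QQ v (map inl s) = walk_end v s.
Proof. by rewrite /walk_end -map_comp. Qed.

Lemma pemb_proof (p : qpath Q) : @walk QQ (psrc p) (map inl (parr p)).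
Proof. by rewrite walk_inl; apply: (valP p). Qed.
Definition pemb (p : qpath Q) : qpath QQ := mkpath (pemb_proof p).

Definition emb : A -> P := fext (fun p => pelt C (pemb p)).
Lemma emb_linear : linear emb. Proof. exact: fext_linear. Qed.
Lemma emb_pelt p : emb (pelt C p) = pelt C (pemb p). Proof. exact: fextE. Qed.

Lemma ptgt_emb (p : qpath Q) : ptgt (pemb p) = ptgt p.
Proof. exact: walk_end_inl. Qed.

Lemma embM : {morph emb : x y / x ∙ y}.
Proof.
move=> x y; move: x; apply: free_ext.
- exact: lin_comp emb_linear (mulr_lin _).
- exact: lin_comp (mulr_lin _) emb_linear.
move=> p; move: y; apply: free_ext.
- exact: lin_comp emb_linear (mull_lin _).
- exact: lin_comp (mull_lin _) emb_linear.
move=> q; rewrite -!/(pelt C _) !emb_pelt.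
have [e|n] := boolP (ptgt p == psrc q).
  have e' : ptgt (pemb p) == psrc (pemb q) by rewrite ptgt_emb.
  rewrite !pelt_mul emb_pelt; congr (pelt C _); apply: qpath_eq => //.
  by rewrite /parr /= map_cat.
by rewrite !pelt_mul0 ?(lin0 emb_linear) // ptgt_emb.
Qed.

Lemma emb_idem v : emb (idem C v) = idem C (v : vert QQ).
Proof. by rewrite emb_pelt; congr (pelt C _); apply: qpath_eq. Qed.
Lemma emb_arrow a : emb (arrow C a) = arrow C (inl a : arr QQ).
Proof. by rewrite emb_pelt; congr (pelt C _); apply: qpath_eq. Qed.
Lemma emb1 : emb aone = aone.
Proof.
by rewrite !aone_pid (lin_sum emb_linear); apply: eq_bigr => v _; apply: emb_idem.
Qed.

Definition star a : P := arrow C (inr a : arr QQ).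

Definition eval_star a : tensor A A -> P := tlift (fun p q => emb q ∙ star a ∙ emb p).
Lemma eval_star_bilin a : bilin (fun p q => emb q ∙ star a ∙ emb p).
Proof.
split=> [p|q]; last exact: lin_comp (mull_lin _) emb_linear.
exact: lin_comp (mulr_lin _) (lin_comp (mulr_lin _) emb_linear).
Qed.
Lemma eval_star_linear a : linear (eval_star a).
Proof. exact: tlift_linear (eval_star_bilin a). Qed.
Lemma eval_starE a p q : eval_star a (p ⊗ q) = emb q ∙ star a ∙ emb p.
Proof. exact: tliftE (eval_star_bilin a) p q. Qed.

(** Reading the symbol off the values d(a), instead of prescribing it on the elements q ∂_a p,
    avoids any question of well-definedness. *)
Definition dsymb (d : Der) : P := \sum_a eval_star a ((d : dder B) (arrow C a)).

Lemma dsymb_linear : linear dsymb.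
Proof. by apply: lin_bigsum => a k d e; rewrite dderD dderZ eval_star_linear. Qed.

Lemma dsymb_qpartial a p q : dsymb (qpartial a q p) = emb q ∙ star a ∙ emb p.
Proof.
rewrite /dsymb (bigD1 a isT) big1 => [|b nb]; last first.
  by rewrite qpartialE eq_sym (negPf nb) (lin0 (eval_star_linear _)).
rewrite [LHS]addr0 qpartialE eqxx eval_starE !embM !emb_idem -!amulA; congr (_ ∙ _).
by rewrite !amulA (idem_arrow C (inr a : arr QQ)) (arrow_idem C (inr a : arr QQ)).
Qed.

Lemma dsymb_act x (d : Der) y : dsymb (dder_bimod x d y) = emb x ∙ dsymb d ∙ emb y.
Proof.
have lact : linear (fun d : Der => dder_bimod x d y : Der).
  move=> k u v; apply: dder_ext => b.
  exact: (inner_linear x y).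
have lL : linear (fun d : Der => dsymb (dder_bimod x d y)) := lin_comp dsymb_linear lact.
have lR : linear (fun d : Der => emb x ∙ dsymb d ∙ emb y).
  exact: lin_comp (mulr_lin _) (lin_comp (mull_lin _) dsymb_linear).
move: d; apply: Der_ind => [|k d e hd he|a p q _ _].
- by rewrite (lin0 lL) (lin0 lR).
- by rewrite lL lR hd he.
- by rewrite qpartial_act !dsymb_qpartial !embM !amulA.
Qed.

Definition Phi : T -> P := talg_lift emb dsymb.
Lemma Phi_linear : linear Phi.
Proof. exact: talg_lift_linear emb_linear emb1 embM dsymb_linear dsymb_act. Qed.
Lemma PhiM : {morph Phi : x y / x ∙ y}.
Proof. exact: talg_liftM emb_linear emb1 embM dsymb_linear dsymb_act. Qed.
Lemma Phi1 : Phi aone = aone.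
Proof. exact: talg_lift_1 emb_linear emb1 embM dsymb_linear dsymb_act. Qed.
Lemma Phi_inA a : Phi (inA a) = emb a.
Proof. exact: talg_lift_inA emb_linear emb1 embM dsymb_linear dsymb_act _. Qed.
Lemma Phi_inD d : Phi (inD d) = dsymb d.
Proof. exact: talg_lift_inM emb_linear emb1 embM dsymb_linear dsymb_act _. Qed.

Lemma inD_qpartial a q p : inD (qpartial a q p) = inA q ∙ inD (partial C a) ∙ inA p.
Proof. exact: TinD_act. Qed.

Definition Psi_arrow (x : arr QQ) : T :=
  match x with inl a => inA (arrow C a) | inr a => inD (partial C a) end.

(** The trailing idempotent gives the trivial path its image and is absorbed by the last arrow of
    any other path. *)
Fixpoint Psi_seq v (s : seq (arr QQ)) : T :=
  if s is x :: s' then Psi_arrow x ∙ Psi_seq (hd x) s' else inA (idem C v).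

Definition Psi : P -> T := fext (fun p : qpath QQ => Psi_seq (psrc p) (parr p)).
Lemma Psi_linear : linear Psi. Proof. exact: fext_linear. Qed.
Lemma Psi_pelt p : Psi (pelt C p) = Psi_seq (psrc p) (parr p).
Proof. exact: fextE. Qed.

(** The inner action exchanges the two sides, so ∂_a runs from h(a) to t(a), exactly as a^* does. *)
Lemma partial_idem (a : arr Q) : dder_bimod (idem C (hd a)) (partial C a) (idem C (tl a))
  = partial C a.
Proof.
apply: dder_ext => b; rewrite -[LHS]/(inner _ (partial C a (arrow C b)) _).
rewrite partial_arrow; case: eqP => _; last by rewrite (lin0 (inner_linear _ _)).
by rewrite innerE !idem_idem.
Qed.

Lemma Psi_arrow_l (x : arr QQ) : inA (idem C (tl x : vert Q)) ∙ Psi_arrow x = Psi_arrow x.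
Proof.
case: x => a /=; first by rewrite -TinAM idem_arrow.
by rewrite -[partial C a]partial_idem TinD_act !amulA -TinAM idem_idem.
Qed.

Lemma Psi_arrow_r (x : arr QQ) : Psi_arrow x ∙ inA (idem C (hd x : vert Q)) = Psi_arrow x.
Proof.
case: x => a /=; first by rewrite -TinAM arrow_idem.
by rewrite -[partial C a]partial_idem TinD_act -!amulA -TinAM idem_idem.
Qed.

Lemma Psi_seq_l (v : vert Q) s : @walk QQ v s -> inA (idem C v) ∙ Psi_seq v s = Psi_seq v s.
Proof.
case: s => [_|x s /= /andP[/eqP <- _]]; last by rewrite amulA Psi_arrow_l.
by rewrite /= -TinAM; congr inA; apply: idem_idem.
Qed.

Lemma Psi_idem (v : vert Q) : Psi (idem C (v : vert QQ)) = inA (idem C v).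
Proof. exact: Psi_pelt. Qed.

Lemma Psi_arrowE (x : arr QQ) : Psi (arrow C x) = Psi_arrow x.
Proof. by rewrite Psi_pelt /= Psi_arrow_r. Qed.

Lemma Psi1 : Psi aone = aone.
Proof.
rewrite aone_pid (lin_sum Psi_linear) -TinA1 aone_pid (lin_sum TinA_linear).
by apply: eq_bigr => v _; rewrite Psi_idem.
Qed.

Lemma PsiM : {morph Psi : x y / x ∙ y}.
Proof.
move=> x y; move: x; apply: free_ext.
- exact: lin_comp Psi_linear (mulr_lin _).
- exact: lin_comp (mulr_lin _) Psi_linear.
move=> p; move: y; apply: free_ext.
- exact: lin_comp Psi_linear (mull_lin _).
- exact: lin_comp (mull_lin _) Psi_linear.
move=> q; rewrite -!/(pelt C _) !Psi_pelt.
(* With the starting vertex w left free, the induction also covers products that must vanish; it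
   ends at the junction, where distinct idempotents are orthogonal. *)
have cat (v : vert Q) s (w : vert Q) t : @walk QQ v s -> @walk QQ w t ->
    Psi_seq v s ∙ Psi_seq w t = if @walk_end QQ v s == w then Psi_seq v (s ++ t) else 0.
  elim: s v => [|x s IH] v /=.
    move=> _ wt; rewrite /walk_end /=; case: eqP => [->|/eqP ne]; first exact: Psi_seq_l.
    rewrite -(Psi_seq_l wt) amulA -TinAM (@pelt_mul0 _ _ (pid v) (pid w)) //.
    by rewrite (lin0 TinA_linear) amul0r.
  by case/andP => _ ws wt; rewrite -amulA IH // (fun_if (amul _)) amulr0.
rewrite cat ?(valP p) ?(valP q) // -/(ptgt p); case: eqP => [/eqP e|/eqP n].
  by rewrite pelt_mul Psi_pelt.
by rewrite pelt_mul0 // (lin0 Psi_linear).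
Qed.

Lemma Psi_emb x : Psi (emb x) = inA x.
Proof.
move: x; apply: free_ext.
- exact: lin_comp Psi_linear emb_linear.
- exact: TinA_linear.
apply: (path_mul_ind (P := fun x => Psi (emb x) = inA x)) => [v|a p IH].
  by rewrite emb_idem Psi_idem.
by rewrite embM PsiM IH emb_arrow Psi_arrowE -TinAM.
Qed.

Lemma Psi_dsymb d : Psi (dsymb d) = inD d.
Proof.
have lL := lin_comp Psi_linear dsymb_linear.
move: d; apply: Der_ind => [|k d e hd he|a p q _ _].
- by rewrite (lin0 lL) (lin0 TinD_linear).
- by rewrite lL hd he TinD_linear.
- by rewrite dsymb_qpartial !PsiM !Psi_emb Psi_arrowE inD_qpartial.
Qed.

Lemma PhiK : cancel Phi Psi.
Proof.
apply: (talg_ind (P := fun x => Psi (Phi x) = x)) => [|c x y hx hy|].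
- by rewrite (lin0 Phi_linear) (lin0 Psi_linear).
- by rewrite Phi_linear Psi_linear hx hy.
apply: (talg_word_ind (P := fun x => Psi (Phi x) = x)) => [|x y hy].
  by rewrite Phi1 Psi1.
rewrite PhiM PsiM hy; congr (_ ∙ _).
by case: x => [a|d]; rewrite /tletter ?(Phi_inA, Phi_inD) ?(Psi_emb, Psi_dsymb).
Qed.

Lemma PsiK : cancel Psi Phi.
Proof.
apply: free_ext => //; first exact: lin_comp Phi_linear Psi_linear.
apply: (path_mul_ind (P := fun x => Phi (Psi x) = x)) => [v|x p IH].
  by rewrite Psi_idem Phi_inA emb_idem.
rewrite PsiM PhiM IH Psi_arrowE; congr (_ ∙ _).
case: x => a; first by rewrite Phi_inA emb_arrow.
rewrite Phi_inD -[partial C a]partial_idem dsymb_qpartial !emb_idem.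
by rewrite (idem_arrow C (inr a : arr QQ)) (arrow_idem C (inr a : arr QQ)).
Qed.

Lemma emb_deg x : deg 0 (emb x).
Proof.
move: x; apply: path_alg_ind => [|c x y hx hy|p].
- by rewrite (lin0 emb_linear); left.
- by rewrite emb_linear; apply: lspanD => //; apply: lspanZ.
rewrite emb_pelt.
suff e : pdeg (pemb p) = 0%N by have := deg_el C (pemb p); rewrite e.
rewrite pdeg_count /parr /= count_map; apply/eqP.
by rewrite -leqn0 leqNgt -has_count has_pred0.
Qed.

Lemma star_deg a : deg 1 (star a).
Proof. exact: (deg_el C (parrow (inr a : arr (double_quiver Q)))). Qed.

Lemma dsymb_deg d : deg 1 (dsymb d).
Proof.
move: d; apply: Der_ind => [|k d e hd he|a p q _ _].
- by rewrite (lin0 dsymb_linear); left.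
- by rewrite dsymb_linear; apply: lspanD => //; apply: lspanZ.
rewrite dsymb_qpartial.
exact: degM (degM (emb_deg _) (star_deg a)) (emb_deg _).
Qed.

Lemma Phi_deg n x : TDer_deg n x -> deg n (Phi x).
Proof.
apply: lspan_map => [|_ [w <-]]; first exact: Phi_linear.
elim: w => [|y w IH].
  rewrite -[X in Phi X]/(aone : T) Phi1 aone_pid.
  by apply: lspan_sum => v _; apply: (deg_el C (pid (v : vert QQ))).
rewrite talg_word_cons PhiM.
case: y => [a|d].
- by rewrite [Phi (tletter _ _)]Phi_inA; apply: degM (emb_deg a) IH.
- by rewrite [Phi (tletter _ _)]Phi_inD; apply: degM (dsymb_deg d) IH.
Qed.

Lemma Psi_deg n x : deg n x -> TDer_deg n (Psi x).
Proof.
apply: lspan_map => [|_ [p <-]]; first exact: Psi_linear.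
rewrite Psi_pelt pdeg_count; elim: (parr p) (psrc p) => [|y s IH] v.
  exact: talg_deg_inA.
apply: talg_degM (IH _); case: y => a; [exact: talg_deg_inA|exact: talg_deg_inM].
Qed.

End Iso.

(** * The double Schouten bracket *)

Section Existence.
Variables (C : fieldType) (Q : quiver).
Local Notation QQ := (double_quiver Q).
Local Notation A := (path_alg C Q).
Local Notation P := (path_alg C QQ).
Local Notation B := (@vertex_idem C Q).
Local Notation Der := (Der B).
Local Notation T := (TDer C Q).
Local Notation inA := (@inA C A B : A -> T).
Local Notation inD := (@inD C A B : Der -> T).
Local Notation deg := (@TDer_deg C Q).
Local Notation Phi := (@Phi C Q).
Local Notation Psi := (@Psi C Q).
Implicit Types (u v w : T) (x y p q r s : A) (d e : Der).

Definition dsch u v : tensor T T := tmap Psi Psi (dbr (Phi u) (Phi v)).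
Definition tflip (t : tensor T T) : tensor T T :=
  tmap Psi Psi (sflip (tmap Phi Phi t)).

Let lPP : linear (tmap Psi Psi).
Proof. exact: tmap_linear (@Psi_linear C Q) (@Psi_linear C Q). Qed.
Let lFF : linear (tmap Phi Phi).
Proof. exact: tmap_linear (@Phi_linear C Q) (@Phi_linear C Q). Qed.

Lemma dsch_bilin : bilin dsch.
Proof.
have lF := @Phi_linear C Q.
exact: bilin_lcomp (bilin_comp (@dbr_bilin C Q) lF lF) lPP.
Qed.

Lemma tflip_linear : linear tflip.
Proof. exact: lin_comp lPP (lin_comp (@sflip_linear C Q) lFF). Qed.

Lemma tflipE m n u v : deg m u -> deg n v ->
  tflip (u ⊗ v) = sgn C (m%:Z * n%:Z) *: (v ⊗ u).
Proof.
move=> hu hv; rewrite /tflip (tmapE (@Phi_linear C Q) (@Phi_linear C Q)).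
rewrite (sflip_deg (Phi_deg hu) (Phi_deg hv)) (linZ lPP).
by rewrite (tmapE (@Psi_linear C Q) (@Psi_linear C Q)) !PhiK.
Qed.

Lemma dsch_leibniz m n u v w : deg m u -> deg n v ->
  dsch u (v ∙ w) = sgn C ((m%:Z - 1) * n%:Z) *: outl v (dsch u w)
                   + outr (dsch u v) w.
Proof.
move=> hu hv; rewrite /dsch PhiM (dbr_leibniz _ (Phi_deg hu) (Phi_deg hv)).
rewrite lPP (tmap_outl (@Psi_linear C Q) (@PsiM C Q)).
by rewrite (tmap_outr (@Psi_linear C Q) (@PsiM C Q)) !PhiK.
Qed.

Lemma dsch_anti m n u v : deg m u -> deg n v ->
  dsch u v = - (sgn C ((m%:Z - 1) * (n%:Z - 1)) *: tflip (dsch v u)).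
Proof.
move=> hu hv; rewrite /dsch (dbr_anti (Phi_deg hu) (Phi_deg hv)).
rewrite (linN lPP) (linZ lPP) /tflip.
have lF := @Phi_linear C Q; have lP := @Psi_linear C Q.
by rewrite (tmap_comp lP lP lF lF) (tmap_id (@PsiK C Q) (@PsiK C Q)).
Qed.

Lemma deg_inA x : deg 0 (inA x). Proof. exact: talg_deg_inA. Qed.
Lemma deg_inD d : deg 1 (inD d). Proof. exact: talg_deg_inM. Qed.

Lemma dsch_AA x y : dsch (inA x) (inA y) = 0.
Proof. by rewrite /dsch !Phi_inA dbr_deg0 ?(lin0 lPP) //; apply: emb_deg. Qed.

Lemma dsch_idem u i : dsch u (inA (idem C i)) = 0.
Proof.
rewrite /dsch Phi_inA emb_idem; move: (Phi u) => z; move: z.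
have lL : linear (fun z => tmap Psi Psi (dbr z (idem C (i : vert QQ)))).
  exact: lin_comp lPP (bilin_l _ (@dbr_bilin C Q)).
apply: (free_ext lL (@lin_zero _ _ _)) => p.
rewrite [dbr _ _]dbrE /dbr_path big1 ?(lin0 lPP) // => a _.
by rewrite exchange_pair (exchange_pair p _ (inr a)) /pair_sum !pos_sum_pid addr0.
Qed.

Lemma Phi_partial (a : arr Q) : Phi (inD (partial C a)) = star C a.
Proof.
rewrite Phi_inD -[partial C a]partial_idem dsymb_qpartial !emb_idem.
by rewrite (idem_arrow C (inr a : arr QQ)) (arrow_idem C (inr a : arr QQ)).
Qed.

Lemma dsch_partials (a b : arr Q) : dsch (inD (partial C a)) (inD (partial C b)) = 0.
Proof. by rewrite /dsch !Phi_partial dbr_stars (lin0 lPP). Qed.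

Lemma dsch_leibniz1 n d v w : deg n v ->
  dsch (inD d) (v ∙ w) = outl v (dsch (inD d) w) + outr (dsch (inD d) v) w.
Proof.
by move=> hv; rewrite (dsch_leibniz _ (deg_inD d) hv) subrr mul0r sgn0 scale1r.
Qed.

Lemma dsch_leibniz0 x y w :
  dsch (inA x) (inA y ∙ w) = outl (inA y) (dsch (inA x) w).
Proof.
rewrite (dsch_leibniz _ (deg_inA x) (deg_inA y)) dsch_AA mulr0 sgn0 scale1r.
by rewrite (lin0 (outr_linear _)) addr0.
Qed.

Local Notation iAA := (tmap inA inA).
Local Notation iDA := (tmap inD inA).
Local Notation iAD := (tmap inA inD).
Lemma tinAA_linear : linear iAA.
Proof. exact: tmap_linear (@TinA_linear C Q) (@TinA_linear C Q). Qed.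
Lemma tinDA_linear : linear iDA.
Proof. exact: tmap_linear (@TinD_linear C Q) (@TinA_linear C Q). Qed.
Lemma tinAD_linear : linear iAD.
Proof. exact: tmap_linear (@TinA_linear C Q) (@TinD_linear C Q). Qed.
Lemma tinAAE x y : iAA (x ⊗ y) = inA x ⊗ inA y.
Proof. exact: tmapE (@TinA_linear C Q) (@TinA_linear C Q) _ _. Qed.
Lemma tinDAE d y : iDA (d ⊗ y) = inD d ⊗ inA y.
Proof. exact: tmapE (@TinD_linear C Q) (@TinA_linear C Q) _ _. Qed.
Lemma tinADE d y : iAD (y ⊗ d) = inA y ⊗ inD d.
Proof. exact: tmapE (@TinA_linear C Q) (@TinD_linear C Q) _ _. Qed.

Lemma tflip_AA x y : tflip (inA x ⊗ inA y) = inA y ⊗ inA x.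
Proof. by rewrite (tflipE (deg_inA x) (deg_inA y)) mulr0 sgn0 scale1r. Qed.

Lemma dsch_partial_arrow (a b : arr Q) : dsch (inD (partial C a)) (inA (arrow C b))
  = iAA (partial C a (arrow C b)).
Proof.
rewrite (dsch_anti (deg_inD _) (deg_inA _)) subrr mul0r sgn0 scale1r.
rewrite /dsch Phi_partial Phi_inA emb_arrow dbr_arrow_star eq_sym partial_arrow.
case: eqP => [->|_]; last by rewrite (lin0 lPP) (lin0 tflip_linear) (lin0 tinAA_linear) oppr0.
rewrite (linN lPP) (tmapE (@Psi_linear C Q) (@Psi_linear C Q)) !Psi_idem.
by rewrite (linN tflip_linear) tflip_AA opprK tinAAE.
Qed.

(** In x both sides are derivations into the tensor square of the tensor algebra, with A acting
    through [inA], so the arrows decide. *)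
Lemma dsch_partialE (a : arr Q) x :
  dsch (inD (partial C a)) (inA x) = iAA (partial C a x).
Proof.
have [Dr Dl] := dsch_bilin.
pose L x (t : tensor T T) := outl (inA x) t.
pose R (t : tensor T T) x := outr t (inA x).
suff h : (fun x => dsch (inD (partial C a)) (inA x))
         = (fun x => iAA (partial C a x)) by exact: (congr1 (@^~ x) h).
apply: (@deriv_ext _ _ _ L R); last exact: dsch_partial_arrow.
- split; first exact: lin_comp (Dr _) (@TinA_linear C Q).
    by move=> y z; rewrite TinAM (dsch_leibniz1 _ _ (deg_inA y)) addrC.
  by move=> i; apply: dsch_idem.
- split; first exact: lin_comp tinAA_linear (dder_linear _).
    move=> y z; rewrite dderM (linD tinAA_linear).
    by rewrite (tmap_outl (@TinA_linear C Q) (@TinAM C Q))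
      (tmap_outr (@TinA_linear C Q) (@TinAM C Q)).
  by move=> i; rewrite dder_idem (lin0 tinAA_linear).
Qed.

Lemma dsch_DA d x : dsch (inD d) (inA x) = iAA ((d : dder B) x).
Proof.
have [Dr Dl] := dsch_bilin.
have lL : linear (fun d : Der => dsch (inD d) (inA x)).
  exact: lin_comp (Dl _) (@TinD_linear C Q).
have lR : linear (fun d : Der => iAA ((d : dder B) x)).
  by apply: lin_comp tinAA_linear _ => k e f.
move: d; apply: Der_ind => [|k d e hd he|a p q _ _].
- by rewrite (lin0 lL) (lin0 lR).
- by rewrite lL hd he lR.
(* The Leibniz rule acts on the second argument, so antisymmetry brings q ∂_a p there. Conjugation
   by the flip then turns the outer multiplications by q and p into the inner ones that define q ∂_a
   p. *)
rewrite (dsch_anti (deg_inD _) (deg_inA _)) subrr mul0r sgn0 scale1r.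
rewrite inD_qpartial -amulA dsch_leibniz0.
rewrite (dsch_leibniz _ (deg_inA _) (deg_inD _)) dsch_AA (lin0 (outl_linear _)).
rewrite scaler0 add0r (dsch_anti (deg_inA _) (deg_inD _)) subrr mulr0 sgn0 scale1r.
rewrite dsch_partialE -[RHS]/(iAA (inner q (partial C a x) p)).
move: (partial C a x) => t.
rewrite (linN (outr_linear _)) (linN (outl_linear _)) (linN tflip_linear) opprK.
have lI := lin_comp tinAA_linear (inner_linear q p).
have lF := lin_comp tflip_linear (lin_comp (outl_linear (inA q))
  (lin_comp (outr_linear (inA p)) (lin_comp tflip_linear tinAA_linear))).
move: t; apply: (tensor_ext lF lI) => y z.
by rewrite tinAAE tflip_AA outrE outlE innerE tinAAE !TinAM -!TinAM tflip_AA.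
Qed.

Lemma tflip_DA d x : tflip (inD d ⊗ inA x) = inA x ⊗ inD d.
Proof. by rewrite (tflipE (deg_inD d) (deg_inA x)) mulr0 sgn0 scale1r. Qed.
Lemma tflip_AD d x : tflip (inA x ⊗ inD d) = inD d ⊗ inA x.
Proof. by rewrite (tflipE (deg_inA x) (deg_inD d)) mul0r sgn0 scale1r. Qed.

(** Views, brackets and [dsch] are linear in d and in e, so the existence of X and Y is preserved by
    linear combinations in either argument. This reduces it to d = q ∂_a p and e = s ∂_b r. *)
Definition bracket_witness d e := exists X Y,
  [/\ view_l X = dder_bracket_l d e, view_r Y = dder_bracket_r d e
    & dsch (inD d) (inD e) = iDA X + iAD Y].

Lemma pre_bracket_linear_l (e : dder B) x : linear (fun d : Der => pre_bracket d e x).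
Proof.
move=> k d d'; rewrite /pre_bracket.
have -> : ext_l (k *: d + d' : dder B) (e x)
    = k *: ext_l (d : dder B) (e x) + ext_l (d' : dder B) (e x).
  have le (f : Der) := ext_l_linear (dder_linear f).
  move: (e x); apply: tensor_ext => [||y z]; first exact: le.
    exact: lin_add (lin_scale _ (le d)) (le d').
  rewrite !(ext_lE _ _ (dder_linear _)) dderD dderZ.
  by rewrite (rcons3_linear z).
rewrite dderD dderZ (ext_r_linear (dder_linear e)) opprD scalerBr.
by rewrite -!addrA; congr (_ + _); rewrite addrCA.
Qed.

Lemma pre_bracket_linear_r (d : dder B) x : linear (fun e : Der => pre_bracket d e x).
Proof.
move=> k e e'; rewrite /pre_bracket.
have -> : ext_r (k *: e + e' : dder B) (d x)
    = k *: ext_r (e : dder B) (d x) + ext_r (e' : dder B) (d x).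
  have le (f : Der) := ext_r_linear (dder_linear f).
  move: (d x); apply: tensor_ext => [||y z]; first exact: le.
    exact: lin_add (lin_scale _ (le e)) (le e').
  rewrite !(ext_rE _ _ (dder_linear _)) dderD dderZ.
  by rewrite (tprod_r y).
rewrite dderD dderZ (ext_l_linear (dder_linear d)) opprD scalerBr.
by rewrite -!addrA; congr (_ + _); rewrite addrCA.
Qed.

Lemma bracket_l_linear_l (e : dder B) x : linear (fun d : Der => dder_bracket_l d e x).
Proof. exact: lin_comp (@tau23_linear C Q) (pre_bracket_linear_l e x). Qed.
Lemma bracket_l_linear_r (d : dder B) x : linear (fun e : Der => dder_bracket_l d e x).
Proof. exact: lin_comp (@tau23_linear C Q) (pre_bracket_linear_r d x). Qed.
Lemma bracket_r_linear_l (e : dder B) x : linear (fun d : Der => dder_bracket_r d e x).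
Proof.
move=> k d d'; rewrite !bracket_rE.
exact: (lin_opp (lin_comp (@tau12_linear C Q) (pre_bracket_linear_r e x))).
Qed.
Lemma bracket_r_linear_r (d : dder B) x : linear (fun e : Der => dder_bracket_r d e x).
Proof.
move=> k e e'; rewrite !bracket_rE.
exact: (lin_opp (lin_comp (@tau12_linear C Q) (pre_bracket_linear_l d x))).
Qed.

Lemma bracket_witness_l e : bracket_witness 0 e /\
  forall k d d', bracket_witness d e -> bracket_witness d' e ->
  bracket_witness (k *: d + d') e.
Proof.
have lD : linear (fun d : Der => dsch (inD d) (inD e)).
  exact: lin_comp (bilin_l _ dsch_bilin) (@TinD_linear C Q).
split=> [|k d d' [X [Y [hX hY hD]]] [X' [Y' [hX' hY' hD']]]].
  exists 0, 0; split; last by rewrite (lin0 lD) (lin0 tinDA_linear) (lin0 tinAD_linear) addr0.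
  - apply/funext => x.
    by rewrite (lin0 (view_l_linear _)) (lin0 (bracket_l_linear_l _ _)).
  - apply/funext => x.
    by rewrite (lin0 (view_r_linear _)) (lin0 (bracket_r_linear_l _ _)).
exists (k *: X + X'), (k *: Y + Y'); split.
- by apply/funext => x; rewrite view_l_linear bracket_l_linear_l hX hX'.
- by apply/funext => x; rewrite view_r_linear bracket_r_linear_l hY hY'.
- by rewrite lD hD hD' tinDA_linear tinAD_linear scalerDr addrACA.
Qed.

Lemma bracket_witness_r d : bracket_witness d 0 /\
  forall k e e', bracket_witness d e -> bracket_witness d e' ->
  bracket_witness d (k *: e + e').
Proof.
have lD : linear (fun e : Der => dsch (inD d) (inD e)).
  exact: lin_comp (bilin_r _ dsch_bilin) (@TinD_linear C Q).
split=> [|k e e' [X [Y [hX hY hD]]] [X' [Y' [hX' hY' hD']]]].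
  exists 0, 0; split; last by rewrite (lin0 lD) (lin0 tinDA_linear) (lin0 tinAD_linear) addr0.
  - apply/funext => x.
    by rewrite (lin0 (view_l_linear _)) (lin0 (bracket_l_linear_r _ _)).
  - apply/funext => x.
    by rewrite (lin0 (view_r_linear _)) (lin0 (bracket_r_linear_r _ _)).
exists (k *: X + X'), (k *: Y + Y'); split.
- by apply/funext => x; rewrite view_l_linear bracket_l_linear_r hX hX'.
- by apply/funext => x; rewrite view_r_linear bracket_r_linear_r hY hY'.
- by rewrite lD hD hD' tinDA_linear tinAD_linear scalerDr addrACA.
Qed.

End Existence.

(** * Values on arrows of elements of Der ⊗ A and A ⊗ Der *)

Section Views.
Variables (C : fieldType) (Q : quiver).
Local Notation A := (path_alg C Q).
Local Notation B := (@vertex_idem C Q).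
Local Notation Der := (Der B).
Implicit Types (x y p q r s : A) (d e : Der) (t : tensor A A) (a b c : arr Q).

Lemma qpartial_flip_bilin_l a p : bilin (fun u v => qpartial a v p ⊗ u : tensor Der A).
Proof.
split=> [u|v]; last exact: tprod_r.
exact: lin_comp (tprod_l _) (qpartial_l a p).
Qed.
Lemma qpartial_flip_bilin_r a q : bilin (fun u v => v ⊗ qpartial a q u : tensor A Der).
Proof.
split=> [u|v]; first exact: tprod_l.
exact: lin_comp (tprod_r _) (qpartial_r a q).
Qed.

(** This and the next three formulas treat the four pieces of the bracket of d = q ∂_a p with e = s
    ∂_b r; they are applied with t equal to d(r), e(q), d(s) and e(p) respectively. *)
Lemma view_l_qpartial b s t c : s ∙ idem C (hd b) = s ->
  view_l (tmap (qpartial b s) id t) (arrow C c) =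
  if b == c then tau23 (rcons3 (outl (idem C (tl b)) t) s) else 0.
Proof.
move=> hs; have lq := qpartial_r b s; have li := @lin_id _ A.
move: t; apply: tensor_ext.
- exact: lin_comp (view_l_linear _) (tmap_linear lq li).
- case: eqP => _; last exact: lin_zero.
  exact: lin_comp (@tau23_linear C Q) (lin_comp (rcons3_linear s) (outl_linear _)).
move=> u v; rewrite (tmapE lq li) view_lE qpartialE outlE rcons3E tau23E hs.
by case: eqP => _; rewrite ?rcons3E ?(lin0 (rcons3_linear _)).
Qed.

Lemma view_l_qpartial_flip a p t c : idem C (tl a) ∙ p = p ->
  view_l (tlift (fun u v => qpartial a v p ⊗ u) t) (arrow C c) =
  if a == c then tau23 (p ⊗ outr t (idem C (hd a))) else 0.
Proof.
move=> hp; have bq := qpartial_flip_bilin_l a p.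
move: t; apply: tensor_ext.
- exact: lin_comp (view_l_linear _) (tlift_linear bq).
- case: eqP => _; last exact: lin_zero.
  exact: lin_comp (@tau23_linear C Q) (lin_comp (tprod_r p) (outr_linear _)).
move=> u v; rewrite (tliftE bq) view_lE qpartialE outrE tau23E hp.
by case: eqP => _; rewrite ?rcons3E ?(lin0 (rcons3_linear _)).
Qed.

Lemma view_r_qpartial b r t c : idem C (tl b) ∙ r = r ->
  view_r (tmap id (fun v => qpartial b v r) t) (arrow C c) =
  if b == c then tau12 (r ⊗ outr t (idem C (hd b))) else 0.
Proof.
move=> hr; have lq := qpartial_l b r; have li := @lin_id _ A.
move: t; apply: tensor_ext.
- exact: lin_comp (view_r_linear _) (tmap_linear li lq).
- case: eqP => _; last exact: lin_zero.
  exact: lin_comp (@tau12_linear C Q) (lin_comp (tprod_r r) (outr_linear _)).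
move=> u v; rewrite (tmapE li lq) view_rE qpartialE outrE tau12E hr.
by case: eqP => _; rewrite ?(lin0 (tprod_r _)).
Qed.

Lemma view_r_qpartial_flip a q t c : q ∙ idem C (hd a) = q ->
  view_r (tlift (fun u v => v ⊗ qpartial a q u) t) (arrow C c) =
  if a == c then tau12 (rcons3 (outl (idem C (tl a)) t) q) else 0.
Proof.
move=> hq; have bq := qpartial_flip_bilin_r a q.
move: t; apply: tensor_ext.
- exact: lin_comp (view_r_linear _) (tlift_linear bq).
- case: eqP => _; last exact: lin_zero.
  exact: lin_comp (@tau12_linear C Q) (lin_comp (rcons3_linear q) (outl_linear _)).
move=> u v; rewrite (tliftE bq) view_rE qpartialE outlE rcons3E tau12E hq.
by case: eqP => _; rewrite ?(lin0 (tprod_r _)).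
Qed.

End Views.

(** * The bracket of two double derivations *)

Section Schouten.
Variables (C : fieldType) (Q : quiver).
Local Notation QQ := (double_quiver Q).
Local Notation A := (path_alg C Q).
Local Notation P := (path_alg C QQ).
Local Notation B := (@vertex_idem C Q).
Local Notation Der := (Der B).
Local Notation T := (TDer C Q).
Local Notation inA := (@inA C A B : A -> T).
Local Notation inD := (@inD C A B : Der -> T).
Local Notation deg := (@TDer_deg C Q).
Local Notation iAA := (tmap inA inA).
Local Notation iDA := (tmap inD inA).
Local Notation iAD := (tmap inA inD).
Local Notation dsch := (@dsch C Q).
Local Notation tflip := (@tflip C Q).
Implicit Types (u v w : T) (x y p q r s : A) (d e : Der).

(** On an arrow, d is p ⊗ q or 0 and e is r ⊗ s or 0, so each composite reduces to one application
    of d or e to a coefficient of the other. *)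
Lemma bracket_l_arrow (a b c : arr Q) p q r s :
  idem C (tl a) ∙ p = p -> q ∙ idem C (hd a) = q ->
  idem C (tl b) ∙ r = r -> s ∙ idem C (hd b) = s ->
  let d := qpartial a q p : dder B in let e := qpartial b s r : dder B in
  dder_bracket_l d e (arrow C c) =
    (if b == c then tau23 (rcons3 (d r) s) else 0)
    - (if a == c then tau23 (p ⊗ e q) else 0).
Proof.
move=> hp hq hr hs d e; rewrite /dder_bracket_l (linB (@tau23_linear C Q)).
rewrite [e (arrow C c)]qpartialE [d (arrow C c)]qpartialE hp hq hr hs.
have ld := dder_linear d; have le := dder_linear e.
by do 2!case: eqP => _; rewrite ?(ext_lE _ _ ld) ?(ext_rE _ _ le)
  ?(lin0 (ext_l_linear ld)) ?(lin0 (ext_r_linear le)) ?(lin0 (@tau23_linear C Q)).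
Qed.

Lemma bracket_r_arrow (a b c : arr Q) p q r s :
  idem C (tl a) ∙ p = p -> q ∙ idem C (hd a) = q ->
  idem C (tl b) ∙ r = r -> s ∙ idem C (hd b) = s ->
  let d := qpartial a q p : dder B in let e := qpartial b s r : dder B in
  dder_bracket_r d e (arrow C c) =
    (if b == c then tau12 (r ⊗ d s) else 0)
    - (if a == c then tau12 (rcons3 (e p) q) else 0).
Proof.
move=> hp hq hr hs d e; rewrite /dder_bracket_r (linB (@tau12_linear C Q)).
rewrite [e (arrow C c)]qpartialE [d (arrow C c)]qpartialE hp hq hr hs.
have ld := dder_linear d; have le := dder_linear e.
by do 2!case: eqP => _; rewrite ?(ext_lE _ _ le) ?(ext_rE _ _ ld)
  ?(lin0 (ext_l_linear le)) ?(lin0 (ext_r_linear ld)) ?(lin0 (@tau12_linear C Q)).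
Qed.

Lemma bracket_witness_qpartial (a b : arr Q) p q r s :
  idem C (tl a) ∙ p = p -> q ∙ idem C (hd a) = q ->
  idem C (tl b) ∙ r = r -> s ∙ idem C (hd b) = s ->
  bracket_witness (qpartial a q p) (qpartial b s r).
Proof.
move=> hp hq hr hs; set d := qpartial a q p; set e := qpartial b s r.
(* The witnesses are what the Leibniz rule produces. Expanding {{d, s ∂_b r}} gives d(r) in X1, d(s)
   in Y1 and the term s {{d, ∂_b}} r; by antisymmetry the latter comes from {{∂_b, q ∂_a p}}, which
   gives e(q) in X2 and e(p) in Y2, both with a minus sign. *)
pose X1 := tmap (qpartial b s) id ((d : dder B) r).
pose X2 := tlift (fun u v : A => qpartial a v p ⊗ u) ((e : dder B) q).
pose Y1 := tmap id (fun v : A => qpartial b v r) ((d : dder B) s).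
pose Y2 := tlift (fun u v : A => v ⊗ qpartial a q u) ((e : dder B) p).
have bl := qpartial_flip_bilin_l a p; have br := qpartial_flip_bilin_r a q.
have lq1 := qpartial_r b s; have lq2 := qpartial_l b r; have li := @lin_id _ A.
exists (X1 - X2), (Y1 - Y2); split.
- apply: (deriv_ext (view_l_deriv _) (bracket_l_deriv _ _)) => c.
  rewrite (linB (view_l_linear _)) (view_l_qpartial _ _ hs) -dder_idem_l hr.
  by rewrite (view_l_qpartial_flip _ _ hp) -dder_idem_r hq bracket_l_arrow.
- apply: (deriv_ext (view_r_deriv _) (bracket_r_deriv _ _)) => c.
  rewrite (linB (view_r_linear _)) (view_r_qpartial _ _ hr) -dder_idem_r hs.
  by rewrite (view_r_qpartial_flip _ _ hq) -dder_idem_l hp bracket_r_arrow.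
have DX1 : outl (inA s ∙ inD (partial C b)) (iAA ((d : dder B) r)) = iDA X1.
  rewrite /X1; move: ((d : dder B) r); apply: tensor_ext.
  - exact: lin_comp (outl_linear _) (@tinAA_linear C Q).
  - exact: lin_comp (@tinDA_linear C Q) (tmap_linear lq1 li).
  by move=> u v; rewrite (tmapE lq1 li) tinAAE tinDAE outlE inD_qpartial.
have DY1 : outr (outr (iAA ((d : dder B) s)) (inD (partial C b))) (inA r) = iAD Y1.
  rewrite /Y1; move: ((d : dder B) s); apply: tensor_ext.
  - exact: lin_comp (outr_linear _) (lin_comp (outr_linear _) (@tinAA_linear C Q)).
  - exact: lin_comp (@tinAD_linear C Q) (tmap_linear li lq2).
  by move=> u v; rewrite (tmapE li lq2) tinAAE tinADE !outrE inD_qpartial.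
(* By definition e(q) is ∂_b(q) multiplied by s and r on the inner sides; the flip makes these sides
   the outer ones. *)
have DX2 : outr (outl (inA s) (tflip (outr (outr (iAA (partial C b q))
    (inD (partial C a))) (inA p)))) (inA r) = iDA X2.
  rewrite /X2 -[(e : dder B) q]/(inner s (partial C b q) r).
  move: (partial C b q); apply: tensor_ext.
  - apply: lin_comp (outr_linear _) (lin_comp (outl_linear _) _).
    apply: lin_comp (@tflip_linear C Q) (lin_comp (outr_linear _) _).
    exact: lin_comp (outr_linear _) (@tinAA_linear C Q).
  - exact: lin_comp (@tinDA_linear C Q) (lin_comp (tlift_linear bl) (inner_linear _ _)).
  move=> u v; rewrite innerE (tliftE bl) tinAAE tinDAE !outrE -inD_qpartial tflip_AD.
  by rewrite outlE outrE !TinAM !inD_qpartial !TinAM !amulA.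
have DY2 : outr (outl (inA s) (tflip (outl (inA q ∙ inD (partial C a))
    (iAA (partial C b p))))) (inA r) = iAD Y2.
  rewrite /Y2 -[(e : dder B) p]/(inner s (partial C b p) r).
  move: (partial C b p); apply: tensor_ext.
  - apply: lin_comp (outr_linear _) (lin_comp (outl_linear _) _).
    exact: lin_comp (@tflip_linear C Q) (lin_comp (outl_linear _) (@tinAA_linear C Q)).
  - exact: lin_comp (@tinAD_linear C Q) (lin_comp (tlift_linear br) (inner_linear _ _)).
  move=> u v; rewrite innerE (tliftE br) tinAAE tinADE outlE -inD_qpartial tflip_DA.
  by rewrite outlE outrE !TinAM !inD_qpartial !TinAM !amulA.
(* The middle Leibniz term drops out because {{∂_b, ∂_a}} = 0. *)
have Dd : dsch (inD (partial C b)) (inD d) =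
    outl (inA q ∙ inD (partial C a)) (iAA (partial C b p))
    + outr (outr (iAA (partial C b q)) (inD (partial C a))) (inA p).
  rewrite inD_qpartial (dsch_leibniz1 _ _ (n := 1)); last first.
    exact: talg_degM (deg_inA q) (deg_inD _).
  rewrite (dsch_leibniz1 _ _ (deg_inA q)) !dsch_partialE dsch_partials.
  by rewrite (lin0 (outl_linear _)) add0r.
rewrite [inD e]inD_qpartial (dsch_leibniz1 _ _ (n := 1)); last first.
  exact: talg_degM (deg_inA s) (deg_inD _).
rewrite (dsch_leibniz1 _ _ (deg_inA s)) !dsch_DA DX1.
rewrite (linD (outr_linear _)) DY1 (dsch_anti (deg_inD _) (deg_inD _)).
rewrite subrr mul0r sgn0 scale1r Dd (linN (outl_linear _)) (linN (outr_linear _)).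
rewrite (linD (@tflip_linear C Q)) (linD (outl_linear _)) (linD (outr_linear _)).
rewrite DX2 DY2 (linB (@tinDA_linear C Q)) (linB (@tinAD_linear C Q)) opprD.
by rewrite -!addrA; congr (_ + _); rewrite addrC -!addrA addrC -!addrA.
Qed.

Lemma dsch_DD d e : bracket_witness d e.
Proof.
have [r0 rD] := bracket_witness_r d; move: e; apply: (Der_ind r0 rD) => b r s hr hs.
have [l0 lD] := bracket_witness_l (qpartial b s r).
move: d {r0 rD}; apply: (Der_ind l0 lD) => a p q hp hq.
exact: bracket_witness_qpartial.
Qed.

Lemma dsch_double_schouten : quiver_schouten dsch.
Proof.
split.
- exact: dsch_bilin.
- exact: dsch_AA.
- exact: dsch_DA.
- exact: dsch_DD.
- by move=> m n k u v w hu hv _; apply: dsch_leibniz.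
- exists tflip; first by split; [exact: tflip_linear|exact: tflipE].
  by move=> m n u v; apply: dsch_anti.
Qed.

(** * Uniqueness of the double Schouten bracket *)

Section Uniqueness.
Variables (D1 D2 : T -> T -> tensor T T).
Hypotheses (S1 : quiver_schouten D1) (S2 : quiver_schouten D2).
Local Notation letter := (@tletter C A Der (@dder_bimod C A B)).
Local Notation word w := (talg_pi (@dder_bimod C A B) (word_elt w) : T).

(** Each bracket brings its own flip from [ds_anti]. Words are homogeneous and span, so the flips
    coincide and antisymmetry can be compared between two brackets. *)
Lemma superflip_uniq (s1 s2 : tensor T T -> tensor T T) :
  is_superflip s1 -> is_superflip s2 -> s1 =1 s2.
Proof.
case=> l1 E1 [l2 E2]; apply: (tensor_ext l1 l2) => u v.
move: u; apply: talg_ind => [|k x y hx hy|w].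
- by rewrite (lin0 (tprod_l _)) (lin0 l1) (lin0 l2).
- by rewrite (tprod_l _) l1 l2 hx hy.
move: v; apply: talg_ind => [|k x y hx hy|w'].
- by rewrite (lin0 (tprod_r _)) (lin0 l1) (lin0 l2).
- by rewrite (tprod_r _) l1 l2 hx hy.
by rewrite (E1 _ _ _ _ (talg_deg_word _ w) (talg_deg_word _ w'))
  (E2 _ _ _ _ (talg_deg_word _ w) (talg_deg_word _ w')).
Qed.

Lemma schouten_swap m n u v : deg m u -> deg n v ->
  D1 u v = D2 u v -> D1 v u = D2 v u.
Proof.
move=> hu hv; have [s1 f1 A1] := ds_anti S1; have [s2 f2 A2] := ds_anti S2.
by move=> E; rewrite (A1 _ _ _ _ hv hu) (A2 _ _ _ _ hv hu) E (superflip_uniq f1 f2).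
Qed.

(** The Leibniz rule for 1 = 1 · 1 makes the value equal to its double. *)
Lemma schouten1 D m u : quiver_schouten D -> deg m u -> D u aone = 0.
Proof.
move=> S hu; have h1 := @talg_deg1 C A Der (@dder_bimod C A B).
have := ds_leibniz S hu h1 h1; rewrite amul1l mulr0 sgn0 scale1r outl1 outr1.
by move/eqP; rewrite -[X in X == _]addr0 (inj_eq (addrI _)) => /eqP <-.
Qed.

Lemma schouten_word m u : deg m u -> (forall l, D1 u (letter l) = D2 u (letter l)) ->
  forall ls, D1 u (word ls) = D2 u (word ls).
Proof.
move=> hu h; elim=> [|l ls IH].
  by rewrite [LHS](schouten1 S1 hu) [RHS](schouten1 S2 hu).
have hl : deg (word_deg [:: l]) (letter l) := talg_deg_word _ [:: l].
have hw := talg_deg_word (@dder_bimod C A B) ls.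
rewrite talg_word_cons (ds_leibniz S1 hu hl hw) (ds_leibniz S2 hu hl hw).
by rewrite h IH.
Qed.

Lemma schouten_letter l l' : D1 (letter l) (letter l') = D2 (letter l) (letter l').
Proof.
case: l l' => [x|d] [y|e].
- exact: etrans (ds_AA S1 _ _) (esym (ds_AA S2 _ _)).
- apply: (schouten_swap (deg_inD e) (deg_inA x)).
  exact: etrans (ds_DA S1 _ _) (esym (ds_DA S2 _ _)).
- exact: etrans (ds_DA S1 _ _) (esym (ds_DA S2 _ _)).
(* Each bracket comes with its own pair of tensors; equal views force the pairs to be equal. *)
have [x [y [hx hy E]]] := ds_DD S1 d e; have [x' [y' [hx' hy' E']]] := ds_DD S2 d e.
apply: etrans E (etrans _ (esym E')).
have -> : x = x' by apply: (@view_l_inj C Q); rewrite hx hx'.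
by have -> : y = y' by apply: (@view_r_inj C Q); rewrite hy hy'.
Qed.

(** The Leibniz rule lengthens only the second argument. Agreement therefore passes from two letters
    to a letter and a word, is swapped by antisymmetry, and then passes to two words. *)
Lemma schouten_uniq : D1 = D2.
Proof.
have b1 := ds_bilin S1; have b2 := ds_bilin S2.
apply/funext => u; apply/funext => v; move: u v.
have lw l ls : D1 (letter l) (word ls) = D2 (letter l) (word ls).
  exact: (schouten_word (talg_deg_word _ [:: l])) (schouten_letter l) ls.
have wl ls l : D1 (word ls) (letter l) = D2 (word ls) (letter l).
  exact: schouten_swap (talg_deg_word _ [:: l]) (talg_deg_word _ ls) (lw l ls).
have ww ls ls' : D1 (word ls) (word ls') = D2 (word ls) (word ls').
  exact: (schouten_word (talg_deg_word _ ls)) (wl ls) ls'.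
move=> u v; move: u; apply: talg_ind => [|k x y hx hy|w].
- by rewrite (lin0 (bilin_l v b1)) (lin0 (bilin_l v b2)).
- by rewrite (bilin_l v b1) (bilin_l v b2) hx hy.
move: v; apply: talg_ind => [|k x y hx hy|w']; last exact: ww.
- by rewrite (lin0 (bilin_r _ b1)) (lin0 (bilin_r _ b2)).
- by rewrite (bilin_r _ b1) (bilin_r _ b2) hx hy.
Qed.
End Uniqueness.

(** * The isomorphism of the quotients by supercommutators *)

Definition phi (u : TDer_ab C Q) : necklace C Q :=
  superab_pi (@path_deg C Q) (@Phi C Q (mrepr u)).
Definition psi (u : necklace C Q) : TDer_ab C Q :=
  superab_pi (@TDer_deg C Q) (@Psi C Q (mrepr u)).

Lemma phi_pi u : phi (superab_pi deg u) = superab_pi (@path_deg C Q) (@Phi C Q u).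
Proof.
have lp := @superab_pi_linear C P (@path_deg C Q).
apply: (superab_lift (f := fun u => superab_pi _ (@Phi C Q u))).
  exact: lin_comp lp (@Phi_linear C Q).
move=> m n x y hx hy; rewrite !PhiM.
exact: superab_piC (Phi_deg hx) (Phi_deg hy).
Qed.

Lemma psi_pi (z : P) : psi (superab_pi (@path_deg C Q) z) = superab_pi deg (@Psi C Q z).
Proof.
have lp := @superab_pi_linear C T deg.
apply: (superab_lift (f := fun z => superab_pi _ (@Psi C Q z))).
  exact: lin_comp lp (@Psi_linear C Q).
move=> m n x y hx hy; rewrite !PsiM.
exact: superab_piC (Psi_deg hx) (Psi_deg hy).
Qed.

Lemma phi_linear : linear phi.
Proof.
move=> k u v; have [x ->] := mpi_surj u; have [y ->] := mpi_surj v.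
rewrite -!/(superab_pi _ _) -(@superab_pi_linear C T deg) !phi_pi Phi_linear.
exact: superab_pi_linear.
Qed.

Lemma phiK : cancel phi psi.
Proof.
by move=> u; have [x ->] := mpi_surj u; rewrite -!/(superab_pi _ _) phi_pi psi_pi PhiK.
Qed.
Lemma psiK : cancel psi phi.
Proof.
by move=> u; have [x ->] := mpi_surj u; rewrite -!/(superab_pi _ _) psi_pi phi_pi PsiK.
Qed.

Lemma phi_deg n (u : TDer_ab C Q) : TDer_ab_deg n u <-> necklace_deg n (phi u).
Proof.
split=> [[x hx ->]|[z hz e]].
  by exists (@Phi C Q x); [apply: Phi_deg|rewrite phi_pi].
exists (@Psi C Q z); first exact: Psi_deg.
by rewrite -psi_pi -e phiK.
Qed.

End Schouten.

Theorem theorem1 (C : closedFieldType) (charC : [pchar C]%R =i pred0)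
    (Q : quiver) :
  exists (D : TDer C Q -> TDer C Q -> tensor (TDer C Q) (TDer C Q))
         (br : TDer_ab C Q -> TDer_ab C Q -> TDer_ab C Q)
         (brN : necklace C Q -> necklace C Q -> necklace C Q)
         (phi : TDer_ab C Q -> necklace C Q),
    [/\ unique (@quiver_schouten C Q) D,
        quiver_induced D br,
        kontsevich_bracket brN
      & graded_lie_iso (@TDer_ab_deg C Q) (@necklace_deg C Q) br brN phi].
Proof.
(* The bracket on the left is transported from necklaces, which makes compatibility with [phi]
   immediate; the content moves to showing that it is induced by [dsch]. *)
exists (@dsch C Q), (fun u v => psi (nbr (phi u) (phi v))), (@nbr C Q), (@phi C Q).
split.
- split; first exact: dsch_double_schouten.
  move=> D hD; exact: schouten_uniq (@dsch_double_schouten C Q) hD.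
- move=> u v; rewrite [phi _]phi_pi [phi (superab_pi _ v)]phi_pi nbrE [LHS]psi_pi.
  by rewrite -(tmul_tmap (@Psi_linear C Q) (@PsiM C Q)).
- by split; [exact: nbr_bilin|move=> p q _ _; apply: nbr_kontsevich].
- split; [exact: phi_linear|exists (@psi C Q); [exact: phiK|exact: psiK]| |].
    exact: phi_deg.
  by move=> u v; rewrite psiK.
Qed.
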